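(* Let $n\geqslant1$. For every $\varpi\in S_n$, $$\sum_{w\in L(\varpi)}\mathfrak{D}_w(X,Y)=\mathfrak{S}_{\varpi^*}(\omega_0X,-Y),$$ where $\varpi^*=\omega_0\varpi\omega_0$ and $L(\varpi)=\{w\in\varpi H\mid\ell(w)=\ell(\varpi)\}$, with $H$ the normal subgroup of $\widetilde W_n$ consisting of the elements equal to $(1,\ldots,n)$ in absolute value.
   Context: $X=(x_1,\ldots,x_n)$, $Y=(y_1,\ldots,y_n)$ are commuting independent variables. $\omega_0=(n,n-1,\ldots,1)$ is the longest element of $S_n$, and $f(\omega_0X,-Y)$ denotes $f(x_n,\ldots,x_1,-y_1,\ldots,-y_n)$. Weyl group of type $D_n$. $\widetilde W_n$ is the group of signed permutations of $\{1,\ldots,n\}$ (a bar denotes a negative entry) with an even number of bars, generated by simple transpositions $s_i$ ($1\leqslant i\leqslant n-1$; right multiplication interchanges the entries in positions $i,i+1$), which generate $S_n\subset\widetilde W_n$, and $s_\Box$, with $(u_1,u_2,\ldots,u_n)s_\Box=(\overline{u}_2,\overline{u}_1,u_3,\ldots,u_n)$; $\ell(w)$ is the length with respect to these generators. The longest element is $\widetilde w_0=(\overline1,\ldots,\overline n)$ if $n$ is even, $\widetilde w_0=(1,\overline2,\ldots,\overline n)$ if $n$ is odd. Divided differences. $\widetilde W_n$ acts on $\mathbb{Z}[1/2][Y][X]$: $s_i$ interchanges $x_i,x_{i+1}$; $s_\Box$ sends $(x_1,x_2)$ to $(-x_2,-x_1)$ and fixes the other variables. $\partial_i(f)=(f-s_if)/(x_i-x_{i+1})$,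 $\partial_\Box(f)=(f-s_\Box f)/(x_1+x_2)$; $\partial'_i=-\partial_i$ ($1\leqslant i\leqslant n-1$), $\partial'_\Box=\partial_\Box$; $\partial_w$ and $\partial'_w$ are the corresponding composites along a reduced word $w=s_{a_1}\cdots s_{a_r}$, i.e. $\partial_{a_1}\circ\cdots\circ\partial_{a_r}$ and $\partial'_{a_1}\circ\cdots\circ\partial'_{a_r}$. Type $A$ double Schubert polynomials: $\Delta(X,Y)=\prod_{i+j\leqslant n}(x_i-y_j)$, $\mathfrak{S}_\varpi(X,Y)=\partial_{\varpi^{-1}\omega_0}(\Delta(X,Y))$ for $\varpi\in S_n$. $\widetilde P$-polynomials: $\widetilde Q_i(X)=e_i(X)$ (elementary symmetric), $\widetilde Q_{i,j}=\widetilde Q_i\widetilde Q_j+2\sum_{p=1}^j(-1)^p\widetilde Q_{i+p}\widetilde Q_{j-p}$, for $\lambda=(\lambda_1\geqslant\cdots\geqslant\lambda_r\geqslant0)$ with $r$ even (put $\lambda_r=0$ if necessary) $\widetilde Q_\lambda=\mathrm{Pfaffian}[\widetilde Q_{\lambda_i,\lambda_j}]_{1\leqslant i<j\leqslant r}$, and $\widetilde P_\lambda=2^{-\ell(\lambda)}\widetilde Q_\lambda$, with $\ell(\lambda)$ the number of nonzero parts. $\mathcal{D}_{n-1}$ is the set of strict partitions (distinct nonzero parts, possibly none) with all parts at most $n-1$; $\rho_{n-1}\smallsetminus\lambda$ is the strict partition whose parts are the complement of those of $\lambda$ in $\{1,\ldots,n-1\}$; $\widetilde P_{n-1}(X,Y)=\sum_{\lambda\in\mathcal{D}_{n-1}}\widetilde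 P_\lambda(X)\widetilde P_{\rho_{n-1}\smallsetminus\lambda}(Y)$. Type $D$ double Schubert polynomials: $\mathfrak{D}_w(X,Y)=(-1)^{n(n-1)/2}\,\partial'_{w^{-1}\widetilde w_0}\bigl(\Delta(X,Y)\widetilde P_{n-1}(X,Y)\bigr)$ for $w\in\widetilde W_n$. *)

(* Defs.v *)
From HB Require Import structures.
From mathcomp Require Import all_boot all_order all_fingroup all_algebra.
From mathcomp Require Import mpoly.

Set Implicit Arguments.
Unset Strict Implicit.
Unset Printing Implicit Defensive.

Import Order.TTheory GRing.Theory Num.Theory.
Local Open Scope ring_scope.

Definition dyadic : {pred rat} := [pred q | 2%N.-nat `|denq q|%N].

Fact dyadicP (q : rat) :
  reflect (exists k, 2%:R ^+ k * q \is a Num.int) (q \in dyadic).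
Proof.
have den2 k : 2%:R ^+ k = (2 ^ k)%N%:Z%:~R :> rat by rewrite -natrX.
apply: (iffP idP) => [|[k /intrP[z zE]]]; rewrite inE.
  case/p_natP=> // k dE; exists k; apply/intrP; exists (numq q).
  by rewrite den2 -dE absz_denq mulrC numqE.
apply: (@pnat_dvd _ (2 ^ k)%N); last by rewrite pnatX ?pnat_id.
have e : (2 ^ k)%N%:Z * numq q = z * denq q.
  by apply: (@intr_inj rat); rewrite !rmorphM /= numqE mulrA -den2 zE.
have : (`|denq q| %| 2 ^ k * `|numq q|)%N.
  by rewrite -[(2 ^ k)%N]/`|(2 ^ k)%N%:Z|%N -abszM e abszM dvdn_mull.
by rewrite Gauss_dvdl // coprime_sym coprime_num_den.
Qed.

Fact dyadic_subring : subring_closed dyadic.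
Proof.
split.
- by apply/dyadicP; exists 0%N; rewrite expr0 mulr1 rpred1.
- move=> x y /dyadicP[i xi] /dyadicP[j yj]; apply/dyadicP; exists (i + j)%N.
  rewrite mulrBr rpredB // exprD.
    by rewrite -mulrA mulrCA rpredM // rpredX // rpred_nat.
  by rewrite -mulrA rpredM // rpredX // rpred_nat.
- move=> x y /dyadicP[i xi] /dyadicP[j yj]; apply/dyadicP; exists (i + j)%N.
  by rewrite exprD mulrACA rpredM.
Qed.
HB.instance Definition _ :=
  GRing.isSubringClosed.Build rat dyadic dyadic_subring.

Record Zhalf := MkZhalf { Zhalf_val :> rat; _ : Zhalf_val \in dyadic }.
HB.instance Definition _ := [isSub for Zhalf_val].
HB.instance Definition _ := [Choice of Zhalf by <:].
HB.instance Definition _ := [SubChoice_isSubComNzRing of Zhalf by <:].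

Definition Zhalf_unit : pred Zhalf :=
  [pred x | (x != 0) && ((val x)^-1 \in dyadic)].
Definition Zhalf_inv (x : Zhalf) : Zhalf :=
  if x \in Zhalf_unit then insubd x (val x)^-1 else x.

Fact Zhalf_mulVx : {in Zhalf_unit, left_inverse 1 Zhalf_inv *%R}.
Proof.
move=> x ux; rewrite /Zhalf_inv ux; have /andP[x0 vx] := ux.
by apply: val_inj; rewrite rmorphM rmorph1 /= insubdK // mulVf.
Qed.
Fact Zhalf_unitP (x y : Zhalf) : y * x = 1 -> x \in Zhalf_unit.
Proof.
move=> yx; have x0 : x != 0.
  by apply: contra_eq_neq yx => ->; rewrite mulr0 eq_sym oner_neq0.
have v0 : val x != 0 by apply: contra_neq x0 => e; apply: val_inj.
rewrite inE x0 /=; suff -> : (val x)^-1 = val y by apply: valP.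
by apply: (mulIf v0); rewrite mulVf // -rmorphM yx rmorph1.
Qed.
Fact Zhalf_inv_out : {in [predC Zhalf_unit], Zhalf_inv =1 id}.
Proof. by move=> x; rewrite inE /= /Zhalf_inv => /negbTE->. Qed.
HB.instance Definition _ := GRing.ComNzRing_hasMulInverse.Build Zhalf
  Zhalf_mulVx Zhalf_unitP Zhalf_inv_out.

Fact Zhalf_idomain : GRing.integral_domain_axiom Zhalf.
Proof.
move=> x y /(congr1 val); rewrite rmorphM rmorph0 => /eqP.
rewrite mulf_eq0 => /orP[] /eqP e; apply/orP; [left | right];
  by apply/eqP; apply: val_inj.
Qed.
HB.instance Definition _ :=
  GRing.ComUnitRing_isIntegral.Build Zhalf Zhalf_idomain.

Lemma Zhalf_unit2 : (2 : Zhalf) \is a GRing.unit.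
Proof.
have h : (2^-1 : rat) \in dyadic by [].
apply: (@Zhalf_unitP _ (MkZhalf h)); apply: val_inj.
by rewrite rmorphM rmorph1 rmorph_nat.
Qed.

(* [(u, b)] is the signed permutation whose entry in position [k] is [u k],
   barred iff [b k]; positions and values are 0-based. *)
Record weylD (n : nat) := WeylD {
  weylD_val : 'S_n * {ffun 'I_n -> bool};
  _ : ~~ odd #|[set k | weylD_val.2 k]| }.
HB.instance Definition _ n := [isSub for @weylD_val n].
HB.instance Definition _ n := [Finite of weylD n by <:].

Section WeylGroup.
Context {n : nat}.
Implicit Types (w v : weylD n) (u s : 'S_n) (i j k : 'I_n).

Definition wabs w : 'S_n := (weylD_val w).1.
Definition wbar w : {ffun 'I_n -> bool} := (weylD_val w).2.

Lemma weylD_eqP w v : wabs w = wabs v -> wbar w =1 wbar v -> w = v.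
Proof.
by move=> e1 /ffunP e2; apply/val_inj/eqP/andP; split; apply/eqP.
Qed.

Fact odd_bars (b : pred 'I_n) :
  odd #|[set k | b k]| = \big[addb/false]_k b k.
Proof.
rewrite -sum1_card big_mkcond /= (big_morph odd oddD (erefl _)).
by apply: eq_bigr => k _; rewrite inE; case: (b k).
Qed.

Fact one_even : ~~ odd #|[set k | ((1%g, [ffun=> false])
  : 'S_n * {ffun 'I_n -> bool}).2 k]|.
Proof. by rewrite odd_bars big1 // => k _; rewrite ffunE. Qed.

(* Signed permutations compose as functions, the right factor acting first,
   with u (- k) = - u k.  The product of ['S_n] goes the other way round:
   [(s * t)%g k = t (s k)]. *)
Definition wmul_val w v : 'S_n * {ffun 'I_n -> bool} :=
  ((wabs v * wabs w)%g, [ffun k => wbar v k (+) wbar w (wabs v k)]).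
Definition winv_val w : 'S_n * {ffun 'I_n -> bool} :=
  ((wabs w)^-1%g, [ffun k => wbar w ((wabs w)^-1%g k)]).

Fact wmul_even w v : ~~ odd #|[set k | (wmul_val w v).2 k]|.
Proof.
rewrite odd_bars /=; under eq_bigr do rewrite ffunE.
rewrite big_split /= -!odd_bars.
rewrite (negbTE (valP v)) /=.
have := valP w; rewrite !odd_bars.
by rewrite (reindex_inj (@perm_inj _ (wabs v))).
Qed.
Fact winv_even w : ~~ odd #|[set k | (winv_val w).2 k]|.
Proof.
rewrite odd_bars /=; under eq_bigr do rewrite ffunE.
have := valP w; rewrite !odd_bars.
by rewrite (reindex_inj (@perm_inj _ (wabs w)^-1%g)).
Qed.

Definition wone : weylD n := WeylD one_even.
Definition wmul w v : weylD n := WeylD (wmul_even w v).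
Definition winv w : weylD n := WeylD (winv_even w).

Fact wbar_mul w v k : wbar (wmul w v) k = wbar v k (+) wbar w (wabs v k).
Proof. exact: ffunE. Qed.
Fact wbar_inv w k : wbar (winv w) k = wbar w ((wabs w)^-1%g k).
Proof. exact: ffunE. Qed.
Fact wbar_one k : wbar wone k = false.
Proof. exact: ffunE. Qed.

Fact wmulA : associative wmul.
Proof.
move=> x y z; apply: weylD_eqP => [|k]; first exact: esym (mulgA _ _ _).
by rewrite !wbar_mul permM addbA.
Qed.
Fact wmul1 : left_id wone wmul.
Proof.
move=> x; apply: weylD_eqP => [|k]; first exact: mulg1.
by rewrite wbar_mul wbar_one addbF.
Qed.
Fact wmulV : left_inverse wone winv wmul.
Proof.
move=> x; apply: weylD_eqP => [|k]; first exact: mulgV.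
by rewrite wbar_mul wbar_inv wbar_one permK addbb.
Qed.
End WeylGroup.

HB.instance Definition _ n :=
  Finite_isGroup.Build (weylD n) (@wmulA n) (@wmul1 n) (@wmulV n).

Section WeylTheory.
Context {n : nat}.
Implicit Types (w v : weylD n) (u s : 'S_n) (i j k : 'I_n).

Lemma wabsM w v : wabs (w * v)%g = (wabs v * wabs w)%g.
Proof. by []. Qed.
Lemma wbarM w v k : wbar (w * v)%g k = wbar v k (+) wbar w (wabs v k).
Proof. exact: wbar_mul. Qed.

Fact perm_even u : ~~ odd #|[set k | ((u, [ffun=> false])
  : 'S_n * {ffun 'I_n -> bool}).2 k]|.
Proof. by rewrite odd_bars big1 // => k _; rewrite ffunE. Qed.
(* The inclusion of S_n; it reverses products, see [wmul_val]. *)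
Definition wperm u : weylD n := WeylD (perm_even u).

Lemma wbar_wperm u k : wbar (wperm u) k = false.
Proof. exact: ffunE. Qed.

Lemma wpermM u s : wperm (u * s)%g = (wperm s * wperm u)%g.
Proof.
apply: weylD_eqP => // k.
by rewrite wbarM /wbar !ffunE.
Qed.
End WeylTheory.

(* Indices of the generators: [inl i] stands for s_(i+1), and [inr _] for
   s_Box, which exists only for n >= 2 since 1 < n is coerced to 0 or 1. *)
Definition letter (n : nat) : finType := ('I_n.-1 + 'I_(1 < n))%type.

Section Letters.
Context {n : nat}.

Fact lo_subproof (i : 'I_n.-1) : (i < n)%N.
Proof. exact: leq_trans (ltn_ord i) (leq_pred n). Qed.
Fact hi_subproof (i : 'I_n.-1) : (i.+1 < n)%N.
Proof. by rewrite -ltn_predRL. Qed.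
Fact box0_subproof (b : 'I_(1 < n)) : (0 < n)%N.
Proof. by case: b => b; case: n. Qed.
Fact box1_subproof (b : 'I_(1 < n)) : (1 < n)%N.
Proof. by case: b => b; case: (1 < n)%N. Qed.

(* The positions p1 < p2 on which a generator acts: i and i+1 for s_i,
   1 and 2 for s_Box. *)
Definition pos1 (a : letter n) : 'I_n :=
  match a with
  | inl i => Ordinal (lo_subproof i)
  | inr b => Ordinal (box0_subproof b)
  end.
Definition pos2 (a : letter n) : 'I_n :=
  match a with
  | inl i => Ordinal (hi_subproof i)
  | inr b => Ordinal (box1_subproof b)
  end.

Lemma pos12 a : pos1 a != pos2 a.
Proof. by case: a => a; rewrite -val_eqE //= neq_ltn ltnSn. Qed.

Definition is_box (a : letter n) : bool := if a is inr _ then true else false.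

Definition simple_val (a : letter n) : 'S_n * {ffun 'I_n -> bool} :=
  (tperm (pos1 a) (pos2 a),
   [ffun k => is_box a && ((k == pos1 a) || (k == pos2 a))]).

Fact simple_even a : ~~ odd #|[set k | (simple_val a).2 k]|.
Proof.
case: (boolP (is_box a)) => ba.
  have -> : [set k | (simple_val a).2 k] = [set pos1 a; pos2 a].
    by apply/setP => k; rewrite !inE ffunE ba.
  by rewrite cards2 pos12.
rewrite odd_bars big1 // => k _.
by rewrite ffunE (negbTE ba).
Qed.
Definition simple (a : letter n) : weylD n := WeylD (simple_even a).

Definition wordprod (t : seq (letter n)) : weylD n :=
  (\prod_(a <- t) simple a)%g.
End Letters.

Section Generation.
Context {n : nat}.
Implicit Types (w v : weylD n) (u s : 'S_n) (i j k : 'I_n).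

Let G := <<[set simple a | a : letter n]>>%g.

Let simpleG a : simple a \in G.
Proof. by apply: mem_gen; apply: imset_f. Qed.

Let wperm1 : wperm 1 = 1%g :> weylD n.
Proof. by apply: weylD_eqP => // k; rewrite !ffunE. Qed.

Let swap_simple (i : 'I_n.-1) :
  wperm (tperm (pos1 (inl i)) (pos2 (inl i))) = simple (inl i).
Proof. by apply: weylD_eqP => // k; rewrite !ffunE. Qed.

Fact wperm_gen u : wperm u \in G.
Proof.
pose A := [set s | wperm s \in G].
have gA : group_set A.
  apply/group_setP; split=> [|s t]; first by rewrite inE wperm1 group1.
  by rewrite !inE wpermM => sG tG; rewrite groupM.
suff /subsetP/(_ u) : [set: 'S_n] \subset Group gA by rewrite !inE; apply.
case: (posnP n) => [n0|n_gt0].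
  apply/subsetP => s _; rewrite /= inE.
  suff -> : s = 1%g by rewrite wperm1 group1.
  by apply/permP => k; have := ltn_ord k; rewrite [X in (_ < X)%N]n0.
pose z : 'I_n := Ordinal n_gt0.
rewrite -(gen_tperm z) gen_subG; apply/subsetP => _ /imsetP[[m lt_m] _ ->].
elim: m lt_m => [|m IHm] lt_m.
  have -> : Ordinal lt_m = z by apply: val_inj.
  by rewrite tperm1 group1.
have lt_m' : (m < n.-1)%N by rewrite ltn_predRL.
have lt_m0 := ltnW lt_m.
have tA : tperm (Ordinal lt_m0) (Ordinal lt_m) \in Group gA.
  rewrite /= inE; have <- : wperm (tperm (pos1 (inl (Ordinal lt_m')))
      (pos2 (inl (Ordinal lt_m')))) = wperm (tperm (Ordinal lt_m0) (Ordinal lt_m)).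
    by congr (wperm (tperm _ _)); apply: val_inj.
  by rewrite swap_simple.
case: (posnP m) => [m0|m_gt0].
  have <- : Ordinal lt_m0 = z by apply: val_inj.
  by [].
have -> : tperm z (Ordinal lt_m) =
    (tperm z (Ordinal lt_m0) ^ tperm (Ordinal lt_m0) (Ordinal lt_m))%g.
  rewrite tpermJ tpermL tpermD // -val_eqE /= ?(gtn_eqF m_gt0) //.
by rewrite groupJ // IHm.
Qed.

Let wperm_bar w : exists2 v, wabs v = 1%g & w = (wperm (wabs w) * v)%g.
Proof.
exists ((wperm (wabs w))^-1 * w)%g; last by rewrite mulKVg.
by rewrite wabsM; apply: mulgV.
Qed.

Let flip_even i j : i != j ->
  ~~ odd #|[set k | ((1%g, [ffun k => (k == i) || (k == j)])
    : 'S_n * {ffun 'I_n -> bool}).2 k]|.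
Proof.
move=> ij; have -> : [set k | ((1%g, [ffun k => (k == i) || (k == j)])
    : 'S_n * {ffun 'I_n -> bool}).2 k] = [set i; j].
  by apply/setP => k; rewrite !inE ffunE.
by rewrite cards2 ij.
Qed.
Let flip i j (ij : i != j) : weylD n := WeylD (flip_even ij).

Let flip_bar i j (ij : i != j) k :
  wbar (flip ij) k = (k == i) || (k == j).
Proof. exact: ffunE. Qed.
Let flip_abs i j (ij : i != j) : wabs (flip ij) = 1%g.
Proof. by []. Qed.

Let flip_gen i j (ij : i != j) : flip ij \in G.
Proof.
have n1 : (1 < n)%N.
  by case: n i j ij => [[]//|[|//]] i j; rewrite !ord1.
have lt0 : (0 < (1 < n))%N by rewrite n1.
have lt1 : (0 < n.-1)%N by rewrite ltn_predRL.
pose b : letter n := inr (Ordinal lt0).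
pose a : letter n := inl (Ordinal lt1).
have p1 : pos1 a = pos1 b by apply: val_inj.
have p2 : pos2 a = pos2 b by apply: val_inj.
have p12 := pos12 b.
set x := pos1 b in p1 p12 *; set y := pos2 b in p2 p12 *.
have fG : flip p12 \in G.
  have -> : flip p12 = (simple a * simple b)%g.
    have sa : wabs (simple a) = tperm x y by rewrite -p1 -p2.
    have sb : wabs (simple b) = tperm x y by [].
    have bb k : wbar (simple b) k = (k == x) || (k == y) by exact: ffunE.
    have ba k : wbar (simple a) k = false by exact: ffunE.
    apply: weylD_eqP => [|k]; first by rewrite wabsM sa sb tperm2.
    by rewrite flip_bar wbarM ba bb addbF.
  by rewrite groupM.
pose s := (tperm x i * tperm (tperm x i y) j)%g.
have sx : s x = i.
  rewrite permM tpermL tpermD //; last by rewrite eq_sym.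
  by rewrite -{2}(tpermL x i) (inj_eq perm_inj) eq_sym.
have sy : s y = j by rewrite permM tpermL.
have -> : flip ij = (wperm s * flip p12 * (wperm s)^-1)%g.
  apply: (canRL (mulgK _)); apply: weylD_eqP => [|k].
    by rewrite (wabsM (flip ij)) (wabsM (wperm s)) !flip_abs mulg1 mul1g.
  rewrite (wbarM (flip ij)) (wbarM (wperm s)) !wbar_wperm !flip_bar addbF.
  by rewrite -{1}sx -{1}sy !(inj_eq perm_inj).
by rewrite !groupM ?groupV ?wperm_gen.
Qed.

Lemma weylD_gen : <<[set simple a | a : letter n]>>%g = [set: weylD n].
Proof.
apply/setP => w; rewrite inE -/G; have [v v1 ->] := wperm_bar w.
rewrite groupMl ?wperm_gen //.
have [m] := ubnP #|[set k | wbar v k]|; elim: m v v1 {w} => // m IHm v v1 le_m.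
have [e|[i]] := set_0Vmem [set k | wbar v k].
  suff -> : v = 1%g by rewrite group1.
  apply: weylD_eqP => // k; have /setP/(_ k) := e.
  by rewrite !inE => ->; rewrite ffunE.
rewrite inE => vi.
have [e|[j]] := set_0Vmem ([set k | wbar v k] :\ i).
  have := valP v; rewrite -[X in odd X]/#|[set k | wbar v k]|.
  by rewrite (cardsD1 i) e cards0 inE vi.
rewrite !inE => /andP[ji vj].
have ij : i != j by rewrite eq_sym.
rewrite -(groupMr _ (flip_gen ij)) -/G; apply: IHm.
  by rewrite wabsM v1 mulg1.
apply: leq_trans _ (le_m : (_ <= m)%N); apply: proper_card; apply/properP; split.
  apply/subsetP => k; rewrite !inE wbarM flip_abs flip_bar perm1.
  by case: eqP => [->|_]; rewrite ?vi //; case: eqP => [->|_].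
exists i; rewrite inE //.
by rewrite wbarM flip_abs flip_bar perm1 eqxx vi.
Qed.

Lemma weylD_word w :
  exists l : nat, [exists t : l.-tuple (letter n), wordprod t == w].
Proof.
have : w \in <<[set simple a | a : letter n]>>%g by rewrite weylD_gen inE.
case/gen_prodgP => l [c cP ->]; exists l.
have ch r : exists a, simple a == c r.
  by have /imsetP[a _ ->] := cP r; exists a.
pose f r := xchoose (ch r).
apply/existsP; exists [tuple f r | r < l]; apply/eqP.
rewrite /wordprod big_tuple; apply: eq_bigr => r _.
by rewrite tnth_mktuple; apply/eqP/(xchooseP (ch r)).
Qed.
End Generation.

Definition wlen n (w : weylD n) : nat := ex_minn (weylD_word w).

Fact reduced_exists n (w : weylD n) :
  exists t : (wlen w).-tuple (letter n), wordprod t == w.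
Proof. by rewrite /wlen; case: ex_minnP => l /existsP. Qed.

(* An arbitrary but fixed reduced word of [w]. *)
Definition reduced_word n (w : weylD n) : seq (letter n) :=
  xchoose (reduced_exists w).

Lemma wordprod_reduced n (w : weylD n) : wordprod (reduced_word w) = w.
Proof. exact/eqP/(xchooseP (reduced_exists w)). Qed.
Lemma size_reduced n (w : weylD n) : size (reduced_word w) = wlen w.
Proof. exact: size_tuple. Qed.
Lemma wlen_min n (t : seq (letter n)) : (wlen (wordprod t) <= size t)%N.
Proof.
rewrite /wlen; case: ex_minnP => l _; apply.
by apply/existsP; exists (in_tuple t).
Qed.

Definition omega0 n : 'S_n := perm (@rev_ord_inj n).

Definition w0_val n : 'S_n * {ffun 'I_n -> bool} :=
  (1%g, [ffun k : 'I_n => odd n ==> (k != 0%N :> nat)]).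
Fact w0_even n : ~~ odd #|[set k | (w0_val n).2 k]|.
Proof.
have [on|en] := boolP (odd n); last first.
  have -> : [set k | (w0_val n).2 k] = setT.
    by apply/setP => k; rewrite !inE ffunE (negbTE en).
  by rewrite cardsT card_ord.
case: n on => // n on.
have -> : [set k | (w0_val n.+1).2 k] = [set~ ord0].
  by apply/setP => k; rewrite !inE ffunE on -val_eqE.
by rewrite cardsC1 card_ord.
Qed.
Definition w0 n : weylD n := WeylD (w0_even n).

Section DividedDifferences.
Context {n : nat} {R : comNzRingType}.
Implicit Types (w : weylD n) (a : letter n) (f g : {mpoly R[n]}).

(* x_k goes to x_(w k), with x_(- k) = - x_k. *)
Definition wact w f : {mpoly R[n]} :=
  f \mPo [tuple (-1) ^+ wbar w k * 'X_(wabs w k) | k < n].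

Definition root a : {mpoly R[n]} :=
  if is_box a then 'X_(pos1 a) + 'X_(pos2 a)
  else 'X_(pos1 a) - 'X_(pos2 a).

Fact ddiff_exists a f : exists g, root a * g == f - wact (simple a) f.
Proof.
have wX (i : 'I_n) : wact (simple a) 'X_i =
    (-1) ^+ wbar (simple a) i * 'X_(wabs (simple a) i).
  by rewrite /wact comp_mpolyXU -tnth_nth tnth_mktuple.
pose P f := exists g, root a * g == f - wact (simple a) f.
rewrite -/(P f).
have PD f1 f2 : P f1 -> P f2 -> P (f1 + f2).
  move=> [g1 /eqP e1] [g2 /eqP e2]; exists (g1 + g2); apply/eqP.
  by rewrite mulrDr e1 e2 /wact rmorphD /= opprD addrACA.
have PM f1 f2 : P f1 -> P f2 -> P (f1 * f2).
  move=> [g1 /eqP e1] [g2 /eqP e2].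
  exists (g1 * f2 + wact (simple a) f1 * g2); apply/eqP.
  rewrite mulrDr mulrA e1 mulrCA e2 mulrBl mulrBr addrA subrK.
  by rewrite /wact rmorphM.
have PC c : P c%:MP.
  by exists 0; rewrite mulr0 /wact comp_mpolyC subrr.
have PX (i : 'I_n) : P 'X_i.
  rewrite /P wX /wbar /wabs /= ffunE /root.
  case: tpermP => [->|->|/eqP/negbTE e1 /eqP/negbTE e2].
  - rewrite eqxx /= andbT; exists 1; rewrite mulr1.
    by case: ifP => _; rewrite ?mulN1r ?opprK // mul1r.
  - rewrite eqxx orbT andbT; case: ifP => _; [exists 1 | exists (-1)].
      by rewrite mulr1 expr1 mulN1r opprK addrC.
    by rewrite mulrN1 opprB mul1r.
  - by rewrite e1 e2 andbF mul1r subrr; exists 0; rewrite mulr0.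
rewrite [f]mpolyE; apply: big_ind => [||m _]; [|exact: PD|].
  by have := PC 0; rewrite mpolyC0.
rewrite -mul_mpolyC; apply: (PM) => //; rewrite mpolyXE_id.
apply: big_ind => [||i _]; [|exact: PM|].
  by have := PC 1; rewrite mpolyC1.
elim: (m i) => [|d IHd]; first by have := PC 1; rewrite mpolyC1.
by rewrite exprS; apply: PM.
Qed.

Definition ddiff a f : {mpoly R[n]} := xchoose (ddiff_exists a f).

Lemma ddiffE a f : root a * ddiff a f = f - wact (simple a) f.
Proof. exact/eqP/(xchooseP (ddiff_exists a f)). Qed.
Lemma root_neq0 a : root a != 0.
Proof.
apply/eqP => /mpolyP/(_ U_(pos1 a)%MM) /eqP.
rewrite mcoeff0 /root; case: (is_box a);
  rewrite ?mcoeffB ?mcoeffD !mcoeffX eqxx;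
  rewrite (_ : (U_(pos2 a) == U_(pos1 a))%MM = false) ?subr0 ?addr0 ?oner_eq0 //;
  by apply/negbTE; rewrite eq_sym eq_mnm1 pos12.
Qed.

Definition ddiff' a f : {mpoly R[n]} :=
  if is_box a then ddiff a f else - ddiff a f.

Definition ddiff_w w f : {mpoly R[n]} := foldr ddiff f (reduced_word w).
Definition ddiff'_w w f : {mpoly R[n]} := foldr ddiff' f (reduced_word w).
End DividedDifferences.

(* Z[1/2][Y] and Z[1/2][Y][X]. *)
Notation polyY n := {mpoly Zhalf[n]}.
Notation polyXY n := {mpoly (polyY n)[n]}.

Definition xvar n (i : 'I_n) : polyXY n := 'X_i.
Definition yvar n (i : 'I_n) : polyXY n := ('X_i : polyY n)%:MP.

Section Pfaffian.
Variables (A : comNzRingType) (m : nat).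

Fact even_subproof (i : 'I_m) : (i.*2 < m.*2)%N.
Proof. by rewrite ltn_double. Qed.
Fact odd_subproof (i : 'I_m) : (i.*2.+1 < m.*2)%N.
Proof. by rewrite ltn_Sdouble. Qed.
Let ev (i : 'I_m) : 'I_m.*2 := Ordinal (even_subproof i).
Let od (i : 'I_m) : 'I_m.*2 := Ordinal (odd_subproof i).

(* The sum runs over the perfect matchings of the 2m indices, each written
   once as {s 0 < s 1}, {s 2 < s 3}, with s 0 < s 2 < and so on; only the
   entries a i j with i < j occur. *)
Definition pfaffian (a : 'I_m.*2 -> 'I_m.*2 -> A) : A :=
  \sum_(s : 'S_m.*2 |
      [forall i : 'I_m, (s (ev i) < s (od i))%N] &&
      [forall i : 'I_m, forall j : 'I_m,
         (i < j)%N ==> (s (ev i) < s (ev j))%N])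
    (-1) ^+ odd_perm s * \prod_(i < m) a (s (ev i)) (s (od i)).
End Pfaffian.

Section TildePolynomials.
Variable n : nat.

Definition Qtilde1 (i : nat) : polyY n := mesym n Zhalf i.

Definition Qtilde2 (i j : nat) : polyY n :=
  Qtilde1 i * Qtilde1 j
  + 2 * \sum_(1 <= p < j.+1) (-1) ^+ p * (Qtilde1 (i + p) * Qtilde1 (j - p)).

(* [la] is a weakly decreasing sequence.  The Pfaffian has size [size la]
   rounded up to an even number, and [nth] then pads [la] with a zero part. *)
Definition Qtilde (la : seq nat) : polyY n :=
  @pfaffian (polyY n) (uphalf (size la))
    (fun i j => Qtilde2 (nth 0%N la i) (nth 0%N la j)).

Definition Ptilde (la : seq nat) : polyY n :=
  (2^-1 : Zhalf) ^+ count (fun p => p != 0%N) la *: Qtilde la.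

(* The strict partitions with parts at most n - 1 are the sets of parts
   S included in {1, ..., n - 1}; the element i of S stands for the part i + 1. *)
Definition strict_part (S : {set 'I_n.-1}) : seq nat :=
  sort geq [seq (val i).+1 | i <- enum S].

Definition PtildeXY : polyXY n :=
  \sum_(S : {set 'I_n.-1})
    map_mpoly (@mpolyC n Zhalf) (Ptilde (strict_part S))
    * (Ptilde (strict_part (~: S)))%:MP.

Definition Delta : polyXY n :=
  \prod_(i < n) \prod_(j < n | (i.+1 + j.+1 <= n)%N) (xvar i - yvar j).

(* The reduced words in the type D generators of an element of S_n only
   involve the s_i. *)
Definition schubertA (u : 'S_n) : polyXY n :=
  ddiff_w ((wperm u)^-1 * wperm (omega0 n))%g Delta.

Definition schubertD (w : weylD n) : polyXY n :=
  (-1) ^+ (n * n.-1)./2 * ddiff'_w (w^-1 * w0 n)%g (Delta * PtildeXY).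

(* f (omega0 X, - Y) *)
Definition flipXY (f : polyXY n) : polyXY n :=
  map_mpoly (fun c : polyY n => c \mPo [tuple - 'X_i | i < n]) f
    \mPo [tuple xvar (rev_ord i) | i < n].

Definition Hsub : {set weylD n} := [set w | wabs w == 1%g].

Fact Hsub_group_set : group_set Hsub.
Proof.
apply/group_setP; split=> [|w v]; first by rewrite inE.
by rewrite !inE wabsM => /eqP-> /eqP->; rewrite mulg1.
Qed.
Canonical Hsub_group := Group Hsub_group_set.

Lemma Hsub_normal : (Hsub <| [set: weylD n])%g.
Proof.
rewrite /normal subsetT; apply/subsetP => w _; rewrite inE.
apply/subsetP => x /imsetP[v]; rewrite inE => /eqP v1 ->{x}.
by rewrite inE /conjg !wabsM v1 mulg1 -wabsM mulVg.
Qed.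

Definition Lset (u : 'S_n) : {set weylD n} :=
  [set w in (wperm u *: Hsub)%g | wlen w == wlen (wperm u)].
End TildePolynomials.

(* Main.v *)
Require Import Defs.
From HB Require Import structures.
From mathcomp Require Import all_boot all_order all_fingroup all_algebra.
From mathcomp Require Import mpoly ring zify.
Set Implicit Arguments.
Unset Strict Implicit.
Unset Printing Implicit Defensive.
Import Order.TTheory GRing.Theory Num.Theory.
Local Open Scope ring_scope.

(** Both sides obey the same recurrence, and a polynomial of their shape that is
    killed by all the divided differences is determined by a single value.

    Write [dd] for the primed divided differences.  By Matsumoto's theorem
    ([reduced_foldr]), [dd a] sends [schubertD w] to [schubertD (w * simple a)]
    if [a] is a descent of [w], and to 0 otherwise.  The generators s_Box and s_1
    have the same absolute value; if [w] is as short as its absolute value, then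
    its descents are descents of the absolute value, and so the sums over
    [Lset u] obey the recurrence of S_n, with s_Box acting like s_1
    ([dd_sum_Lset]).  The right-hand side obeys it as well: reversing [X]
    conjugates the generators of S_n by [omega0] ([flipXY_schubertA]), and the
    [k]-th variable, counting from 0, occurs in it to at most the power [k],
    which makes s_Box and s_1 act alike ([staircase_box], [dd_famA]).  By
    induction on the length of [u], the difference of the two sides is killed by
    all the divided differences, that is, it is invariant under the Weyl group
    acting on [X].

    Uniqueness comes from the kernel [Delta * PtildeXY].  Evaluate [X] at the
    image of the generic point [z] under [u], and [Y] at its reversed image under
    [v]: the kernel vanishes if [u] and [v] differ, and does not if they agree
    ([kernel_offdiag], [kernel_diag_neq0]).  Both sides of the identity and the
    kernel are combinations, with coefficients in [X], of no more polynomials in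
    [Y] than the group has elements, and so the kernel shows that the matrix of
    the values of these polynomials has independent rows ([spanned_eq0]).  A
    combination which vanishes for [X] at [z] and for [Y] at all the points is
    therefore 0, and an invariant one is 0 as soon as it vanishes at one point
    ([spanned_dd_eq0]).  At the point of the longest element, a chain of divided
    differences of the kernel vanishes if it is too short to reach that element
    ([ev_chain_vanish]), and otherwise its value is a quotient by a product of
    roots ([ev_chain_value]).  So both sides have the value 1 for [u = 1] and 0
    otherwise ([schubertD_value], [famA_value]).

    If the same variables have the same signs at the two points, then it is
    [Delta] that vanishes.  Otherwise at least two signs differ, and the factor
    [PtildeXY] vanishes: it does not change if one variable is dropped on one
    side and its opposite on the other ([pairsum_wQ_flip]), and after two steps
    there are too few variables left ([pairsum_wQ_flip2]).  This is proved for
    Pfaffians indexed by words, possibly with repeated letters, on which adjoining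
    a variable acts by lowering some of the letters ([wQ_hop]); equal adjacent
    letters can be removed ([wpf_twin]).  The same vanishing gives the value of
    [PtildeXY] on the diagonal, as a polynomial in one of the variables with known
    roots ([pairsum_wQ_self]). *)

(** * Pfaffians of words *)

Section WordPfaffian.
Variable R : comNzRingType.
Implicit Types (a : nat -> nat -> R) (h : nat -> seq nat -> R).
Implicit Types (l r p q : seq nat).

(** The alternating sum over the ways to pull one letter out of a word: the
    shape of the expansion of a Pfaffian along its first row. *)
Fixpoint pick h l : R :=
  if l is y :: l' then h y l' - pick (fun z r => h z (y :: r)) l' else 0.

(** The Pfaffian of the entries of [a] indexed by the letters of a word,
    expanded along the first letter.  Letters may be repeated, in which case
    [a k k] need not be 0.  The number [m], half the length of the word, is
    fuel. *)
Fixpoint wpf a (m : nat) l : R :=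
  if m is m'.+1 then
    if l is x :: l' then pick (fun y r => a x y * wpf a m' r) l' else 0
  else 1.
Arguments wpf : simpl never.

Lemma wpf_cons a m x l :
  wpf a m.+1 (x :: l) = pick (fun y r => a x y * wpf a m r) l.
Proof. by []. Qed.

Lemma eq_pick h1 h2 l :
  (forall y r, y \in l -> subseq r l -> (size r).+1 = size l ->
     h1 y r = h2 y r) ->
  pick h1 l = pick h2 l.
Proof.
elim: l h1 h2 => // y l IHl h1 h2 e; rewrite /=.
congr (_ - _); first by apply: e; rewrite ?mem_head ?subseq_cons.
apply: IHl => z r zl rl sz; apply: e; first by rewrite inE zl orbT.
  by rewrite /= eqxx.
by rewrite /= sz.
Qed.

Lemma pickD h1 h2 l :
  pick (fun y r => h1 y r + h2 y r) l = pick h1 l + pick h2 l.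
Proof.
elim: l h1 h2 => [|y l IHl] h1 h2 /=; first by rewrite addr0.
by rewrite IHl opprD addrACA.
Qed.

Lemma pickZ c h l : pick (fun y r => c * h y r) l = c * pick h l.
Proof.
by elim: l h => [|y l IHl] h /=; rewrite ?mulr0 // IHl mulrBr.
Qed.

Lemma pick0 h l : (forall y r, y \in l -> h y r = 0) -> pick h l = 0.
Proof.
elim: l h => //= y l IHl h e; rewrite e ?inE ?eqxx // IHl ?subrr // => z r zl.
by apply: e; rewrite inE zl orbT.
Qed.

(** Two letters are pulled in both orders, with opposite signs. *)
Lemma pick_sym2 (H : nat -> nat -> seq nat -> R) l :
  (forall y z r, H y z r = H z y r) ->
  pick (fun y r => pick (H y) r) l = 0.
Proof.
elim: l H => //= y l IHl H symH.
have -> : pick (fun z r => H z y r - pick (fun z' r' => H z z' (y :: r')) r) l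
   = pick (fun z r => H z y r) l
     + pick (fun z r => (-1) * pick (fun z' r' => H z z' (y :: r')) r) l.
  by rewrite -pickD; apply: eq_pick => z r _ _; rewrite mulN1r.
rewrite pickZ IHl // mulr0 addr0.
by rewrite (@eq_pick (H y) (fun z r => H z y r)) ?subrr // => z r _ _ _.
Qed.

(** Pulling either of the twins leaves the same word, with opposite signs; so
    only the terms in which both remain survive. *)
Lemma pick_twin c h1 h2 p q (k : nat) :
  (forall y p' q', (size (p' ++ q')).+1 = size (p ++ q) ->
     h1 y (p' ++ k :: k :: q') = c * h2 y (p' ++ q')) ->
  pick h1 (p ++ k :: k :: q) = c * pick h2 (p ++ q).
Proof.
elim: p h1 h2 => [|y p IHp] h1 h2 e /=.
  rewrite opprB addrA addrAC subrr add0r -pickZ.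
  by apply: eq_pick => z r _ _ sz; apply: (e z [::]).
rewrite e //= mulrBr; congr (_ - _).
by apply: IHp => z p' q' sz; rewrite (e z (y :: p')) //= sz.
Qed.

(** Two equal adjacent rows: all the terms cancel in pairs, except for those
    that match the twins with each other. *)
Lemma wpf_twin a m p q (k : nat) : (size (p ++ q) = m.*2)%N ->
  wpf a m.+1 (p ++ k :: k :: q) = a k k * wpf a m (p ++ q).
Proof.
elim: m p q => [|m IHm] [|x p] q.
- by case: q => // _; rewrite /= wpf_cons /= subr0.
- by [].
- move=> _; rewrite /= wpf_cons /=; under eq_pick => z r _ _ _ do
    rewrite wpf_cons -pickZ.
  by rewrite pick_sym2 ?subr0 // => y z r; rewrite mulrCA.
- rewrite doubleS => -[sz]; rewrite !wpf_cons.
  apply: pick_twin => y p' q'; rewrite sz => -[sz'].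
  by rewrite [RHS]mulrCA IHm.
Qed.

(** The price of lowering the letter [k]; the letter 0 cannot be lowered. *)
Definition hopw (x : R) (k : nat) : R := if k is 0 then 0 else x.

(** The sum over all ways to lower some of the letters of a word by 1, each
    at the price [x].  This is how adjoining a variable [x] acts on the
    polynomials indexed by words. *)
Fixpoint hop x (f : seq nat -> R) l : R :=
  if l is k :: l' then
    hop x (fun r => f (k :: r)) l' + hopw x k * hop x (fun r => f (k.-1 :: r)) l'
  else f [::].

Lemma eq_hop_size x f1 f2 l :
  (forall r, size r = size l -> f1 r = f2 r) -> hop x f1 l = hop x f2 l.
Proof.
elim: l f1 f2 => [|k l IHl] f1 f2 e /=; first exact: e.
by congr (_ + _ * _); apply: IHl => r sz; apply: e; rewrite /= sz.
Qed.

Lemma eq_hop x f1 f2 l : f1 =1 f2 -> hop x f1 l = hop x f2 l.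
Proof. by move=> e; apply: eq_hop_size => r _. Qed.

Lemma hop_rcons0 x f l :
  hop x f (rcons l 0%N) = hop x (fun r => f (rcons r 0%N)) l.
Proof.
by elim: l f => [|k l IHl] f /=; rewrite ?mul0r ?addr0 // !IHl.
Qed.

Lemma hopD x f1 f2 l : hop x (fun r => f1 r + f2 r) l = hop x f1 l + hop x f2 l.
Proof. by elim: l f1 f2 => //= k l IHl f1 f2; rewrite !IHl mulrDr addrACA. Qed.

Lemma hopZ x c f l : hop x (fun r => c * f r) l = c * hop x f l.
Proof. by elim: l f => //= k l IHl f; rewrite !IHl mulrDr mulrCA. Qed.

Lemma hopB x f1 f2 l : hop x (fun r => f1 r - f2 r) l = hop x f1 l - hop x f2 l.
Proof.
rewrite -mulN1r -hopZ -hopD; apply: eq_hop => r.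
by rewrite mulN1r.
Qed.

Lemma hop_pick x h l :
  hop x (pick h) l =
  pick (fun y r => hop x (fun s => h y s + hopw x y * h y.-1 s) r) l.
Proof.
elim: l h => //= y l IHl h; rewrite !hopB !IHl hopD hopZ.
set A := hop x _ l; set B := hop x _ l.
rewrite mulrBr addrACA -opprD; congr (_ - _).
by rewrite -pickZ -pickD; apply: eq_pick.
Qed.

(** The Pfaffian is linear in each of its rows, so lowering letters in the
    entries amounts to lowering them in the word.  In a decreasing word the
    entries are only taken at pairs [i > j]. *)
Lemma wpf_hop x a b m l :
  (forall i j, (j < i)%N ->
     a i j = b i j + hopw x i * b i.-1 j
             + hopw x j * (b i j.-1 + hopw x i * b i.-1 j.-1)) ->
  size l = m.*2 -> pairwise gtn l -> wpf a m l = hop x (wpf b m) l.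
Proof.
move=> ab; elim: m l => [|m IHm] [|i l] //; rewrite doubleS => -[sz] /=.
case/andP=> /allP il pl; rewrite wpf_cons.
rewrite -[RHS]/(hop x (pick (fun y r => b i y * wpf b m r)) l
  + hopw x i * hop x (pick (fun y r => b i.-1 y * wpf b m r)) l).
rewrite !hop_pick -pickZ -pickD; apply: eq_pick => y r yl rl sz'.
have lin c y' : hop x (fun s => b c y' * wpf b m s
      + hopw x y' * (b c y'.-1 * wpf b m s)) r
    = (b c y' + hopw x y' * b c y'.-1) * hop x (wpf b m) r.
  by rewrite -hopZ; apply: eq_hop => s; rewrite mulrA -mulrDl.
rewrite !lin IHm ?(subseq_pairwise rl) //; last by apply/eqP; rewrite -eqSS sz' sz.
by rewrite ab; [ring | apply: il].
Qed.
End WordPfaffian.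

(** * Q-polynomials of a power series *)

Section WordQ.
Variable R : comNzRingType.
Implicit Types (p q : {poly R}) (l r : seq nat).

(** The two-row polynomials, with the coefficients of [p] in place of the
    elementary symmetric functions; for [p = \prod_k (1 + x_k 'X)] these
    coefficients are the elementary symmetric functions of the [x_k]. *)
Definition q2 p (i j : nat) : R :=
  p`_i * p`_j + 2 * \sum_(1 <= k < j.+1) (-1) ^+ k * (p`_(i + k) * p`_(j - k)).

Definition pad l := if odd (size l) then rcons l 0%N else l.
(** The polynomial [Qtilde] of a word, which need not be a partition. *)
Definition wQ p l : R := wpf (q2 p) (uphalf (size l)) (pad l).

Lemma size_pad l : size (pad l) = (uphalf (size l)).*2.
Proof.
rewrite /pad uphalf_half; case: ifP => o; rewrite ?size_rcons /= ?doubleS.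
  by rewrite -{1}(odd_double_half (size l)) o.
by rewrite -{1}(odd_double_half (size l)) o.
Qed.

Lemma wQ_twin p (k : nat) l r : wQ p (l ++ k :: k :: r) = q2 p k k * wQ p (l ++ r).
Proof.
set s := if odd (size (l ++ r)) then rcons r 0%N else r.
have sz : size (l ++ k :: k :: r) = (size (l ++ r)).+2.
  by rewrite !size_cat !addnS.
have e1 : pad (l ++ r) = l ++ s by rewrite /pad /s; case: ifP; rewrite ?rcons_cat.
have e2 : pad (l ++ k :: k :: r) = l ++ k :: k :: s.
  by rewrite /pad sz /s /= negbK; case: ifP; rewrite ?rcons_cat.
by rewrite /wQ sz e2 e1 wpf_twin // -e1 size_pad.
Qed.

Lemma q2_00 p : p`_0 = 1 -> q2 p 0 0 = 1.
Proof. by move=> p0; rewrite /q2 big_geq // p0 mulr0 addr0 mulr1. Qed.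

Lemma wQ_rcons0 p l : p`_0 = 1 -> wQ p (rcons l 0%N) = wQ p l.
Proof.
move=> p0; case: (boolP (odd (size l))) => o.
  have -> : wQ p (rcons l 0%N) = wpf (q2 p) (uphalf (size (rcons l 0%N))) (pad l).
    by rewrite /wQ /pad size_rcons /= o.
  by rewrite /wQ size_rcons uphalfE /= !uphalf_half o.
have := wQ_twin p 0 l [::]; rewrite q2_00 // mul1r cats0 => <-.
have -> : wQ p (rcons l 0%N) =
    wpf (q2 p) (uphalf (size (rcons l 0%N))) (l ++ [:: 0%N; 0%N]).
  by rewrite /wQ /pad !size_rcons /= o -!cats1 -catA.
have -> : wQ p (l ++ [:: 0%N; 0%N]) =
    wpf (q2 p) (uphalf (size l).+2) (l ++ [:: 0%N; 0%N]).
  by rewrite /wQ /pad size_cat addn2 /= negbK (negbTE o).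
by rewrite size_rcons /= !uphalf_half /= (negbTE o).
Qed.

(** The letter [N] exceeds the degree of [p], so its row vanishes. *)
Lemma wQ_big p (N : nat) l : (0 < N)%N -> (size p <= N)%N -> wQ p (N :: l) = 0.
Proof.
move=> N0 sp; rewrite /wQ; set m := uphalf _.
have -> : m = m.-1.+1 by [].
have -> : pad (N :: l) = N :: (if odd (size (N :: l)) then rcons l 0%N else l).
  by rewrite /pad /=; case: ifP.
rewrite wpf_cons; apply: pick0 => y r _.
rewrite /q2 nth_default // mul0r add0r big1 ?mulr0 ?mul0r // => k _.
by rewrite nth_default ?mul0r ?mulr0 // (leq_trans sp) // leq_addr.
Qed.

Lemma coef_mulX1 p x (k : nat) :
  (p * (1 + x *: 'X))`_k = p`_k + hopw x k * p`_k.-1.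
Proof.
rewrite mulrDr mulr1 -scalerAr coefD coefZ coefMX.
by case: k => //=; rewrite mulr0 mul0r.
Qed.

(** The coefficients of the product are [p`_k + x * p`_k.-1]; the sums that
    define the four terms on the right are obtained by shifting indices. *)
Lemma q2_hop p x (i j : nat) : (0 < i)%N ->
  q2 (p * (1 + x *: 'X)) i j = q2 p i j + hopw x i * q2 p i.-1 j
    + hopw x j * (q2 p i j.-1 + hopw x i * q2 p i.-1 j.-1).
Proof.
case: i => // i _; rewrite /q2 !coef_mulX1 /=.
under eq_big_nat => k _ do rewrite !coef_mulX1 addSn /= mulrDl !mulrDr.
case: j => [|j] /=; first by rewrite !big_geq //; ring.
rewrite !big_split /= [X in _ = X + _]addrC.
have e1 : \sum_(1 <= k < j.+2)
     (-1) ^+ k * (p`_(i + k).+1 * (hopw x (j.+1 - k) * p`_(j.+1 - k).-1))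
   = x * \sum_(1 <= k < j.+1) (-1) ^+ k * (p`_(i.+1 + k) * p`_(j - k)).
  rewrite big_nat_recr //= subnn /= mul0r !mulr0 addr0 big_distrr /=.
  apply: eq_big_nat => k /andP[_ kj]; rewrite subSn //= addSn.
  ring.
have e2 : \sum_(1 <= k < j.+2)
     (-1) ^+ k * (x * p`_(i + k) * (hopw x (j.+1 - k) * p`_(j.+1 - k).-1))
   = x * x * \sum_(1 <= k < j.+1) (-1) ^+ k * (p`_(i + k) * p`_(j - k)).
  rewrite big_nat_recr //= subnn /= mul0r !mulr0 addr0 big_distrr /=.
  by apply: eq_big_nat => k /andP[_ kj]; rewrite subSn //=; ring.
have e3 : \sum_(1 <= k < j.+2) (-1) ^+ k * (x * p`_(i + k) * p`_(j.+1 - k))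
   = x * \sum_(1 <= k < j.+2) (-1) ^+ k * (p`_(i + k) * p`_(j.+1 - k)).
  by rewrite big_distrr /=; apply: eq_big_nat => k _; ring.
have e0 : \sum_(1 <= k < j.+2) (-1) ^+ k * (p`_(i + k).+1 * p`_(j.+1 - k))
   = \sum_(1 <= k < j.+2) (-1) ^+ k * (p`_(i.+1 + k) * p`_(j.+1 - k)).
  by apply: eq_bigr => k _; rewrite addSn.
rewrite e0 e1 e2 e3; ring.
Qed.

Lemma q2_anti p (k : nat) : q2 p k k.+1 = - q2 p k.+1 k.
Proof.
rewrite /q2 big_nat_recl // subSS subn0 addn1 big_add1 /=.
under eq_big_nat => j _ do rewrite exprS mulN1r mulNr subSS addnS -addSn.
rewrite sumrN expr1 mulN1r [in RHS]big_add1 /=.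
ring.
Qed.

(** The terms of the first degree in [x] cancel by [q2_anti]. *)
Lemma q2_diag_hop p x (k : nat) :
  q2 (p * (1 + x *: 'X)) k k =
  q2 p k k + (if k is j.+1 then x ^+ 2 * q2 p j j else 0).
Proof.
case: k => [|k]; last by rewrite q2_hop //= q2_anti; ring.
by rewrite /q2 !big_geq // coef_mulX1 /= mul0r !addr0.
Qed.

Lemma wQ_hop p x l : pairwise gtn l -> all (ltn 0) l ->
  wQ (p * (1 + x *: 'X)) l = hop x (wQ p) l.
Proof.
move=> pl l0; have e (r : seq nat) : size r = size l ->
    wQ p r = wpf (q2 p) (uphalf (size l)) (if odd (size l) then rcons r 0%N else r).
  by rewrite /wQ /pad => ->.
rewrite (eq_hop_size x e) /wQ.
have -> : hop x (fun r => wpf (q2 p) (uphalf (size l))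
      (if odd (size l) then rcons r 0%N else r)) l
    = hop x (wpf (q2 p) (uphalf (size l))) (pad l).
  by rewrite /pad; case: ifP => // _; rewrite hop_rcons0.
apply: wpf_hop; first by move=> i j ji; rewrite q2_hop // (leq_ltn_trans _ ji).
  exact: size_pad.
rewrite /pad; case: ifP => // _.
by rewrite -cats1 pairwise_cat allrel1r pl !andbT.
Qed.
End WordQ.

(** * Pairing complementary words *)

Section PairSum.
Variable R : comNzRingType.
Implicit Types (f g : seq nat -> R) (gam : nat -> R) (x : R).

(** The sum of [f S * g (~: S)] over the subsets [S] of [{1, .., N}], a set
    being read as a strictly decreasing word. *)
Fixpoint pairsum (N : nat) f g : R :=
  if N is M.+1 then
    pairsum M (fun l => f (N :: l)) g + pairsum M f (fun l => g (N :: l))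
  else f [::] * g [::].

Definition strict (N : nat) (l : seq nat) :=
  [&& pairwise gtn l, all (ltn 0) l & all (fun k => k <= N)%N l].

Lemma eq_pairsum N f1 f2 g1 g2 :
  (forall l, strict N l -> f1 l = f2 l) ->
  (forall l, strict N l -> g1 l = g2 l) ->
  pairsum N f1 g1 = pairsum N f2 g2.
Proof.
elim: N f1 f2 g1 g2 => [|N IHN] f1 f2 g1 g2 ef eg /=; first by rewrite ef ?eg.
have up l : strict N l -> strict N.+1 l.
  case/and3P=> pl l0 lN; apply/and3P; split=> //.
  by apply: sub_all lN => k /leqW.
have co l : strict N l -> strict N.+1 (N.+1 :: l).
  case/and3P=> pl l0 lN; apply/and3P; split=> //=.
    by rewrite pl andbT; apply: sub_all lN => k; rewrite /= ltnS.
  by rewrite leqnn; apply: sub_all lN => k /leqW.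
by congr (_ + _); apply: IHN => l sl; do ?[apply: ef | apply: eg]; auto.
Qed.

Lemma pairsumDl N f1 f2 g :
  pairsum N (fun l => f1 l + f2 l) g = pairsum N f1 g + pairsum N f2 g.
Proof.
by elim: N f1 f2 g => [|N IHN] f1 f2 g /=; rewrite ?mulrDl // !IHN addrACA.
Qed.

Lemma pairsumC N f g : pairsum N f g = pairsum N g f.
Proof.
elim: N f g => [|N IHN] f g /=; first exact: mulrC.
by rewrite addrC; congr (_ + _); apply: IHN.
Qed.

Lemma pairsumZl N c f g : pairsum N (fun l => c * f l) g = c * pairsum N f g.
Proof.
by elim: N f g => [|N IHN] f g /=; rewrite ?mulrA // !IHN mulrDr.
Qed.

Lemma pairsumDr N f g1 g2 :
  pairsum N f (fun l => g1 l + g2 l) = pairsum N f g1 + pairsum N f g2.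
Proof. by rewrite pairsumC pairsumDl ![pairsum _ _ f]pairsumC. Qed.

Lemma pairsumZr N c f g : pairsum N f (fun l => c * g l) = c * pairsum N f g.
Proof. by rewrite pairsumC pairsumZl pairsumC. Qed.

(** The two rules which reduce any weakly decreasing word to a strict one. *)
Definition twinned gam f :=
  (forall l k r, f (l ++ k :: k :: r) = gam k * f (l ++ r)) /\
  (forall l, f (rcons l 0%N) = f l).

Lemma twinned_cons gam f k : twinned gam f -> twinned gam (fun l => f (k :: l)).
Proof. by case=> ft f0; split=> [l j r|l]; rewrite -?cat_cons -?rcons_cons. Qed.

Let hopsum N x f g := pairsum N (hop x f) (hop (- x) g).

Let hopsumS N x f g : hopsum N.+1 x f g =
  hopsum N x (fun l => f (N.+1 :: l)) g + x * hopsum N x (fun l => f (N :: l)) g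
  + (hopsum N x f (fun l => g (N.+1 :: l))
     - x * hopsum N x f (fun l => g (N :: l))).
Proof.
rewrite /hopsum /= pairsumDl pairsumZl pairsumDr pairsumZr.
by rewrite mulNr.
Qed.

(** A letter [N] above all the letters of [{1, .., N}] may change sides: the
    configurations in which it meets another letter cancel between the two
    sides, and the others agree by induction. *)
Let hopsum_swap N x gam f g : twinned gam f -> twinned gam g ->
  hopsum N x (fun l => f (N :: l)) g = hopsum N x f (fun l => g (N :: l)).
Proof.
elim: N f g => [|N IHN] f g tf tg.
  by have [_ f0] := tf; have [_ g0] := tg;
     rewrite /hopsum /= (f0 [::]) (g0 [::]).
rewrite !hopsumS; have [ft _] := tf; have [gt _] := tg.
have -> : hopsum N x (fun l => f [:: N.+1, N.+1 & l]) g = gam N.+1 * hopsum N x f g.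
  rewrite /hopsum -pairsumZl; apply: eq_pairsum => // l _.
  by rewrite -hopZ; apply: eq_hop => r; apply: (ft [::]).
have -> : hopsum N x f (fun l => g [:: N.+1, N.+1 & l]) = gam N.+1 * hopsum N x f g.
  rewrite /hopsum -pairsumZr; apply: eq_pairsum => // l _.
  by rewrite -hopZ; apply: eq_hop => r; apply: (gt [::]).
have swap1 := IHN _ _ (twinned_cons N.+1 tf) tg.
have swap2 := IHN _ _ tf (twinned_cons N.+1 tg).
have -> : hopsum N x (fun l => f [:: N.+1, N & l]) g =
   hopsum N x (fun l => f (N.+1 :: l)) (fun l => g (N :: l)) by exact: swap1.
have -> : hopsum N x f (fun l => g [:: N.+1, N & l]) =
   hopsum N x (fun l => f (N :: l)) (fun l => g (N.+1 :: l)) by exact: esym swap2.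
ring.
Qed.

(** By induction on [N], splitting by the side of the letter [N]: the two terms in
    which this letter is lowered cancel by [hopsum_swap]. *)
Lemma pairsum_hop N x gam f g : twinned gam f -> twinned gam g ->
  pairsum N (hop x f) (hop (- x) g) = pairsum N f g.
Proof.
rewrite -/(hopsum N x f g).
elim: N f g => [|N IHN] f g tf tg; first by [].
rewrite hopsumS (hopsum_swap N x tf tg) /=.
rewrite -(IHN _ _ (twinned_cons N.+1 tf) tg) -(IHN _ _ tf (twinned_cons N.+1 tg)).
ring.
Qed.
End PairSum.

(** * Products of linear factors *)

Section LinearFactors.
Variables (R : comNzRingType) (I : Type).
Implicit Types (s : seq I) (P : pred I) (x y : I -> R).

Definition linprod s P x : {poly R} := \prod_(i <- s | P i) (1 + x i *: 'X).

Lemma linprod0 s P x : (linprod s P x)`_0 = 1.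
Proof.
rewrite /linprod; elim/big_rec: _ => [|i p _ p0]; first by rewrite coef1.
by rewrite mulrC coef_mulX1 p0 /= mul0r addr0.
Qed.

Lemma size_linprod s P x : (size (linprod s P x) <= (count P s).+1)%N.
Proof.
rewrite /linprod; elim: s => [|i s IHs]; first by rewrite big_nil size_poly1.
rewrite big_cons /=; case: (P i) => //=; rewrite mulrDl mul1r.
rewrite (leq_trans (size_polyD _ _)) // geq_max (leq_trans IHs) //=.
rewrite -scalerAl (leq_trans (size_scale_leq _ _)) // mulrC.
by rewrite (leq_trans (size_polyMleq _ _)) // size_polyX addn2.
Qed.

(** The diagonal entries are elementary symmetric functions of the squares. *)
Lemma q2_diag_linprod s P x y k : (forall i, x i ^+ 2 = y i ^+ 2) ->
  q2 (linprod s P x) k k = q2 (linprod s P y) k k.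
Proof.
move=> xy; rewrite /linprod; elim: s k => [|i s IHs] k; first by rewrite !big_nil.
rewrite !big_cons; case: (P i) => //; rewrite ![(1 + _) * _]mulrC.
by rewrite !q2_diag_hop IHs xy; case: k => // k; rewrite IHs.
Qed.
End LinearFactors.

Lemma twinned_wQ (R : comNzRingType) (p : {poly R}) :
  p`_0 = 1 -> twinned (fun k => q2 p k k) (wQ p).
Proof. by move=> p0; split=> [l k r|l]; [apply: wQ_twin | apply: wQ_rcons0]. Qed.

(** The two factors act by lowering letters at opposite prices, so they can be
    dropped together. *)
Lemma pairsum_wQ_flip (R : comNzRingType) N (p q : {poly R}) a :
  p`_0 = 1 -> q`_0 = 1 -> (forall k, q2 p k k = q2 q k k) ->
  pairsum N (wQ (p * (1 + a *: 'X))) (wQ (q * (1 - a *: 'X)))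
  = pairsum N (wQ p) (wQ q).
Proof.
move=> p0 q0 pq; rewrite -(pairsum_hop N a (twinned_wQ p0)).
  apply: eq_pairsum => l /and3P[pl l0 _]; rewrite -?scaleNr; exact: wQ_hop.
have [qt qz] := twinned_wQ q0.
by split=> // l k r; rewrite qt pq.
Qed.

(** Two sign changes remove two variables from either side; then no variable
    is left to make use of the letter [N], which has to stand on some side. *)
Lemma pairsum_wQ_flip2 (R : comNzRingType) N (p q : {poly R}) a b :
  p`_0 = 1 -> q`_0 = 1 -> (forall k, q2 p k k = q2 q k k) ->
  (0 < N)%N -> (size p <= N)%N -> (size q <= N)%N ->
  pairsum N (wQ (p * (1 + a *: 'X) * (1 + b *: 'X)))
            (wQ (q * (1 - a *: 'X) * (1 - b *: 'X))) = 0.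
Proof.
move=> p0 q0 pq N0 sp sq; rewrite pairsum_wQ_flip.
- rewrite pairsum_wQ_flip //; case: N N0 sp sq => // N _ sp sq /=.
  rewrite (@eq_pairsum _ _ _ (fun l => 0 * wQ p l) _ (wQ q)) //; last first.
    by move=> l _; rewrite mul0r; apply: wQ_big.
  rewrite (@eq_pairsum _ N (wQ p) (wQ p) _ (fun l => 0 * wQ q l)) //; last first.
    by move=> l _; rewrite mul0r; apply: wQ_big.
  by rewrite pairsumZl pairsumZr !mul0r addr0.
- by rewrite coef_mulX1 p0 /= mul0r addr0.
- by rewrite -scaleNr coef_mulX1 q0 /= mul0r addr0.
- move=> k; rewrite -scaleNr !q2_diag_hop pq sqrrN.
  by case: k => // k; rewrite pq.
Qed.

(** * The pairing of a family of variables with itself *)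

Section Top.
Variable R : comNzRingType.
Implicit Types (p q : {poly R}) (f g : seq nat -> R).

Definition topcoef (d : nat) (c : R) p := (size p <= d.+1)%N /\ p`_d = c.

Lemma topcoefD d c1 c2 p q :
  topcoef d c1 p -> topcoef d c2 q -> topcoef d (c1 + c2) (p + q).
Proof.
move=> [sp <-] [sq <-]; split; last by rewrite coefD.
by rewrite (leq_trans (size_polyD _ _)) // geq_max sp.
Qed.

Lemma topcoef_mulX d c p : topcoef d c p -> topcoef d.+1 c ('X * p).
Proof.
move=> [sp <-]; split; last by rewrite coefXM.
by rewrite (leq_trans (size_polyMleq _ _)) // size_polyX.
Qed.

Lemma topcoef_lift d c p : topcoef d c p -> topcoef d.+1 0 p.
Proof. by move=> [sp _]; split; [exact: leqW | rewrite nth_default]. Qed.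

Lemma topcoefM d e b c p q :
  topcoef d b p -> topcoef e c q -> topcoef (d + e) (b * c) (p * q).
Proof.
move=> [sp <-] [sq <-]; split.
  rewrite (leq_trans (size_polyMleq _ _)) //; lia.
rewrite coefM; have dlt : (d < (d + e).+1)%N by rewrite ltnS leq_addr.
rewrite (bigD1 (Ordinal dlt)) //= addKn big1 ?addr0 // => i; rewrite -val_eqE /=.
rewrite neq_ltn => /orP[id|di]; last by rewrite nth_default ?mul0r // (leq_trans sp).
by rewrite [q`__]nth_default ?mulr0 // (leq_trans sq) // ltn_subRL; lia.
Qed.

(** The top degree is reached by lowering all the letters. *)
Lemma topcoef_hop f l : all (ltn 0) l ->
  topcoef (size l) (f (map predn l)) (hop 'X (fun r => (f r)%:P) l).
Proof.
elim: l f => [|k l IHl] f /=.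
  by split; rewrite ?coefC // size_polyC leq_b1.
case: k => //= k l0; rewrite -[X in topcoef _ X]add0r.
apply: topcoefD; first exact: topcoef_lift (IHl _ l0).
exact: topcoef_mulX (IHl (fun r => f (k :: r)) l0).
Qed.

Lemma topcoef_pairsum N d e f g (F G : seq nat -> {poly R}) :
  (forall l, strict N l -> topcoef (d + size l) (f l) (F l)) ->
  (forall l, strict N l -> topcoef (e + size l) (g l) (G l)) ->
  topcoef (d + e + N) (pairsum N f g) (pairsum N F G).
Proof.
elim: N d e f g F G => [|N IHN] d e f g F G tF tG /=.
  by rewrite addn0 -[d]addn0 -[e]addn0; apply: topcoefM; [apply: tF | apply: tG].
have up l : strict N l -> strict N.+1 l.
  case/and3P=> pl l0 lN; apply/and3P; split=> //.
  by apply: sub_all lN => k /leqW.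
have co l : strict N l -> strict N.+1 (N.+1 :: l).
  case/and3P=> pl l0 lN; apply/and3P; split=> //=.
    by rewrite pl andbT; apply: sub_all lN => k; rewrite /= ltnS.
  by rewrite leqnn; apply: sub_all lN => k /leqW.
apply: topcoefD.
  rewrite addnS -!addSn; apply: IHN => l sl; last by apply: tG; apply: up.
  by rewrite addSnnS; apply: tF; apply: co.
rewrite addnS -addSn -addnS; apply: IHN => l sl; first by apply: tF; apply: up.
by rewrite addSnnS; apply: tG; apply: co.
Qed.

(** When all the letters are lowered, the letter 1 becomes a final 0, which can
    be dropped on whichever side it stands; hence the factor 2. *)
Lemma pairsum_pred N f g :
  (forall l, f (rcons l 0%N) = f l) -> (forall l, g (rcons l 0%N) = g l) ->
  pairsum N.+1 (fun l => f (map predn l)) (fun l => g (map predn l))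
  = 2 * pairsum N f g.
Proof.
elim: N f g => [|N IHN] f g f0 g0.
  by rewrite /= (f0 [::]) (g0 [::]); ring.
rewrite -[LHS]/(pairsum N.+1 (fun l => f (N.+1 :: map predn l)) (fun l => g (map predn l))
 + pairsum N.+1 (fun l => f (map predn l)) (fun l => g (N.+1 :: map predn l))).
rewrite (IHN (fun l => f (N.+1 :: l)) g) // ?(IHN f (fun l => g (N.+1 :: l))) //.
- by rewrite /= mulrDr.
- by move=> l; rewrite -rcons_cons.
- by move=> l; rewrite -rcons_cons.
Qed.
End Top.

Section Morph.
Variables (R S : comNzRingType) (phi : {rmorphism R -> S}).

Lemma rmorph_hop x f l : phi (hop x f l) = hop (phi x) (fun r => phi (f r)) l.
Proof.
elim: l f => //= k l IHl f; rewrite rmorphD rmorphM !IHl.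
by case: k => //=; rewrite rmorph0.
Qed.

Lemma rmorph_pairsum N f g : phi (pairsum N f g) =
  pairsum N (fun r => phi (f r)) (fun r => phi (g r)).
Proof.
by elim: N f g => [|N IHN] f g /=; rewrite ?rmorphM // rmorphD !IHN.
Qed.

End Morph.

Section SelfPairing.
Variable B : idomainType.
Implicit Types (z : B) (zs : seq B).

Fixpoint sumprod zs : B :=
  if zs is z :: zs' then \prod_(y <- zs') (z + y) * sumprod zs' else 1.

Let E zs := linprod zs xpredT id.

(** By induction on the number of variables.  As a polynomial in the first one,
    [z], the pairing has degree at most the number of the other variables; it
    vanishes at their opposites, where two signs change, and its top coefficient
    is given by the pairing of the other variables with themselves. *)
Lemma pairsum_wQ_self N zs : size zs = N.+1 -> uniq zs ->
  pairsum N (wQ (E zs)) (wQ (E zs)) = 2 ^+ N * sumprod zs.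
Proof.
elim: N zs => [|N IHN] [|z zs] // [sz]; rewrite cons_uniq => /andP[_ uzs].
  by case: zs sz {uzs} => // _; rewrite /= big_nil !mulr1.
pose f := wQ (E zs).
have Ez y : E (y :: zs) = E zs * (1 + y *: 'X).
  by rewrite /E /linprod big_cons mulrC.
have hopE y : pairsum N.+1 (wQ (E (y :: zs))) (wQ (E (y :: zs)))
    = pairsum N.+1 (hop y f) (hop y f).
  by rewrite Ez; apply: eq_pairsum => l /and3P[pl l0 _]; apply: wQ_hop.
pose phi := pairsum N.+1 (hop 'X (fun l => (f l)%:P)) (hop 'X (fun l => (f l)%:P)).
have phiE y : phi.[y] = pairsum N.+1 (hop y f) (hop y f).
  rewrite /phi -/(horner_eval y _) rmorph_pairsum.
  by apply: eq_pairsum => l _; rewrite rmorph_hop /= /horner_eval hornerX;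
     apply: eq_hop => r; rewrite hornerC.
have f0 l : f (rcons l 0%N) = f l by apply: wQ_rcons0; apply: linprod0.
have [sphi cphi] : topcoef N.+1 (2 * pairsum N f f) phi.
  rewrite -pairsum_pred //; apply: (topcoef_pairsum (d := 0) (e := 0)) => l /and3P[_ l0 _];
  exact: topcoef_hop.
have c2 : 2 * pairsum N f f = 2 ^+ N.+1 * sumprod zs.
  by rewrite IHN // exprS mulrA.
have root_phi y : y \in zs -> phi.[- y] = 0.
  move=> yzs; rewrite phiE -hopE; have py := perm_to_rem yzs.
  have e1 : E (- y :: zs) = E (rem y zs) * (1 + y *: 'X) * (1 + (- y) *: 'X).
    by rewrite Ez /E /linprod (perm_big _ py) big_cons; congr (_ * _); rewrite mulrC.
  have e2 : E (- y :: zs) = E (rem y zs) * (1 - y *: 'X) * (1 - (- y) *: 'X).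
    by rewrite e1 mulrAC -!scaleNr opprK.
  have szr : (size (E (rem y zs)) <= N.+1)%N.
    rewrite (leq_trans (size_linprod _ _ _)) // count_predT size_rem // sz.
    by rewrite ltnS.
  by rewrite {1}e1 e2 pairsum_wQ_flip2 //; apply: linprod0.
rewrite hopE -phiE.
pose psi := \prod_(y <- zs) ('X - (- y)%:P).
have spsi : size psi = N.+2.
  by rewrite /psi -(big_map (fun y => - y) xpredT (fun y => 'X - y%:P))
    size_prod_XsubC size_map sz.
have mpsi : psi \is monic by apply: monic_prod_XsubC.
have phi_psi : phi = (2 ^+ N.+1 * sumprod zs) *: psi.
  apply/eqP; rewrite -subr_eq0; apply/eqP.
  apply: (@roots_geq_poly_eq0 _ _ [seq - y | y <- zs]).
  - apply/allP => _ /mapP[y yzs ->]; rewrite rootE hornerD hornerN hornerZ root_phi //.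
    rewrite /psi horner_prod (big_rem y) //= hornerXsubC subrr.
    by rewrite mul0r mulr0 subr0.
  - by rewrite map_inj_uniq //; apply: oppr_inj.
  - rewrite size_map sz; apply/leq_sizeP => j.
    rewrite leq_eqVlt => /orP[/eqP<-|jN].
      rewrite coefB coefZ cphi c2.
      have -> : psi`_N.+1 = 1.
        by have := monicP mpsi; rewrite lead_coefE spsi.
      by rewrite mulr1 subrr.
    rewrite coefB coefZ !nth_default ?mulr0 ?subrr ?spsi //.
    exact: leq_trans sphi jN.
rewrite phi_psi hornerZ /psi horner_prod /= -mulrA [sumprod _ * _]mulrC.
congr (_ * (_ * _)); apply: eq_bigr => y _.
by rewrite !hornerE opprK.
Qed.
End SelfPairing.

(** * Row expansion of the Pfaffian *)

Section PfaffianExpansion.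
Variable A : comNzRingType.

Lemma lift_perm_onto n (i j : 'I_n.+1) (s : 'S_n.+1) :
  s i = j -> exists t : 'S_n, s = lift_perm i j t.
Proof.
move=> sij; pose g k := odflt k (unlift j (s (lift i k))).
have gK k : lift j (g k) = s (lift i k).
  rewrite /g -sij; have : s i != s (lift i k) by rewrite (inj_eq perm_inj) neq_lift.
  by case/unlift_some => k' -> ->.
have g_inj : injective g.
  move=> k1 k2 /(congr1 (lift j)); rewrite !gK => /perm_inj; exact: lift_inj.
exists (perm g_inj); apply/permP => k.
case: (unliftP i k) => [k'|] ->; first by rewrite lift_perm_lift permE gK.
by rewrite lift_perm_id.
Qed.

Lemma lift_perm_inj n (i j : 'I_n.+1) : injective (lift_perm i j).
Proof.
move=> s t st; apply/permP => k; apply: (@lift_inj _ j).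
by rewrite -!(lift_perm_lift i j) st.
Qed.

Lemma sum_lift_perm n (i j : 'I_n.+1) (P : pred 'S_n.+1) (F : 'S_n.+1 -> A) :
  \sum_(s : 'S_n.+1 | (s i == j) && P s) F s
  = \sum_(t : 'S_n | P (lift_perm i j t)) F (lift_perm i j t).
Proof.
rewrite big_mkcondr [RHS]big_mkcond.
rewrite (eq_bigl (mem [set lift_perm i j t | t : 'S_n])) => [|s].
  rewrite big_imset /= => [|s t _ _]; last exact: lift_perm_inj.
  by apply: eq_bigl => t; rewrite inE.
apply/eqP/imsetP => [/lift_perm_onto[t ->]|[t _ ->]]; first by exists t.
by rewrite lift_perm_id.
Qed.

Section Step.
Variable m : nat.
Let ev (i : 'I_m) : 'I_m.*2 := Ordinal (even_subproof i).
Let od (i : 'I_m) : 'I_m.*2 := Ordinal (odd_subproof i).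

(** The normal form of a perfect matching in the definition of [pfaffian]. *)
Definition canon (s : 'S_m.*2) :=
  [forall i : 'I_m, (s (ev i) < s (od i))%N] &&
  [forall i : 'I_m, forall j : 'I_m, (i < j)%N ==> (s (ev i) < s (ev j))%N].

Lemma canonP (s : 'S_m.*2) : reflect
  ((forall i, (s (ev i) < s (od i))%N) /\
   (forall i j : 'I_m, (i < j)%N -> (s (ev i) < s (ev j))%N)) (canon s).
Proof.
apply: (iffP andP) => [[/forallP h1 /forallP h2]|[h1 h2]]; split.
- by [].
- by move=> i j ij; have /forallP/(_ j)/implyP := h2 i; apply.
- exact/forallP.
- by apply/forallP => i; apply/forallP => j; apply/implyP; apply: h2.
Qed.
End Step.

Let evS m (i : 'I_m) : Ordinal (even_subproof (lift ord0 i))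
  = lift ord0 (lift ord0 (Ordinal (even_subproof i))) :> 'I_(m.*2).+2.
Proof. exact: val_inj. Qed.
Let odS m (i : 'I_m) : Ordinal (odd_subproof (lift ord0 i))
  = lift ord0 (lift ord0 (Ordinal (odd_subproof i))) :> 'I_(m.*2).+2.
Proof. exact: val_inj. Qed.
Let ev0 m : Ordinal (even_subproof (ord0 : 'I_m.+1)) = ord0 :> 'I_(m.*2).+2.
Proof. exact: val_inj. Qed.
Let od0 m : Ordinal (odd_subproof (ord0 : 'I_m.+1)) = lift ord0 ord0 :> 'I_(m.*2).+2.
Proof. exact: val_inj. Qed.

Let lift_lt n (i : 'I_n.+1) (j k : 'I_n) : (lift i j < lift i k)%N = (j < k)%N.
Proof. by rewrite /= /bump; lia. Qed.

(** Matching the first index with the [j]-th of the others leaves a matching of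
    the remaining indices, which is in normal form at the same time. *)
Lemma canon_lift m (j : 'I_(m.*2).+1) (t : 'S_m.*2) :
  @canon m.+1 (lift_perm ord0 ord0 (lift_perm ord0 j t)) = canon t.
Proof.
set s := lift_perm _ _ _.
have s0 : s ord0 = ord0 by rewrite /s lift_perm_id.
have s1 : s (lift ord0 ord0) = lift ord0 j by rewrite /s lift_perm_lift lift_perm_id.
have sS k : s (lift ord0 (lift ord0 k)) = lift ord0 (lift j (t k)).
  by rewrite /s !lift_perm_lift.
apply/canonP/canonP => -[h1 h2]; split.
- by move=> i; have := h1 (lift ord0 i); rewrite evS odS !sS !lift_lt.
- move=> i k ik; have := h2 (lift ord0 i) (lift ord0 k).
  by rewrite !evS !sS !lift_lt; apply.
- move=> i; case: (unliftP ord0 i) => [i'|] ->; first by rewrite evS odS !sS !lift_lt.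
  by rewrite ev0 od0 s0 s1.
- move=> i k; case: (unliftP ord0 k) => [k'|] -> //.
  case: (unliftP ord0 i) => [i'|] ->; rewrite ?evS ?ev0 ?s0 !sS ?lift_lt //.
  exact: h2.
Qed.

(** Every index belongs to some pair, whose smaller element is in an even place,
    and the elements in the even places increase. *)
Lemma canon_ord0 m (s : 'S_(m.*2).+2) : @canon m.+1 s -> s ord0 = ord0.
Proof.
case/canonP => h1 h2; apply: val_inj; apply/eqP; rewrite -leqn0 leqNgt.
apply/negP => s0; have [k sk] : exists k, s k = ord0.
  by exists ((s^-1)%g ord0); rewrite permKV.
have kdiv : (k./2 < m.+1)%N by have := ltn_ord k; rewrite -ltn_double; lia.
have s0e : (s ord0 <= s (Ordinal (even_subproof (Ordinal kdiv))))%N.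
  case: (posnP k./2) => [k0|k0].
    by rewrite leq_eqVlt; apply/orP; left; apply/eqP; congr (nat_of_ord (s _));
       apply: val_inj; rewrite /= k0.
  by apply: ltnW; rewrite -[ord0]ev0; apply: h2.
have := odd_double_half k; case: (boolP (odd k)) => ok kE.
  have := h1 (Ordinal kdiv); have <- : k = Ordinal (odd_subproof (Ordinal kdiv)).
    by apply: val_inj; rewrite /= -[in LHS]kE.
  by rewrite sk.
move: s0e; have <- : k = Ordinal (even_subproof (Ordinal kdiv)).
  by apply: val_inj; rewrite /= -[in LHS]kE.
by rewrite sk => s00; move: s0; rewrite ltnNge => /negP[].
Qed.

Lemma pfaffian_row m (a : 'I_m.+1.*2 -> 'I_m.+1.*2 -> A) :
  pfaffian a = \sum_(j < (m.*2).+1) (-1) ^+ j * a ord0 (lift ord0 j) *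
    pfaffian (fun i k : 'I_m.*2 => a (lift ord0 (lift j i)) (lift ord0 (lift j k))).
Proof.
rewrite /pfaffian.
rewrite -[LHS]/(\sum_(s | @canon m.+1 s) (-1) ^+ odd_perm s * \prod_(i < m.+1)
      a (s (Ordinal (even_subproof i))) (s (Ordinal (odd_subproof i)))).
have -> : \sum_(s | @canon m.+1 s) (-1) ^+ odd_perm s * \prod_(i < m.+1)
      a (s (Ordinal (even_subproof i))) (s (Ordinal (odd_subproof i)))
  = \sum_(s : 'S_(m.*2).+2 | (s ord0 == ord0) && @canon m.+1 s)
      (-1) ^+ odd_perm s * \prod_(i < m.+1)
      a (s (Ordinal (even_subproof i))) (s (Ordinal (odd_subproof i))).
  apply: eq_bigl => s; case: (boolP (@canon m.+1 s)) => [cs|]; last by rewrite andbF.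
  by rewrite (canon_ord0 cs) eqxx.
rewrite sum_lift_perm (partition_big (fun s : 'S_(m.*2).+1 => s ord0) predT) //=.
apply: eq_bigr => j _; rewrite big_distrr /=.
under eq_bigl => s do rewrite andbC.
rewrite sum_lift_perm; apply: eq_big => [t|t ct]; first exact: canon_lift.
rewrite !odd_lift_perm /= signr_addb signr_odd -!mulrA; congr (_ * _).
rewrite big_ord_recl mulrCA; congr (_ * _).
  by rewrite ev0 od0 lift_perm_id lift_perm_lift lift_perm_id.
congr (_ * _); apply: eq_bigr => i _.
by rewrite evS odS !lift_perm_lift.
Qed.

Lemma pickE (h : nat -> seq nat -> A) l : pick h l =
  \sum_(j < size l) (-1) ^+ j * h (nth 0%N l j) (take j l ++ drop j.+1 l).
Proof.
elim: l h => [|y l IHl] h; first by rewrite big_ord0.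
rewrite /= big_ord_recl expr0 mul1r /= drop0; congr (_ + _).
rewrite IHl -sumrN; apply: eq_bigr => j _.
by rewrite /= exprS mulN1r mulNr.
Qed.

Lemma pfaffian_wpf m (a : nat -> nat -> A) l : size l = m.*2 ->
  pfaffian (fun i j : 'I_m.*2 => a (nth 0%N l i) (nth 0%N l j)) = wpf a m l.
Proof.
elim: m l => [|m IHm] [|x l] // sz.
  rewrite /pfaffian (big_pred1 1%g) => [|s].
    by rewrite odd_perm1 mul1r big_ord0.
  rewrite /= -/(canon s); have -> : s = 1%g by apply/permP => -[].
  by rewrite eqxx; apply/canonP; split=> -[].
have sz' : size l = (m.*2).+1 by case: sz.
rewrite pfaffian_row wpf_cons pickE sz'; apply: eq_bigr => j _.
rewrite -!mulrA; congr (_ * (_ * _)).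
have jl : (j < size l)%N by rewrite sz'.
have stk : size (take j l) = j by rewrite size_takel // ltnW.
rewrite -IHm; last by rewrite size_cat stk size_drop; lia.
have e (k : 'I_m.*2) : nth 0%N (x :: l) (lift ord0 (lift j k))
    = nth 0%N (take j l ++ drop j.+1 l) k.
  rewrite lift0 -[LHS]/(nth 0%N l (bump j k)) nth_cat stk /bump.
  case: (leqP j k) => jk; last by rewrite add0n nth_take.
  by rewrite add1n nth_drop; congr (nth _ _ _); lia.
by apply: eq_bigr => s _; congr (_ * _); apply: eq_bigr => i _; rewrite !e.
Qed.
End PfaffianExpansion.

(** * Evaluation of the kernel polynomial *)

Lemma eq_mpoly_morph n (R : nzRingType) (S : nzRingType)
    (f g : {rmorphism {mpoly R[n]} -> S}) :
  (forall c, f c%:MP = g c%:MP) -> (forall i, f 'X_i = g 'X_i) -> f =1 g.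
Proof.
move=> fgC fgX p; rewrite [p]mpolyE (rmorph_sum f) (rmorph_sum g).
apply: eq_bigr => m _; rewrite -mul_mpolyC (rmorphM f) (rmorphM g) fgC.
congr (_ * _); rewrite mpolyXE_id (rmorph_prod f) (rmorph_prod g).
by apply: eq_bigr => i _; rewrite (rmorphXn f) (rmorphXn g) fgX.
Qed.

Section Evaluation.
Variable n : nat.
Implicit Types (x y : 'I_n -> polyY n).

Definition evY y : polyY n -> polyY n := mmap (@mpolyC n Zhalf) y.
HB.instance Definition _ y := GRing.RMorphism.on (evY y).

Definition evXY x y : polyXY n -> polyY n := mmap (evY y) x.
HB.instance Definition _ x y := GRing.RMorphism.on (evXY x y).

Lemma evY_X y i : evY y 'X_i = y i.
Proof. by rewrite /evY mmapX mmap1U. Qed.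

Lemma evY_C y c : evY y c%:MP = c%:MP.
Proof. by rewrite /evY mmapC. Qed.

Lemma evXY_C x y c : evXY x y c%:MP = evY y c.
Proof. by rewrite /evXY mmapC. Qed.

Lemma evXY_xvar x y i : evXY x y (xvar i) = x i.
Proof. by rewrite /evXY mmapX mmap1U. Qed.

Lemma evXY_yvar x y i : evXY x y (yvar i) = y i.
Proof. by rewrite evXY_C evY_X. Qed.

Lemma evXY_map x y f : evXY x y (map_mpoly (@mpolyC n Zhalf) f) = evY x f.
Proof.
move: f; apply: (@eq_mpoly_morph _ _ _ (evXY x y \o map_mpoly (@mpolyC n Zhalf))
  (evY x)) => [c|i] /=.
  by rewrite map_mpolyC evXY_C !evY_C.
by rewrite map_mpolyX evXY_xvar evY_X.
Qed.

(** The generating function of the elementary symmetric functions. *)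
Definition lin x : {poly polyY n} := linprod (index_enum 'I_n) xpredT x.

Lemma evY_mesym y k : evY y (mesym n Zhalf k) = (lin y)`_k.
Proof.
have linE : lin y = \prod_i (y i *: 'X + 1).
  by apply: eq_bigr => i _; rewrite addrC.
have prodE (h : {set 'I_n}) : \prod_i (if i \in h then y i *: 'X else 1)
    = (\prod_(i in h) y i) *: 'X^#|h| :> {poly polyY n}.
  rewrite -big_mkcond /= -sum1_card -mul_polyC rmorph_prod /= -prodrXr -big_split /=.
  by apply: eq_bigr => i _; rewrite expr1 mul_polyC.
rewrite mesymE rmorph_sum /= linE bigA_distr /= coef_sum.
rewrite [RHS](bigID (fun h : {set 'I_n} => #|h| == k)) /=.
rewrite [X in _ = _ + X]big1 ?addr0 => [|h hk].
  apply: eq_bigr => h /eqP hk; rewrite /evY mmapX /mmap1.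
  rewrite prodE coefZ coefXn hk eqxx mulr1 [RHS]big_mkcond /=.
  by apply: eq_bigr => i _; rewrite mnmE; case: (i \in h).
by rewrite prodE coefZ coefXn eq_sym (negbTE hk) mulr0.
Qed.

Lemma evY_Qtilde2 y i j : evY y (Qtilde2 n i j) = q2 (lin y) i j.
Proof.
rewrite /Qtilde2 /Qtilde1 /q2 rmorphD !rmorphM rmorph_nat /= !evY_mesym rmorph_sum /=.
congr (_ + _ * _); apply: eq_bigr => k _.
by rewrite !rmorphM rmorphXn rmorphN1 /= !evY_mesym.
Qed.

Lemma nth_pad l i : nth 0%N (pad l) i = nth 0%N l i.
Proof.
rewrite /pad; case: ifP => // _; rewrite nth_rcons; case: ltngtP => // [lt|->].
  by rewrite nth_default // ltnW.
by rewrite nth_default.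
Qed.

Lemma evY_Qtilde y l : evY y (Qtilde n l) = wQ (lin y) l.
Proof.
rewrite /wQ -pfaffian_wpf ?size_pad // /Qtilde /pfaffian rmorph_sum /=.
apply: eq_bigr => s _; rewrite rmorphM rmorphXn rmorphN1 rmorph_prod /=.
by congr (_ * _); apply: eq_bigr => i _; rewrite evY_Qtilde2 !nth_pad.
Qed.
End Evaluation.

(** * Strict partitions as words *)

Section StrictPart.

Lemma mem_strict_part n (S : {set 'I_n.-1}) k :
  (k \in strict_part S) = [exists i in S, k == (val i).+1].
Proof.
rewrite mem_sort; apply/mapP/exists_inP => [[i iS ->]|[i iS /eqP->]].
  by exists i; rewrite // -mem_enum.
by exists i; rewrite ?mem_enum.
Qed.

Lemma strict_part_sorted n (S : {set 'I_n.-1}) : sorted gtn (strict_part S).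
Proof.
rewrite gtn_sorted_uniq_geq sort_uniq map_inj_uniq ?enum_uniq /=.
  by apply: sort_sorted => i j; apply: leq_total.
by move=> i j /= [] /val_inj.
Qed.

Definition lift_set N (b : bool) (S : {set 'I_N}) : {set 'I_N.+1} :=
  [set i | if unlift ord_max i is Some j then j \in S else b].

Lemma in_lift_set N b (S : {set 'I_N}) j :
  (lift ord_max j \in lift_set b S) = (j \in S).
Proof. by rewrite inE liftK. Qed.

Lemma max_lift_set N b (S : {set 'I_N}) : (ord_max \in lift_set b S) = b.
Proof. by rewrite inE unlift_none. Qed.

Lemma lift_setC N b (S : {set 'I_N}) : ~: lift_set b S = lift_set (~~ b) (~: S).
Proof.
by apply/setP => i; rewrite !inE; case: (unlift _ i) => // j; rewrite inE.
Qed.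

Lemma strict_part_lift N b (S : {set 'I_N}) :
  @strict_part N.+2 (lift_set b S)
  = if b then N.+1 :: @strict_part N.+1 S else @strict_part N.+1 S.
Proof.
have gt_trans : transitive gtn by move=> j i k /= ji kj; apply: ltn_trans kj ji.
apply: (irr_sorted_eq gt_trans ltnn); first exact: strict_part_sorted.
  case: b; last exact: strict_part_sorted.
  rewrite /= path_sortedE // strict_part_sorted andbT.
  by apply/allP => k; rewrite mem_strict_part => /exists_inP[i _ /eqP->] /=; rewrite ltnS.
move=> k; have e : (k \in @strict_part N.+2 (lift_set b S))
    = (k \in @strict_part N.+1 S) || (b && (k == N.+1)).
  rewrite !mem_strict_part; apply/exists_inP/orP => [[i]|].
    case: (unliftP ord_max i) => [j|] ->.
      rewrite in_lift_set => jS /eqP->; left; apply/exists_inP; exists j => //.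
      by apply/eqP; congr _.+1; apply: lift_max.
    by rewrite max_lift_set => -> /eqP ->; right; rewrite eqxx.
  case=> [/exists_inP[j jS kj]|/andP[b1 kN]].
    exists (lift ord_max j); rewrite ?in_lift_set // (eqP kj).
    by apply/eqP; congr _.+1; apply/esym/lift_max.
  by exists ord_max => //; rewrite max_lift_set.
by rewrite e; case: b {e}; rewrite ?orbF // inE orbC.
Qed.

Lemma sum_strict_part (R : comNzRingType) N (f g : seq nat -> R) :
  \sum_(S : {set 'I_N}) f (@strict_part N.+1 S) * g (@strict_part N.+1 (~: S))
  = pairsum N f g.
Proof.
elim: N f g => [|N IHN] f g.
  have e0 (S : {set 'I_0}) : @strict_part 1 S = [::].
    by rewrite /strict_part; case: (enum S) => [|[]].
  rewrite (big_pred1 set0) /= ?e0 // => S.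
  by apply/esym/eqP/setP => -[].
rewrite (reindex (fun p : bool * {set 'I_N} => lift_set p.1 p.2)) /=; last first.
  exists (fun S : {set 'I_N.+1} =>
    (ord_max \in S, [set j : 'I_N | lift ord_max j \in S])) => [[b S] _|S _] /=.
    by rewrite max_lift_set; congr (_, _); apply/setP => j; rewrite inE in_lift_set.
  apply/setP => i; case: (unliftP ord_max i) => [j|] ->.
    by rewrite in_lift_set inE.
  by rewrite max_lift_set.
rewrite -(pair_bigA _ (fun b S => f (@strict_part N.+2 (lift_set b S))
   * g (@strict_part N.+2 (~: lift_set b S)))) /= big_bool /= -!IHN.
by congr (_ + _); apply: eq_bigr => S _; rewrite lift_setC !strict_part_lift.
Qed.
End StrictPart.

Section KernelValue.
Variable m : nat.
Local Notation n := m.+1.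

Lemma count_strict_part (S : {set 'I_n.-1}) :
  count (fun p => p != 0%N) (@strict_part n S) = #|S|.
Proof.
rewrite /strict_part (seq.permP (permEl (perm_sort _ _))) count_map.
by rewrite (eq_count (a2 := predT)) // count_predT -cardE.
Qed.

(** Two complementary partitions have [m] parts in all, hence the same power of
    2 for all the terms. *)
Lemma evXY_PtildeXY (x y : 'I_n -> polyY n) :
  evXY x y (PtildeXY n)
  = ((2^-1 : Zhalf) ^+ m)%:MP * pairsum m (wQ (lin x)) (wQ (lin y)).
Proof.
rewrite /PtildeXY rmorph_sum /= -sum_strict_part big_distrr /=.
apply: eq_bigr => S _; rewrite rmorphM /= evXY_map evXY_C.
rewrite /Ptilde -!mul_mpolyC !rmorphM /= !evY_C !evY_Qtilde !count_strict_part.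
rewrite mulrACA -rmorphM /= -exprD.
by have := cardsC S; rewrite card_ord => ->.
Qed.
End KernelValue.

(** * Signed permutations acting on points *)

Section SignedAction.
Variables (n : nat) (T : comNzRingType).
Implicit Types (x y : 'I_n -> T) (w v : weylD n) (a b : letter n).

Definition pact x w : 'I_n -> T := fun k => (-1) ^+ wbar w k * x (wabs w k).

Lemma pactM x w v : pact x (w * v)%g =1 pact (pact x w) v.
Proof. by move=> k; rewrite /pact wbarM wabsM permM signr_addb mulrA. Qed.

Lemma pact1 x : pact x 1%g =1 x.
Proof. by move=> k; rewrite /pact wbar_one perm1 mul1r. Qed.

Lemma eq_pact x y w : x =1 y -> pact x w =1 pact y w.
Proof. by move=> e k; rewrite /pact e. Qed.

Definition dot x y : T := \sum_k x k * y k.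

Lemma dot_pact x y w : dot (pact x w) (pact y w) = dot x y.
Proof.
rewrite /dot [RHS](reindex_inj (@perm_inj _ (wabs w))); apply: eq_bigr => k _.
by rewrite /pact mulrACA -expr2 sqrr_sign mul1r.
Qed.

(** The positive root attached to a letter: [x_(i+1) - x_i] for s_i and
    [x_1 + x_2] for s_Box.  Up to sign this is [root], the divisor of the
    divided difference, and the sign is the one that separates the primed
    operators from the plain ones. *)
Definition sgl a : T := if is_box a then 1 else -1.
Definition rootv a : 'I_n -> T :=
  fun k => (k == pos2 a)%:R + sgl a * (k == pos1 a)%:R.
Definition rt x a : T := x (pos2 a) + sgl a * x (pos1 a).

Lemma dot_rootv x a : dot (rootv a) x = rt x a.
Proof.
rewrite /dot /rootv; under eq_bigr => k _ do rewrite mulrDl -mulrA.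
rewrite big_split /= -big_distrr /= (bigD1 (pos2 a)) //= eqxx mul1r big1.
  rewrite addr0; congr (_ + _ * _); rewrite (bigD1 (pos1 a)) //= eqxx mul1r.
  by rewrite big1 ?addr0 // => k /negbTE->; rewrite mul0r.
by move=> k /negbTE->; rewrite mul0r.
Qed.

Lemma eq_rt x y a : x =1 y -> rt x a = rt y a.
Proof. by move=> e; rewrite /rt !e. Qed.

Lemma wbar_simple a k :
  wbar (simple a) k = is_box a && ((k == pos1 a) || (k == pos2 a)).
Proof. exact: ffunE. Qed.

Lemma wabs_simple a : wabs (simple a) = tperm (pos1 a) (pos2 a).
Proof. by []. Qed.

Lemma pact_simple x a k : pact x (simple a) k = x k - rootv a k * rt x a.
Proof.
rewrite /pact wbar_simple wabs_simple /rootv /rt /sgl.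
have p12 := pos12 a; have p21 : pos2 a != pos1 a by rewrite eq_sym.
case: tpermP => [->|->|/eqP k1 /eqP k2].
- rewrite eqxx (negbTE p12) /= andbT; case: ifP => _ /=; ring.
- rewrite eqxx (negbTE p21) orbT andbT; case: ifP => _ /=; rewrite mulr0 addr0; ring.
- by rewrite (negbTE k1) (negbTE k2) andbF /=; ring.
Qed.
End SignedAction.

(** * Descents and exchange *)

(* Of the length, only its minimality among the words is used. *)
Opaque wlen.

Section Exchange.
Variable n : nat.
Implicit Types (w v u : weylD n) (a b : letter n) (t r : seq (letter n)).

(** The point [(1, 2, .., n)] has a trivial stabiliser. *)
Lemma weylD_pact_eq w v :
  (forall T : comNzRingType, forall x : 'I_n -> T, pact x w =1 pact x v) -> w = v.
Proof.
move=> e; have {e}e := e int (fun k => k.+1%:Z); apply: weylD_eqP => [|k].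
  apply/permP => k; have := e k; rewrite /pact => /(congr1 absz).
  by rewrite !abszM !absz_sign !mul1n => -[] /ord_inj.
have := e k; rewrite /pact; case: (wbar w k); case: (wbar v k) => //=; lia.
Qed.

(** A point at which all the simple roots have the value 1: the signs of the roots
    at its images decide whether a generator is a descent. *)
Definition rho (k : 'I_n) : int := k%:Z.

Lemma rt_rho a : rt rho a = 1.
Proof. by rewrite /rt /rho /sgl; case: a => a /=; lia. Qed.

Lemma rho_neq0 w a : rt (pact rho w) a != 0.
Proof.
have := pos12 a; rewrite -(inj_eq (@perm_inj _ (wabs w))) -val_eqE /= /rt /sgl /pact.
rewrite /rho; case: (is_box a); case: (wbar w _); case: (wbar w _) => //=; lia.
Qed.

(** [w] sends the root of [a] to a negative root. *)
Definition desc w a := rt (pact rho w) a < 0.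

Lemma rt_simple (T : comNzRingType) (x : 'I_n -> T) a : rt (pact x (simple a)) a = - rt x a.
Proof.
have p12 := pos12 a; have p21 : pos2 a != pos1 a by rewrite eq_sym.
rewrite {1}/rt !pact_simple /rootv !eqxx (negbTE p12) (negbTE p21).
by rewrite /rt /sgl; case: ifP => _ /=; ring.
Qed.

Lemma desc_simple w a : desc (w * simple a)%g a = ~~ desc w a.
Proof.
rewrite /desc (eq_rt a (pactM rho w (simple a))) rt_simple oppr_lt0 -leNgt.
by rewrite lt_neqAle eq_sym rho_neq0.
Qed.

Lemma simple2 a : (simple a * simple a = 1)%g.
Proof.
apply: weylD_pact_eq => T x k; rewrite pactM pact1 pact_simple rt_simple.
by rewrite pact_simple; ring.
Qed.

Lemma simpleV a : (simple a)^-1%g = simple a.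
Proof. by apply/eqP; rewrite eq_invg_mul simple2. Qed.

Lemma rootv_range a k : rootv int a k \in [:: -1; 0; 1].
Proof.
have p21 : pos2 a != pos1 a by rewrite eq_sym pos12.
rewrite /rootv /sgl; case: (eqVneq k (pos2 a)) => [->|_].
  by rewrite (negbTE p21); case: ifP.
by case: eqP => _; case: ifP.
Qed.

(** A simple reflection changes the sign of its own root and of no other
    positive root. *)
Lemma simple_conj a b u : ~~ desc u b -> desc (simple a * u)%g b ->
  (simple a * u = u * simple b)%g.
Proof.
move=> ub sub; pose xi := pact (rootv int a) u.
have xi_range k : xi k \in [:: -1; 0; 1].
  by rewrite /xi /pact; have := rootv_range a (wabs u k);
     rewrite !inE; case: (wbar u k) => /=; lia.
have big2 : 2 <= rt xi b.
  move: ub sub; rewrite /desc (eq_rt b (pactM rho (simple a) u)).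
  have e : pact (pact rho (simple a)) u =1 fun k => pact rho u k - xi k.
    move=> k; rewrite {1}/pact pact_simple rt_rho /xi /pact; ring.
  have := rho_neq0 u b.
  rewrite (eq_rt b e) /rt /sgl.
  by case: (is_box b); move: (pact rho u _) (pact rho u _) (xi _) (xi _); lia.
have [xi2 xi1] : xi (pos2 b) = 1 /\ xi (pos1 b) = sgl int b.
  move: big2 (xi_range (pos1 b)) (xi_range (pos2 b)).
  by rewrite /rt /sgl !inE; case: (is_box b); lia.
have xiE : xi =1 rootv int b.
  have supp k : xi k != 0 -> (wabs u k == pos1 a) || (wabs u k == pos2 a).
    rewrite /xi /pact /rootv; apply: contraR; rewrite negb_or => /andP[/negbTE-> /negbTE->].
    by rewrite mulr0 addr0 mulr0.
  have s1 : sgl int b != 0 by rewrite /sgl; case: ifP.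
  have /supp h1 : xi (pos1 b) != 0 by rewrite xi1.
  have /supp h2 : xi (pos2 b) != 0 by rewrite xi2.
  move=> k; rewrite [RHS]/rootv; have p12 := pos12 b.
  case: (eqVneq k (pos2 b)) => [->|k2].
    by rewrite eq_sym (negbTE p12) mulr0 addr0 xi2.
  case: (eqVneq k (pos1 b)) => [->|k1]; first by rewrite xi1 mulr1 add0r.
  rewrite mulr0 addr0; apply/eqP; apply: contraT => /supp hk.
  have uinj := inj_eq (@perm_inj _ (wabs u)).
  move: k1 k2 p12; rewrite -(uinj k) -(uinj _ (pos2 b)) -(uinj (pos1 b)).
  by case/orP: h1 => /eqP->; case/orP: h2 => /eqP->; case/orP: hk => /eqP->;
     rewrite ?eqxx.
apply: weylD_pact_eq => T x k; rewrite !pactM [RHS]pact_simple.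
have xiT : pact (rootv T a) u =1 rootv T b.
  have cast c (j : 'I_n) : rootv T c j = (rootv int c j)%:~R.
    rewrite /rootv /sgl rmorphD rmorphM /= !rmorph_nat.
    by case: ifP; rewrite ?rmorphN1 ?rmorph1.
  by move=> j; rewrite cast -xiE /xi /pact intrM rmorphXn rmorphN1 cast.
have -> : rt (pact x u) b = rt x a.
  rewrite -!dot_rootv -(dot_pact (rootv T a) x u).
  by apply: eq_bigr => j _; rewrite xiT.
rewrite -xiT {1}/pact pact_simple /pact; ring.
Qed.

Lemma wordprod_cons a t : wordprod (a :: t) = (simple a * wordprod t)%g.
Proof. by rewrite /wordprod big_cons. Qed.

Lemma wordprod_cat t r : wordprod (t ++ r) = (wordprod t * wordprod r)%g.
Proof. by rewrite /wordprod big_cat. Qed.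

Lemma wordprod1 a : wordprod [:: a] = simple a.
Proof. by rewrite /wordprod big_seq1. Qed.

Lemma wordprod_rev t : wordprod (rev t) = (wordprod t)^-1%g.
Proof.
elim: t => [|a t IHt]; first by rewrite /wordprod !big_nil invg1.
by rewrite rev_cons -cats1 wordprod_cat wordprod1 wordprod_cons invMg IHt simpleV.
Qed.

(** Applying the letters from right to left to the root of [b], some letter makes
    it negative; by [simple_conj] this letter can be deleted. *)
Lemma exchange t b : desc (wordprod t) b ->
  exists t1 a t2, t = t1 ++ a :: t2 /\
    wordprod (t1 ++ t2) = (wordprod t * simple b)%g.
Proof.
elim: t => [|a t IHt].
  by rewrite /desc /wordprod big_nil (eq_rt b (pact1 rho)) rt_rho.
rewrite wordprod_cons; case: (boolP (desc (wordprod t) b)) => [/IHt|nd d].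
  move=> [t1 [c [t2 [-> e]]]] _; exists (a :: t1), c, t2; split=> //.
  by rewrite cat_cons wordprod_cons e mulgA.
exists [::], a, t; split=> //.
by rewrite (simple_conj nd d) -mulgA simple2 mulg1.
Qed.

Definition reduced t := size t == wlen (wordprod t).
Arguments reduced : simpl never.

Lemma reduced_reduced_word w : reduced (reduced_word w).
Proof. by rewrite /reduced wordprod_reduced size_reduced. Qed.

Lemma wlen_mul_le w a : (wlen (w * simple a)%g <= (wlen w).+1)%N.
Proof.
rewrite -[X in wlen (X * _)%g]wordprod_reduced -wordprod1 -wordprod_cat.
by rewrite (leq_trans (wlen_min _)) // size_cat addn1 size_reduced.
Qed.

Lemma wlen_desc w a : desc w a -> wlen w = (wlen (w * simple a)%g).+1.
Proof.
move=> d; apply/eqP; rewrite eqn_leq; apply/andP; split.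
  by have := wlen_mul_le (w * simple a)%g a; rewrite -mulgA simple2 mulg1.
have := d; rewrite -{1}(wordprod_reduced w) => /exchange[t1 [b [t2 [e e2]]]].
rewrite -{1}(wordprod_reduced w) -e2 -(size_reduced w) e.
by rewrite (leq_ltn_trans (wlen_min _)) // !size_cat addnS.
Qed.

Lemma wlen_ndesc w a : ~~ desc w a -> wlen (w * simple a)%g = (wlen w).+1.
Proof.
rewrite -desc_simple => /wlen_desc ->.
by rewrite -mulgA simple2 mulg1.
Qed.

Lemma wlenV w : wlen w^-1%g = wlen w.
Proof.
have le v : (wlen v^-1%g <= wlen v)%N.
  rewrite -{1}(wordprod_reduced v) -wordprod_rev (leq_trans (wlen_min _)) //.
  by rewrite size_rev size_reduced.
apply/eqP; rewrite eqn_leq; apply/andP; split; first exact: le.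
by have := le w^-1%g; rewrite invgK.
Qed.

Lemma wlen1 : wlen (1%g : weylD n) = 0%N.
Proof. by have := @wlen_min n [::]; rewrite /wordprod big_nil leqn0 => /eqP. Qed.

Lemma wlen0_eq w : wlen w = 0%N -> w = 1%g.
Proof.
rewrite -{2}(wordprod_reduced w) -size_reduced => /size0nil ->.
by rewrite /wordprod big_nil.
Qed.

Lemma wlen_mulV w a : (wlen (simple a * w)%g < wlen w)%N = desc w^-1%g a.
Proof.
rewrite -(wlenV w) -wlenV invMg simpleV; apply/idP/idP => [|/wlen_desc ->] //.
by apply: contraLR => /wlen_ndesc ->; rewrite -leqNgt leqW.
Qed.

Lemma exchange_left t b : (wlen (simple b * wordprod t)%g < wlen (wordprod t))%N ->
  exists t1 a t2, t = t1 ++ a :: t2 /\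
    wordprod (t1 ++ t2) = (simple b * wordprod t)%g.
Proof.
rewrite wlen_mulV -wordprod_rev => /exchange[t1 [a [t2 [e e2]]]].
exists (rev t2), a, (rev t1); split.
  by rewrite -[t]revK e rev_cat rev_cons cat_rcons.
rewrite -rev_cat wordprod_rev e2 wordprod_rev invMg invgK; congr (_ * _)%g.
exact: simpleV.
Qed.

Lemma reduced_cons a t : reduced (a :: t) -> reduced t.
Proof.
rewrite /reduced wordprod_cons => /eqP e; rewrite eqn_leq wlen_min andbT -ltnS.
have -> : (size t).+1 = wlen (simple a * wordprod t)%g by [].
have := wlen_mul_le (wordprod t)^-1%g a; rewrite wlenV.
by rewrite -{1}(simpleV a) -invMg wlenV.
Qed.

Lemma simple_inj : injective (@simple n).
Proof.
move=> a b ab; have ebox : is_box a = is_box b.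
  have := congr1 (fun w => wbar w (pos1 a)) ab.
  have := congr1 (fun w => wbar w (pos1 b)) ab.
  by rewrite /= !wbar_simple !eqxx /= !andbT; case: (is_box a); case: (is_box b).
have := congr1 (fun w => wabs w (pos1 a)) ab.
rewrite /= !wabs_simple tpermL; case: a b ebox {ab} => [i|i] [j|j] //= _; last first.
  move=> _; congr inr; apply: val_inj => /=.
  by case: i j => [i /= li] [j /= lj]; case: (1 < n)%N li lj; lia.
case: tpermP => [e|e|_ _] /(congr1 val) /=; last by lia.
  by move/(congr1 val): e => /= e _; congr inl; apply: val_inj.
by move/(congr1 val): e => /=; lia.
Qed.

(** * Words of the same element *)

Section Matsumoto.
Variables (M : Type) (op : letter n -> M -> M).

Hypothesis op_braid : forall a b, a != b ->
  ((simple a * simple b = simple b * simple a)%g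
   /\ forall f, op a (op b f) = op b (op a f)) \/
  [/\ (simple a * simple b * simple a = simple b * simple a * simple b)%g,
      (simple a * simple b <> simple b * simple a)%g
    & forall f, op a (op b (op a f)) = op b (op a (op b f))].

(** Two reduced words of [w] that start with [a] and [b] can both be brought to
    words that start with the commutation or braid relation of [a] and [b], by
    changing only their tails; the exchange condition supplies these words. *)
Lemma reduced_foldr t r f : reduced t -> reduced r -> wordprod t = wordprod r ->
  foldr op f t = foldr op f r.
Proof.
have [l] := ubnP (size t); elim: l t r f => // l IHl t r f lt_t rt rr tr.
have szE : size t = size r by rewrite (eqP rt) (eqP rr) tr.
case: t r szE rt rr tr lt_t => [|a t] [|b r] // [szE] rt rr tr lt_t.
have rt' := reduced_cons rt; have rr' := reduced_cons rr.
have [ab|ab] := eqVneq a b.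
  rewrite ab /= in tr *; congr op; apply: IHl => //.
  by move: tr; rewrite !wordprod_cons; apply: mulgI.
have desc_b : (wlen (simple b * wordprod (a :: t))%g < wlen (wordprod (a :: t)))%N.
  by rewrite -(eqP rt) tr wordprod_cons mulgA simple2 mul1g -(eqP rr') /= szE.
have desc_a (s : seq (letter n)) : wordprod s = wordprod (a :: t) ->
    (wlen (simple a * wordprod s)%g < wlen (wordprod s))%N.
  by move=> ->; rewrite -(eqP rt) wordprod_cons mulgA simple2 mul1g -(eqP rt').
have [t1 [c [t2 [e1 e2]]]] := exchange_left desc_b.
case: t1 e1 e2 => [|a' q1] /= [ca te] e2.
  case/eqP: ab; apply: simple_inj; apply: (@mulIg _ (wordprod t)).
  move: e2; rewrite -te wordprod_cons => {2}->.
  by rewrite !mulgA simple2 mul1g.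
rewrite -ca in e2 => {a' ca}; set q := q1 ++ t2 in e2.
have szq : size t = (size q).+1 by rewrite te !size_cat addnS.
have wE : wordprod (a :: t) = wordprod [:: b, a & q].
  by rewrite [RHS]wordprod_cons e2 mulgA simple2 mul1g.
have red s : size s = size t -> wordprod s = wordprod t -> reduced s.
  by move=> s1 s2; rewrite /reduced s1 s2; apply: rt'.
have red' s : size s = size r -> wordprod s = wordprod r -> reduced s.
  by move=> s1 s2; rewrite /reduced s1 s2; apply: rr'.
have rE : wordprod (a :: q) = wordprod r.
  by move: wE; rewrite tr !wordprod_cons => /mulgI.
have szq2 : size (a :: q) = size r by rewrite -szE szq.
have lt_q : (size (a :: q) < l)%N by rewrite szq2 -szE.
have Er := IHl (a :: q) r f lt_q (red' (a :: q) szq2 rE) rr' rE.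
have lt_t' : (size t < l)%N by [].
have [[comm opc]|[braid ncomm opb]] := op_braid ab.
  have tE : wordprod (b :: q) = wordprod t.
    apply: (@mulgI _ (simple a)); rewrite -[RHS]wordprod_cons wE !wordprod_cons.
    by rewrite !mulgA comm.
  have Et := IHl (b :: q) t f lt_q (red (b :: q) (esym szq) tE) rt' tE.
  by rewrite [LHS]/= -Et [RHS]/= -Er /= opc.
have [t1' [c' [t2' [e1' e2']]]] := exchange_left (desc_a _ (esym wE)).
case: t1' e1' e2' => [|b' [|a' q1']].
- move=> [_ <-]; rewrite [_ ++ _]/= !wordprod_cons !mulgA => /mulIg e.
  case/eqP: ab; apply: simple_inj; apply: (@mulgI _ (simple a)).
  by apply: (@mulIg _ (simple a)); rewrite -e simple2 mul1g.
- move=> [<- [_ <-]]; rewrite [_ ++ _]/= !wordprod_cons !mulgA => /mulIg e.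
  case: ncomm; apply: (@mulIg _ (simple a)).
  by rewrite -e -mulgA simple2 mulg1.
move=> [<- [<- qe]]; set q' := q1' ++ t2'; rewrite [_ ++ _]/= -/q' => e2'.
have szq' : size q = (size q').+1 by rewrite qe !size_cat addnS.
have tE : wordprod [:: b, a & q'] = wordprod t.
  apply: (@mulgI _ (simple a)); rewrite e2' mulgA simple2 mul1g -wE.
  exact: wordprod_cons.
have rE' : wordprod [:: a, b & q'] = wordprod r.
  apply: (@mulgI _ (simple b)); rewrite -[RHS]wordprod_cons -tr.
  by rewrite [RHS]wordprod_cons -tE !wordprod_cons !mulgA braid.
have sz1 : size [:: b, a & q'] = size t by rewrite /= -szq' -szq.
have sz2 : size [:: a, b & q'] = size r by rewrite -szE -sz1.
have lt1 : (size [:: b, a & q'] < l)%N by rewrite sz1.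
have lt2 : (size [:: a, b & q'] < l)%N by rewrite sz2 -szE.
have Et' := IHl [:: b, a & q'] t f lt1 (red [:: b, a & q'] sz1 tE) rt' tE.
have Er' := IHl [:: a, b & q'] r f lt2 (red' [:: a, b & q'] sz2 rE') rr' rE'.
by rewrite [LHS]/= -Et' [RHS]/= -Er' /= opb.
Qed.
End Matsumoto.
End Exchange.

(** * Divided differences *)

Section Cartan.
Variable n : nat.
Implicit Types (a b : letter n).

Definition cartan a b : int := rt (rootv int a) b.

Lemma rt_rootv (T : comNzRingType) a b : rt (rootv T a) b = (cartan a b)%:~R.
Proof.
rewrite /cartan /rt /rootv /sgl; do 2!case: (is_box _);
by rewrite !(rmorphD, rmorphM, rmorphN1, rmorph1, rmorph_nat).
Qed.

Lemma cartanC a b : cartan a b = cartan b a.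
Proof. by rewrite /cartan -!dot_rootv; apply: eq_bigr => k _; rewrite mulrC. Qed.

Lemma cartan_diag a : cartan a a = 2.
Proof.
have p12 := pos12 a; have p21 : pos2 a != pos1 a by rewrite eq_sym.
rewrite /cartan /rt /rootv !eqxx (negbTE p12) (negbTE p21) /sgl.
by case: ifP.
Qed.

Lemma cartan_cases a b : a != b -> cartan a b = 0 \/ cartan a b = -1.
Proof.
rewrite /cartan /rt /rootv -!val_eqE /sgl.
case: a b => [i|i] [j|j] /= ab.
- have ij : i != j :> nat by apply: contra ab => /eqP/val_inj->.
  by do ?[case: eqP => ? /=]; lia.
- by do ?[case: eqP => ? /=]; lia.
- by do ?[case: eqP => ? /=]; lia.
- case/eqP: ab; congr inr; apply: val_inj => /=.
  by case: i j => [i /= li] [j /= lj]; case: (1 < n)%N li lj; lia.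
Qed.

Lemma rt_pact_simple (T : comNzRingType) (x : 'I_n -> T) a b :
  rt (pact x (simple a)) b = rt x b - (cartan a b)%:~R * rt x a.
Proof.
rewrite -rt_rootv {1}/rt !pact_simple /rt; ring.
Qed.

Lemma simple_rel a b : a != b ->
  (cartan a b = 0 /\ (simple a * simple b = simple b * simple a)%g) \/
  [/\ cartan a b = -1,
      (simple a * simple b * simple a = simple b * simple a * simple b)%g
    & (simple a * simple b <> simple b * simple a)%g].
Proof.
case/cartan_cases => cab; [left | right].
  split=> //; apply: weylD_pact_eq => T x k; rewrite !pactM !pact_simple.
  rewrite !rt_pact_simple (cartanC b a) cab; ring.
split=> //.
  apply: weylD_pact_eq => T x k; rewrite !pactM.
  rewrite !(eq_pact _ (pactM _ _ _)) !pact_simple !rt_pact_simple.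
  rewrite !cartan_diag (cartanC b a) cab; ring.
move=> comm; have e k : rootv int a k = rootv int b k.
  have := congr1 (fun w => pact (rho (n := n)) w k) comm.
  rewrite !pactM !pact_simple !rt_pact_simple (cartanC b a) cab !rt_rho.
  move: (rootv int a k) (rootv int b k) (rho k) => x y z; lia.
by move: cab; rewrite /cartan (eq_rt b e) -/(cartan b b) cartan_diag.
Qed.
End Cartan.

(** An iterated divided difference, multiplied by the roots of the group that the
    reflections [s] and [t] generate, is an alternating sum over this group, which
    is symmetric in [s] and [t]. *)
Lemma braid_algebra (T : comNzRingType) (s t : {rmorphism T -> T})
    (al be f g h k : T) :
  s al = - al -> s be = al + be -> t al = al + be -> s g = g ->
  al * g = f - s f -> be * h = g - t g -> al * k = h - s h ->
  al * be * (al + be) * k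
  = f - s f - t f + s (t f) + t (s f) - s (t (s f)).
Proof.
move=> sal sbe tal sg e1 e3 e6.
have e2 : (al + be) * t g = t f - t (s f) by rewrite -tal -rmorphM e1 rmorphB.
have e4 : (al + be) * s h = g - s (t g) by rewrite -sbe -rmorphM e3 rmorphB sg.
have e5 : be * s (t g) = s (t f) - s (t (s f)).
  have sab : s (al + be) = be by rewrite rmorphD sal sbe; ring.
  by rewrite -{1}sab -rmorphM e2 rmorphB.
have -> : al * be * (al + be) * k = be * (al + be) * (al * k) by ring.
have -> : be * (al + be) * (al * k) = (al + be) * (be * h) - be * ((al + be) * s h).
  by rewrite e6; ring.
have -> : (al + be) * (be * h) - be * ((al + be) * s h)
    = al * g - (al + be) * t g + be * s (t g) by rewrite e3 e4; ring.
by rewrite e1 e2 e5; ring.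
Qed.

Lemma comm_algebra (T : comNzRingType) (s t : {rmorphism T -> T})
    (al be f g h : T) :
  s be = be -> be * g = f - t f -> al * h = g - s g ->
  al * be * h = f - s f - t f + s (t f).
Proof.
move=> sbe e1 e2; have e3 : be * s g = s f - s (t f).
  by rewrite -{1}sbe -rmorphM e1 rmorphB.
have -> : al * be * h = be * (al * h) by ring.
by rewrite e2 mulrBr e1 e3; ring.
Qed.

Lemma swap4 (V : zmodType) (f x y z : V) : f - x - y + z = f - y - x + z.
Proof. by rewrite (addrAC f). Qed.

Lemma swap6 (V : zmodType) (f x y p q r : V) :
  f - x - y + p + q - r = f - y - x + q + p - r.
Proof. by rewrite (addrAC f) (addrAC _ p). Qed.

(* Of the divided difference, only the equation [ddE] is used, which determines
   it. *)
HB.lock Definition dd (n : nat) (R : comNzRingType) (a : letter n)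
  (f : {mpoly R[n]}) : {mpoly R[n]} := ddiff' a f.

Section DiffOps.
Variables (n : nat) (R : idomainType).
Implicit Types (f g : {mpoly R[n]}) (a b : letter n) (w v : weylD n).

Lemma wact_is_monoid_morphism w : monoid_morphism (@wact n R w).
Proof. by split=> [|f g]; rewrite /wact ?rmorph1 ?rmorphM. Qed.
Lemma wact_is_zmod_morphism w : zmod_morphism (@wact n R w).
Proof. by move=> f g; rewrite /wact rmorphB. Qed.
HB.instance Definition _ w :=
  GRing.isZmodMorphism.Build _ _ (@wact n R w) (wact_is_zmod_morphism w).
HB.instance Definition _ w :=
  GRing.isMonoidMorphism.Build _ _ (@wact n R w) (wact_is_monoid_morphism w).

Lemma wactD w f g : wact w (f + g) = wact w f + wact w g.
Proof. exact: rmorphD. Qed.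
Lemma wactB w f g : wact w (f - g) = wact w f - wact w g.
Proof. exact: rmorphB. Qed.
Lemma wactN w f : wact w (- f) = - wact w f.
Proof. exact: rmorphN. Qed.
Lemma wact_mul w f g : wact w (f * g) = wact w f * wact w g.
Proof. exact: rmorphM. Qed.
Lemma wact0 w : wact w 0 = 0 :> {mpoly R[n]}.
Proof. exact: rmorph0. Qed.

Definition mX (i : 'I_n) : {mpoly R[n]} := 'X_i.

Lemma wact_X w i : wact w (mX i) = pact mX w i.
Proof. by rewrite /wact comp_mpolyXU -tnth_nth tnth_mktuple. Qed.

Lemma wact_C w c : wact w c%:MP = c%:MP :> {mpoly R[n]}.
Proof. by rewrite /wact comp_mpolyC. Qed.

Lemma wactM w v f : wact (w * v)%g f = wact w (wact v f).
Proof.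
move: f; apply: (@eq_mpoly_morph _ _ _ _ (wact w \o wact v)) => [c|i] /=.
  by rewrite !wact_C.
rewrite !wact_X pactM {1}/pact [X in wact w X]/pact rmorphM rmorphXn rmorphN1 /=.
by rewrite wact_X.
Qed.

Lemma wact1 f : wact 1%g f = f.
Proof.
move: f; apply: (@eq_mpoly_morph _ _ _ _ idfun) => [c|i] /=; first exact: wact_C.
by rewrite wact_X pact1.
Qed.

Lemma wactK w : cancel (@wact n R w) (wact w^-1%g).
Proof. by move=> f; rewrite -wactM mulVg wact1. Qed.

Lemma wact_rt w b : wact w (rt mX b) = rt (pact mX w) b.
Proof.
by rewrite /rt /sgl rmorphD rmorphM /= !wact_X; case: ifP; rewrite ?rmorphN1 ?rmorph1.
Qed.

Lemma rt_neq0 a : rt mX a != 0.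
Proof.
have h : Defs.root a != 0 :> {mpoly R[n]} by exact: root_neq0.
apply: contraNneq h; rewrite /Defs.root /rt /sgl /mX; case: ifP => _.
  by rewrite mul1r addrC => ->.
by rewrite mulN1r -opprB => /eqP; rewrite oppr_eq0.
Qed.

Lemma ddE a f : rt mX a * dd a f = f - wact (simple a) f.
Proof.
rewrite dd.unlock -ddiffE /ddiff' /Defs.root /rt /sgl; case: ifP => _.
  by rewrite mul1r addrC.
by rewrite mulrN -mulNr mulN1r opprB.
Qed.

Lemma dd_unique a f g :
  rt mX a * g = f - wact (simple a) f -> dd a f = g.
Proof. by rewrite -ddE => /(mulfI (rt_neq0 a)). Qed.

Lemma ddD a f g : dd a (f + g) = dd a f + dd a g.
Proof.
by apply: dd_unique; rewrite mulrDr !ddE wactD opprD addrACA.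
Qed.

Lemma dd_mul a f g : wact (simple a) f = f -> dd a (f * g) = f * dd a g.
Proof.
by move=> sf; apply: dd_unique; rewrite mulrCA ddE wact_mul sf mulrBr.
Qed.

Lemma dd0 a : dd a 0 = 0 :> {mpoly R[n]}.
Proof. by apply: dd_unique; rewrite mulr0 wact0 subr0. Qed.

Lemma ddN a f : dd a (- f) = - dd a f.
Proof. by apply: dd_unique; rewrite mulrN ddE wactN opprB opprK addrC. Qed.

Lemma dd_sum a (I : Type) (r : seq I) P (F : I -> {mpoly R[n]}) :
  dd a (\sum_(i <- r | P i) F i) = \sum_(i <- r | P i) dd a (F i).
Proof. exact: (big_morph _ (ddD a) (dd0 a)). Qed.

Lemma wact_simple_rt a b :
  wact (simple a) (rt mX b) = rt mX b - (cartan a b)%:~R * rt mX a.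
Proof. by rewrite wact_rt rt_pact_simple. Qed.

Lemma wact_dd a f : wact (simple a) (dd a f) = dd a f.
Proof.
apply: (mulfI (rt_neq0 a)); rewrite ddE.
have -> : rt mX a = - wact (simple a) (rt mX a).
  by rewrite wact_simple_rt cartan_diag; ring.
rewrite mulNr -wact_mul ddE wactB -wactM simple2 wact1; ring.
Qed.

Lemma dd_dd a f : dd a (dd a f) = 0.
Proof. by apply: dd_unique; rewrite wact_dd subrr mulr0. Qed.

Lemma wact_rt_diag a : wact (simple a) (rt mX a) = - rt mX a.
Proof. by rewrite wact_rt rt_simple. Qed.

Lemma wact_rt_comm a b : cartan a b = 0 -> wact (simple a) (rt mX b) = rt mX b.
Proof. by rewrite wact_simple_rt => ->; rewrite mulr0z mul0r subr0. Qed.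

Lemma wact_rt_braid a b :
  cartan a b = -1 -> wact (simple a) (rt mX b) = rt mX a + rt mX b.
Proof. by rewrite wact_simple_rt => ->; rewrite mulrN1z mulN1r opprK addrC. Qed.

(** Both sides of the relation have the same product with the roots, an
    alternating sum over the subgroup generated by [a] and [b]. *)
Lemma dd_braid a b : a != b ->
  ((simple a * simple b = simple b * simple a)%g
   /\ forall f, dd a (dd b f) = dd b (dd a f)) \/
  [/\ (simple a * simple b * simple a = simple b * simple a * simple b)%g,
      (simple a * simple b <> simple b * simple a)%g
    & forall f, dd a (dd b (dd a f)) = dd b (dd a (dd b f))].
Proof.
case/simple_rel => [[cab comm]|[cab braid ncomm]]; [left | right]; split=> // f.
  have cba : cartan b a = 0 by rewrite cartanC.
  have e1 := comm_algebra (wact_rt_comm cab) (ddE b f) (ddE a (dd b f)).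
  have e2 := comm_algebra (wact_rt_comm cba) (ddE a f) (ddE b (dd a f)).
  rewrite /= (mulrC (rt mX b)) in e1 e2.
  apply: (mulfI (mulf_neq0 (rt_neq0 a) (rt_neq0 b))).
  rewrite e1 e2 -!wactM comm.
  exact: swap4.
have cba : cartan b a = -1 by rewrite cartanC.
have ab0 : rt mX a + rt mX b != 0.
  rewrite -(wact_rt_braid cab); apply: contraNneq (rt_neq0 b) => e0.
  by rewrite -(wactK (simple a) (rt mX b)) e0 wact0.
have e1 := braid_algebra (wact_rt_diag a) (wact_rt_braid cab)
  (etrans (wact_rt_braid cba) (addrC _ _)) (wact_dd a f) (ddE a f)
  (ddE b (dd a f)) (ddE a (dd b (dd a f))).
have e2 := braid_algebra (wact_rt_diag b) (wact_rt_braid cba)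
  (etrans (wact_rt_braid cab) (addrC _ _)) (wact_dd b f) (ddE b f)
  (ddE a (dd b f)) (ddE b (dd a (dd b f))).
rewrite /= (mulrC (rt mX b)) (addrC (rt mX b)) in e1 e2.
apply: (mulfI (mulf_neq0 (mulf_neq0 (rt_neq0 a) (rt_neq0 b)) ab0)).
rewrite e1 e2 -!wactM !mulgA braid.
exact: swap6.
Qed.
End DiffOps.

(** * Values of divided differences *)

Section PairProducts.
Variables (n : nat) (T : comNzRingType).

Definition pairs (F : 'I_n -> 'I_n -> T) : T :=
  \prod_(p : 'I_n * 'I_n | (p.1 < p.2)%N) F p.1 p.2.

Lemma prod_pairs (F : 'I_n -> 'I_n -> T) :
  pairs F = \prod_(j < n) \prod_(i < n | (i < j)%N) F i j.
Proof.
by rewrite [RHS](exchange_big_dep predT) //= pair_big_dep.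
Qed.

Lemma pairsN (F : 'I_n -> 'I_n -> T) :
  pairs (fun i j => - F i j) = (-1) ^+ (n * n.-1)./2 * pairs F.
Proof.
have -> : (-1) ^+ (n * n.-1)./2 = pairs (fun _ _ => -1) :> T.
  rewrite (prod_pairs (fun _ _ => -1)) -bin2 -bin2_sum big_mkord -prodrXr.
  apply: eq_bigr => j _.
  rewrite -(big_ord_widen n (fun _ => -1 : T) (ltnW (ltn_ord j))).
  by rewrite prodr_const card_ord.
by rewrite -big_split /=; apply: eq_bigr => p _; rewrite mulN1r.
Qed.
(** Reversing the second index turns the staircase into the pairs [i < k]. *)
Lemma staircase_pairs (F : 'I_n -> 'I_n -> T) :
  \prod_(i < n) \prod_(j < n | (i.+1 + j.+1 <= n)%N) F i (rev_ord j) = pairs F.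
Proof.
rewrite pair_big_dep /=.
pose h (p : 'I_n * 'I_n) := (p.1, rev_ord p.2).
have hK : involutive h by move=> [i j]; rewrite /h /= rev_ordK.
rewrite (reindex_inj (inv_inj hK)) /=.
apply: eq_big => [[i j]|[i j] _] /=; last by rewrite rev_ordK.
by have := ltn_ord i; have := ltn_ord j; lia.
Qed.

Lemma pairs_rev (F : 'I_n -> 'I_n -> T) :
  pairs (fun i j => F (rev_ord i) (rev_ord j)) = pairs (fun i j => F j i).
Proof.
pose h (p : 'I_n * 'I_n) := (rev_ord p.2, rev_ord p.1).
have hK : involutive h by move=> [i j]; rewrite /h /= !rev_ordK.
rewrite /pairs (reindex_inj (inv_inj hK)) /=.
apply: eq_big => [[i j]|[i j] _] /=; last by rewrite !rev_ordK.
by have := ltn_ord i; have := ltn_ord j; lia.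
Qed.

Lemma eq_pairs (F G : 'I_n -> 'I_n -> T) :
  (forall i j : 'I_n, (i < j)%N -> F i j = G i j) -> pairs F = pairs G.
Proof. by move=> e; apply: eq_bigr => p; apply: e. Qed.

Lemma pairsM (F G : 'I_n -> 'I_n -> T) :
  pairs (fun i j => F i j * G i j) = pairs F * pairs G.
Proof. exact: big_split. Qed.
End PairProducts.

Section InversionProduct.
Variables (n : nat) (T : comNzRingType).
Implicit Types (x : 'I_n -> T) (r : 'I_n -> int) (a : letter n).

Definition negfac (v : int) (e : T) : T := if v < 0 then - e else 1.
Definition pairfac x r (i j : 'I_n) : T :=
  negfac (r j - r i) (x j - x i) * negfac (r j + r i) (x j + x i).
(** The product of the opposites of the roots [x_j - x_i] and [x_j + x_i],
    [i < j], that are negative at [r]. *)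
Definition invprod x r : T := pairs (pairfac x r).

Lemma eq_invprod x x' r r' : x =1 x' -> r =1 r' -> invprod x r = invprod x' r'.
Proof. by move=> e e'; apply: eq_bigr => p _; rewrite /pairfac !e !e'. Qed.

Lemma pos12S a : pos2 a = (pos1 a).+1 :> nat.
Proof. by case: a. Qed.

Lemma pos1_box a : is_box a -> pos1 a = 0%N :> nat.
Proof. by case: a. Qed.

(** A simple reflection permutes the positive roots other than its own. *)
Lemma invprod_simple x r a : 0 < rt r a ->
  invprod (pact x (simple a)) (pact r (simple a)) = rt x a * invprod x r.
Proof.
move=> ra; set s := tperm (pos1 a) (pos2 a).
have p12 := pos12S a; have ltp : (pos1 a < pos2 a)%N by rewrite p12.
have pactE (S : comNzRingType) (y : 'I_n -> S) k : pact y (simple a) k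
    = if is_box a && ((k == pos1 a) || (k == pos2 a)) then - y (s k) else y (s k).
  by rewrite /pact wbar_simple wabs_simple; case: ifP => _; rewrite ?mulN1r ?mul1r.
have s1 : s (pos1 a) = pos2 a by rewrite /s tpermL.
have s2 : s (pos2 a) = pos1 a by rewrite /s tpermR.
rewrite /invprod /pairs (bigD1 (pos1 a, pos2 a)) //= [in RHS](bigD1 (pos1 a, pos2 a)) //=.
rewrite mulrA; congr (_ * _).
  rewrite /pairfac !pactE !eqxx orbT /= andbT s1 s2 /negfac.
  move: ra; rewrite /rt /sgl; case: (is_box a) => /= ra.
    have -> : - r (pos1 a) - - r (pos2 a) = r (pos2 a) - r (pos1 a) by ring.
    have -> : - x (pos1 a) - - x (pos2 a) = x (pos2 a) - x (pos1 a) by ring.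
    have -> : - r (pos1 a) + - r (pos2 a) < 0 by lia.
    have -> : (r (pos2 a) + r (pos1 a) < 0) = false by lia.
    by case: ifP => _; ring.
  have -> : r (pos1 a) - r (pos2 a) < 0 by lia.
  have -> : (r (pos2 a) - r (pos1 a) < 0) = false by lia.
  rewrite [r (pos1 a) + _]addrC [x (pos1 a) + _]addrC.
  by case: ifP => _; ring.
have sv k : s k = (if k == pos1 a then (pos1 a).+1 else
    if k == pos2 a then nat_of_ord (pos1 a) else nat_of_ord k) :> nat.
  rewrite -p12; case: (eqVneq k (pos1 a)) => [->|k1]; first by rewrite s1.
  case: (eqVneq k (pos2 a)) => [->|k2]; first by rewrite s2.
  by rewrite /s tpermD // eq_sym.
pose ss (p : 'I_n * 'I_n) := (s p.1, s p.2).
have ssK : involutive ss by move=> [i j]; rewrite /ss /= !tpermK.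
rewrite [RHS](reindex_inj (inv_inj ssK)) /=; apply: eq_big => [[i j]|[i j]] /=.
  rewrite !xpair_eqE -!val_eqE /= p12; move: (sv i) (sv j).
  rewrite -!val_eqE /= p12; move: (s i) (s j) => si sj.
  by do 4!case: eqP => ? /=; lia.
move=> /andP[ij nij]; rewrite /ss /pairfac !pactE.
have [ba|_] := boolP (is_box a) => //=.
have p1 := pos1_box ba.
have -> : (j == pos1 a) || (j == pos2 a) = false.
  by move: nij; rewrite xpair_eqE -!val_eqE /= p12 p1; lia.
by case: ifP => _ //; rewrite !opprK mulrC.
Qed.
End InversionProduct.

Lemma chain_algebra (T : idomainType) (r d e b c p : T) (k : nat) :
  r != 0 -> r * d = - e -> e * b = (-1) ^+ k * c * (r * p) ->
  d * b = (-1) ^+ k.+1 * c * p.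
Proof.
move=> r0 rd eb; apply: (mulfI r0).
by rewrite mulrA rd mulNr eb exprS; ring.
Qed.

Section Chain.
Variable n : nat.
Implicit Types (x y z : 'I_n -> polyY n) (f : polyXY n).
Implicit Types (u v w : weylD n) (a : letter n) (t : seq (letter n)).

Lemma eq_evXY x x' y y' : x =1 x' -> y =1 y' -> evXY x y =1 evXY x' y'.
Proof.
move=> ex ey; apply: (@eq_mpoly_morph _ _ _ (evXY x y) (evXY x' y')) => [c|i] /=.
  rewrite !evXY_C; move: c.
  apply: (@eq_mpoly_morph _ _ _ (evY y) (evY y')) => [c|i] /=; first by rewrite !evY_C.
  by rewrite !evY_X ey.
by rewrite -/(xvar i) !evXY_xvar ex.
Qed.

Lemma evXY_wact x y w f : evXY x y (wact w f) = evXY (pact x w) y f.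
Proof.
move: f; apply: (@eq_mpoly_morph _ _ _ (evXY x y \o wact w)) => [c|i] /=.
  by rewrite wact_C !evXY_C.
rewrite -/(mX _ i) wact_X evXY_xvar /pact rmorphM rmorphXn rmorphN1 /=.
by rewrite evXY_xvar.
Qed.

Lemma evXY_rt x y a : evXY x y (rt (mX _) a) = rt x a.
Proof.
rewrite /rt /sgl rmorphD rmorphM /= !evXY_xvar.
by case: ifP => _; rewrite ?rmorphN1 ?rmorph1.
Qed.

Lemma evXY_dd x y a f :
  rt x a * evXY x y (dd a f) = evXY x y f - evXY (pact x (simple a)) y f.
Proof. by rewrite -(evXY_rt x y) -rmorphM ddE rmorphB /= evXY_wact. Qed.

Lemma wlen_mul_word w t : (wlen (w * wordprod t)%g <= wlen w + size t)%N.
Proof.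
rewrite -[X in wlen (X * _)%g]wordprod_reduced -wordprod_cat.
by rewrite (leq_trans (wlen_min _)) // size_cat size_reduced.
Qed.

Lemma wlen_simple_mul a w : (wlen w <= (wlen (simple a * w)%g).+1)%N.
Proof.
have := wlen_mul_le (simple a * w)^-1%g a.
by rewrite wlenV invMg simpleV -mulgA simple2 mulg1 wlenV.
Qed.

(* The type D family uses all the letters and the whole group; the type A family
   only uses the letters other than s_Box and the permutations. *)
Variables (z y : 'I_n -> polyY n).
Hypothesis z_reg : forall u a, rt (pact z u) a != 0.
Variables (L : pred (letter n)) (U : pred (weylD n)).
Hypothesis U_stable : forall u a, U u -> L a -> U (u * simple a)%g.
Variables (v0 : weylD n) (f : polyXY n).
Hypothesis f_supp : forall u, U u -> u != v0 -> evXY (pact z u) y f = 0.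

Let ev u (g : polyXY n) := evXY (pact z u) y g.

Let ev_dd u a g : rt (pact z u) a * ev u (dd a g) = ev u g - ev (u * simple a)%g g.
Proof.
by rewrite /ev evXY_dd (eq_evXY (pactM z u (simple a)) (frefl y)).
Qed.

Let ev_dd0 u a g : ev u g = 0 -> ev (u * simple a)%g g = 0 -> ev u (dd a g) = 0.
Proof.
move=> e1 e2; have := ev_dd u a g; rewrite e1 e2 subrr => /eqP.
by rewrite mulf_eq0 (negbTE (z_reg u a)) => /eqP.
Qed.

Let ev_ddV u a g : ev u g = 0 ->
  rt (pact z u) a * ev u (dd a g) = - ev (u * simple a)%g g.
Proof. by move=> e1; rewrite ev_dd e1 sub0r. Qed.

(** The value of a divided difference only depends on those at the same point and
    at a neighbour, so [v0] is out of reach. *)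
Lemma ev_chain_vanish t u : all L t -> U u ->
  (size t < wlen (u^-1 * v0)%g)%N -> evXY (pact z u) y (foldr (@dd n (polyY n)) f t) = 0.
Proof.
elim: t u => [|a t IHt] u /=.
  move=> _ Uu; case: (eqVneq u v0) => [->|]; last by move=> ne _; apply: f_supp.
  by rewrite mulVg wlen1.
case/andP=> La Lt Uu lt.
apply: ev_dd0; first by apply: IHt => //; apply: ltnW.
apply: IHt; [exact: Lt | exact: U_stable | ].
rewrite invMg simpleV -mulgA -ltnS.
exact: leq_trans lt (wlen_simple_mul _ _).
Qed.

(** At each step, the point that is further away from [v0] contributes 0 by
    [ev_chain_vanish]; the denominators are the roots that change sign between
    [u] and [v0]. *)
Lemma ev_chain_value t u : all L t -> U u ->
  (u * wordprod t)%g = v0 -> (wlen u + size t = wlen v0)%N ->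
  evXY (pact z u) y (foldr (@dd n (polyY n)) f t)
    * invprod (pact z v0) (pact (rho (n := n)) v0)
  = (-1) ^+ size t * evXY (pact z v0) y f
    * invprod (pact z u) (pact (rho (n := n)) u).
Proof.
elim: t u => [|a t IHt] u /=.
  by rewrite /wordprod big_nil mulg1 => _ _ -> _; rewrite expr0 mul1r.
case/andP=> La Lt Uu; rewrite wordprod_cons => e le.
have e' : (u * simple a * wordprod t)%g = v0 by rewrite -mulgA.
have Uu' := U_stable Uu La.
have nd : ~~ desc u a.
  apply/negP => d; have := wlen_mul_word (u * simple a)%g t.
  by rewrite e' -le (wlen_desc d) addSnnS leq_add2l ltnNge ltnW.
have le' : (wlen (u * simple a)%g + size t = wlen v0)%N.
  by rewrite (wlen_ndesc nd) -le addnS addSn.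
have gu0 : ev u (foldr (@dd n (polyY n)) f t) = 0.
  apply: ev_chain_vanish; [exact: Lt | exact: Uu | rewrite -e mulKg].
  have := wlen_mul_word u (reduced_word (simple a * wordprod t)%g).
  by rewrite wordprod_reduced e size_reduced -le leq_add2l.
have IH := IHt _ Lt Uu' e' le'.
have pos : 0 < rt (pact (rho (n := n)) u) a.
  by rewrite lt_neqAle eq_sym rho_neq0 leNgt.
rewrite (eq_invprod (pactM z u (simple a)) (pactM (rho (n := n)) u (simple a))) in IH.
rewrite (invprod_simple _ pos) in IH.
exact: chain_algebra (z_reg u a) (ev_ddV a gu0) IH.
Qed.
End Chain.

Lemma sign_word n (t : seq (letter n)) :
  odd (size t) = odd_perm (wabs (wordprod t)).
Proof.
elim: t => [|a t IHt]; first by rewrite /wordprod big_nil odd_perm1.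
rewrite wordprod_cons wabsM odd_permM wabs_simple odd_tperm pos12 /= IHt.
by rewrite addbT.
Qed.

(** * The two families of polynomials *)

Section Family.
Variable n : nat.
Implicit Types (f : polyXY n) (w v : weylD n) (a : letter n) (u s : 'S_n).
Implicit Types (t : seq (letter n)).

Lemma wlen_simple_desc w a : desc w^-1%g a -> wlen w = (wlen (simple a * w)%g).+1.
Proof.
by move/wlen_desc; rewrite wlenV => ->; rewrite -(wlenV (simple a * w)%g) invMg simpleV.
Qed.

Lemma wlen_simple_ndesc w a :
  ~~ desc w^-1%g a -> wlen (simple a * w)%g = (wlen w).+1.
Proof.
by move/wlen_ndesc; rewrite wlenV => <-; rewrite -(wlenV (simple a * w)%g) invMg simpleV.
Qed.

Definition chain f t : polyXY n := foldr (@dd n (polyY n)) f t.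
Definition fam v f w := chain f (reduced_word (w^-1 * v)%g).

Lemma foldr_ddiff' f t : foldr (@ddiff' n (polyY n)) f t = chain f t.
Proof. by elim: t => //= a t ->; rewrite dd.unlock. Qed.

Lemma chain_reduced f t r : reduced t -> reduced r -> wordprod t = wordprod r ->
  chain f t = chain f r.
Proof. by apply: reduced_foldr => a b; apply: dd_braid. Qed.

Lemma fam_reduced v f w t : reduced t -> wordprod t = (w^-1 * v)%g ->
  fam v f w = chain f t.
Proof.
move=> rt te; apply: chain_reduced; first exact: reduced_reduced_word.
  exact: rt.
by rewrite wordprod_reduced te.
Qed.

Lemma dd_fam v f w a :
  dd a (fam v f w) = if desc (v^-1 * w)%g a then 0 else fam v f (w * simple a)%g.
Proof.
have vw : (v^-1 * w)%g = (w^-1 * v)^-1%g by rewrite invMg invgK.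
rewrite vw; case: ifP => [/wlen_simple_desc|/negbT/wlen_simple_ndesc] le.
  pose t := reduced_word (simple a * (w^-1 * v))%g.
  have te : wordprod (a :: t) = (w^-1 * v)%g.
    by rewrite wordprod_cons wordprod_reduced mulgA simple2 mul1g.
  have rt : reduced (a :: t) by rewrite /reduced te /= size_reduced le.
  by rewrite (fam_reduced f rt te) /chain /= dd_dd.
pose t := reduced_word (w^-1 * v)%g.
have te : wordprod (a :: t) = ((w * simple a)^-1 * v)%g.
  by rewrite wordprod_cons wordprod_reduced invMg simpleV mulgA.
have rt : reduced (a :: t).
  by rewrite /reduced wordprod_cons wordprod_reduced le /= size_reduced.
by rewrite (fam_reduced f rt te).
Qed.

(** * Summing over the elements of the same length as their absolute value *)

Lemma lt01n (b : 'I_(1 < n)) : (0 < n.-1)%N.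
Proof. by rewrite ltn_predRL; case: (1 < n)%N b => // -[]. Qed.
(** s_Box and s_1 have the same absolute value. *)
Definition labs a : letter n :=
  if a is inr b then inl (Ordinal (lt01n b)) else a.
Definition sw a : 'S_n := tperm (pos1 a) (pos2 a).

Lemma labs_box a : is_box (labs a) = false.
Proof. by case: a. Qed.

Lemma pos1_labs a : pos1 (labs a) = pos1 a.
Proof. by case: a => // b; apply: val_inj. Qed.
Lemma pos2_labs a : pos2 (labs a) = pos2 a.
Proof. by case: a => // b; apply: val_inj. Qed.

Lemma wperm1 : wperm 1 = 1%g :> weylD n.
Proof. by apply: weylD_eqP => // k; rewrite !ffunE. Qed.

Lemma wperm_sw a u : wperm (sw a * u)%g = (wperm u * simple (labs a))%g.
Proof.
rewrite wpermM; congr (_ * _)%g; apply: weylD_eqP => [|k].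
  by rewrite wabs_simple pos1_labs pos2_labs.
by rewrite wbar_wperm wbar_simple labs_box.
Qed.

Lemma wabs_wperm u : wabs (wperm u) = u.
Proof. by []. Qed.

Lemma wabs_simpleM w a : wabs (w * simple a)%g = (sw a * wabs w)%g.
Proof. by rewrite wabsM wabs_simple. Qed.

Lemma wordprod_labs t : wordprod (map labs t) = wperm (wabs (wordprod t)).
Proof.
elim/last_ind: t => [|t a IHt]; first by rewrite /wordprod !big_nil wperm1.
rewrite map_rcons -!cats1 !wordprod_cat !wordprod1 IHt wabs_simpleM.
by rewrite wperm_sw.
Qed.

(** Replacing s_Box by s_1 in a word gives a word for the absolute value. *)
Lemma wlen_wabs w : (wlen (wperm (wabs w)) <= wlen w)%N.
Proof.
rewrite -{1}(wordprod_reduced w) -wordprod_labs (leq_trans (wlen_min _)) //.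
by rewrite size_map size_reduced.
Qed.

Lemma LsetE u w : (w \in Lset u) = (wabs w == u) && (wlen w == wlen (wperm u)).
Proof.
rewrite inE mem_lcoset inE wabsM; congr (_ && _).
have -> : wabs (wperm u)^-1%g = u^-1%g by [].
by rewrite -eq_mulgV1.
Qed.

Let wlen_sw u a :
  desc (wperm u) (labs a) -> wlen (wperm u) = (wlen (wperm (sw a * u)%g)).+1.
Proof. by move/wlen_desc => ->; rewrite wperm_sw. Qed.

Lemma Lset_desc u a w : w \in Lset u -> desc w a ->
  desc (wperm u) (labs a) /\ (w * simple a)%g \in Lset (sw a * u)%g.
Proof.
rewrite !LsetE => /andP[/eqP wu /eqP wl] d.
have l1 := wlen_desc d; have l2 := wlen_wabs (w * simple a)%g.
have ws : wabs (w * simple a)%g = (sw a * u)%g by rewrite wabs_simpleM wu.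
have du : desc (wperm u) (labs a).
  apply: contraT => /wlen_ndesc l3; move: l2.
  rewrite ws wperm_sw l3 ltnNge => /negP[].
  by apply: leq_trans (leqnSn _) _; rewrite -l1 wl.
split; first exact: du.
apply/andP; split; first by rewrite ws.
apply/eqP; apply: succn_inj.
exact: etrans (esym l1) (etrans wl (wlen_sw du)).
Qed.

Lemma Lset_up u a v : desc (wperm u) (labs a) -> v \in Lset (sw a * u)%g ->
  (v * simple a)%g \in Lset u /\ desc (v * simple a)%g a.
Proof.
move=> du; rewrite !LsetE => /andP[/eqP vu /eqP vl].
have wu : wabs (v * simple a)%g = u.
  by rewrite wabs_simpleM vu mulgA tperm2 mul1g.
have l1 := etrans (wlen_sw du) (congr1 S (esym vl)).
have l2 := wlen_wabs (v * simple a)%g; rewrite wu l1 in l2.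
have nd : ~~ desc v a.
  apply/negP => /wlen_desc l3; move: l2; rewrite ltnNge => /negP[].
  by rewrite l3.
split; last by rewrite desc_simple nd.
apply/andP; split; first by rewrite wu.
apply/eqP; exact: etrans (wlen_ndesc nd) (esym l1).
Qed.

(** The homomorphism of nil-Coxeter algebras which identifies the two generators with the same
    absolute value maps [w] to its absolute value if both have the same length,
    and to 0 otherwise.  So the sums over [Lset u] inherit the recurrence of the
    summands, with s_Box acting like s_1. *)
Lemma dd_sum_Lset (F : weylD n -> polyXY n) u a :
  (forall w, dd a (F w) = if desc w a then F (w * simple a)%g else 0) ->
  dd a (\sum_(w in Lset u) F w) =
  if desc (wperm u) (labs a) then \sum_(w in Lset (sw a * u)%g) F w else 0.
Proof.
move=> Fa; rewrite dd_sum; under eq_bigr => w _ do rewrite Fa.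
rewrite -big_mkcondr /=; case: ifP => du; last first.
  rewrite big_pred0 // => w; apply/negP => /andP[wL /(Lset_desc wL)[]].
  by rewrite du.
rewrite (reindex_inj (mulIg (simple a))) /=.
apply: eq_big => [v|v _]; last by rewrite -mulgA simple2 mulg1.
apply/andP/idP => [[vL /(Lset_desc vL)[_ wL]]|/(Lset_up du) //].
by move: wL; rewrite -mulgA simple2 mulg1.
Qed.

(** For odd [n], the entry without a bar meets the coordinate 0 of [rho]. *)
Lemma pact_rho_w0 : pact (rho (n := n)) (w0 n) =1 fun k => - rho k.
Proof.
move=> k; rewrite /pact /wabs /wbar /= ffunE perm1.
case: (odd n) => /=; last by rewrite expr1 mulN1r.
case: (eqVneq (val k) 0%N) => k0; last by rewrite expr1 mulN1r.
by rewrite /rho k0 mulr0 oppr0.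
Qed.

Lemma desc_w0 w a : desc ((w0 n)^-1 * w)%g a = ~~ desc w a.
Proof.
rewrite /desc (eq_rt a (pactM (rho (n := n)) (w0 n)^-1%g w)).
have e : pact (rho (n := n)) (w0 n)^-1%g =1 fun k => - rho k.
  move=> k; have := pact1 (rho (n := n)) k.
  rewrite -(mulgV (w0 n)) pactM (eq_pact _ pact_rho_w0) => <-.
  by rewrite /pact; ring.
rewrite (eq_rt a (eq_pact w e)).
have -> : rt (pact (fun k => - rho k) w) a = - rt (pact (rho (n := n)) w) a.
  by rewrite /rt /pact; ring.
by rewrite oppr_lt0 -leNgt lt_neqAle eq_sym rho_neq0.
Qed.

Lemma dd_famD f w a :
  dd a (fam (w0 n) f w) = if desc w a then fam (w0 n) f (w * simple a)%g else 0.
Proof. by rewrite dd_fam desc_w0; case: (desc w a). Qed.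
End Family.

(** * The type A family *)

Section FlipFamily.
Variable n : nat.
Implicit Types (f g : polyXY n) (a : letter n) (u s : 'S_n).
Implicit Types (t : seq (letter n)).

Definition flipC : polyY n -> polyY n := comp_mpoly [tuple - 'X_i | i < n].
HB.instance Definition _ := GRing.RMorphism.on flipC.

Lemma flipXYE f :
  flipXY f = comp_mpoly [tuple xvar (rev_ord i) | i < n] (map_mpoly flipC f).
Proof. by []. Qed.

Lemma flipXY_is_zmod_morphism : zmod_morphism (@flipXY n).
Proof. by move=> f g; rewrite !flipXYE !rmorphB. Qed.
Lemma flipXY_is_monoid_morphism : monoid_morphism (@flipXY n).
Proof. by split=> [|f g]; rewrite !flipXYE ?rmorph1 ?rmorphM. Qed.
HB.instance Definition _ :=
  GRing.isZmodMorphism.Build _ _ (@flipXY n) flipXY_is_zmod_morphism.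
HB.instance Definition _ :=
  GRing.isMonoidMorphism.Build _ _ (@flipXY n) flipXY_is_monoid_morphism.

Lemma flipXY_C c : flipXY c%:MP = (flipC c)%:MP.
Proof. by rewrite flipXYE map_mpolyC comp_mpolyC. Qed.

Lemma flipXY_xvar (i : 'I_n) : flipXY (xvar i) = xvar (rev_ord i).
Proof. by rewrite flipXYE map_mpolyX comp_mpolyXU -tnth_nth tnth_mktuple. Qed.

Lemma flipXY_yvar (i : 'I_n) : flipXY (yvar i) = - yvar i.
Proof.
rewrite flipXY_C /flipC comp_mpolyXU -tnth_nth tnth_mktuple.
exact: rmorphN.
Qed.

(** The conjugation by the reversal of the positions. *)
Definition star a : letter n := if a is inl i then inl (rev_ord i) else a.

Lemma pos1_star a : ~~ is_box a -> pos1 (star a) = rev_ord (pos2 a).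
Proof.
by case: a => // i _; apply: val_inj => /=; have := ltn_ord i; lia.
Qed.
Lemma pos2_star a : ~~ is_box a -> pos2 (star a) = rev_ord (pos1 a).
Proof.
by case: a => // i _; apply: val_inj => /=; have := ltn_ord i; lia.
Qed.
Lemma is_box_star a : is_box (star a) = is_box a.
Proof. by case: a. Qed.
Lemma wact_simple_X a (i : 'I_n) : ~~ is_box a ->
  wact (simple a) (xvar i) = xvar (sw a i).
Proof.
move=> na; rewrite -[xvar i]/(mX _ i) wact_X /pact wbar_simple (negbTE na).
by rewrite expr0 mul1r wabs_simple.
Qed.

Lemma flipXY_wact a f : ~~ is_box a ->
  flipXY (wact (simple a) f) = wact (simple (star a)) (flipXY f).
Proof.
move=> na; move: f; apply: (@eq_mpoly_morph _ _ _ (@flipXY n \o wact (simple a))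
  (wact (simple (star a)) \o @flipXY n)) => [c|i] /=.
  by rewrite wact_C !flipXY_C wact_C.
have h1 : flipXY (wact (simple a) (xvar i)) = xvar (rev_ord (sw a i)).
  by rewrite wact_simple_X // flipXY_xvar.
have h2 : wact (simple (star a)) (flipXY (xvar i)) = xvar (sw (star a) (rev_ord i)).
  by rewrite flipXY_xvar wact_simple_X // is_box_star.
have h3 : rev_ord (sw a i) = sw (star a) (rev_ord i).
  by rewrite /sw pos1_star // pos2_star // tpermC (inj_tperm _ _ _ rev_ord_inj).
rewrite h3 in h1; exact: etrans h1 (esym h2).
Qed.

Lemma flipXY_ddiff a f : ~~ is_box a ->
  flipXY (ddiff a f) = dd (star a) (flipXY f).
Proof.
move=> na; apply/esym/dd_unique; rewrite -flipXY_wact // -rmorphB -ddiffE.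
have -> : rt (@mX n (polyY n)) (star a) = flipXY (Defs.root a).
  rewrite /Defs.root (negbTE na) rmorphB /= -[X in X - _]/(flipXY (xvar (pos1 a))).
  rewrite -[X in _ - X]/(flipXY (xvar (pos2 a))) !flipXY_xvar.
  by rewrite /rt /sgl is_box_star (negbTE na) pos1_star // pos2_star // mulN1r.
exact/esym/rmorphM.
Qed.

Definition nobox t := all (fun a => ~~ is_box a) t.

Lemma flipXY_foldr t f : nobox t ->
  flipXY (foldr (@ddiff n (polyY n)) f t) = chain (flipXY f) (map star t).
Proof.
elim: t => //= a t IHt /andP[na nt].
by rewrite /chain /= -/(chain _ _) -IHt // flipXY_ddiff.
Qed.

Lemma ndesc_wperm_box u a : is_box a -> ~~ desc (wperm u) a.
Proof.
move=> ba; rewrite /desc /rt /sgl ba /pact !wbar_wperm /rho !expr0 !mul1r.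
by rewrite -leNgt addr_ge0.
Qed.

(** The last letter of a reduced word is a descent, and s_Box never is a descent
    of a permutation without bars. *)
Lemma reduced_nobox t u : reduced t -> wordprod t = wperm u -> nobox t.
Proof.
elim/last_ind: t u => [|t a IHt] u; first by [].
rewrite /reduced size_rcons -cats1 wordprod_cat wordprod1 => /eqP rt e.
have te : wordprod t = (wperm u * simple a)%g by rewrite -e -mulgA simple2 mulg1.
have d : desc (wperm u) a.
  apply: contraT => /wlen_ndesc le; have := wlen_min t.
  by rewrite te le -e -rt ltnNge leqnSn.
have na : ~~ is_box a by apply: contraL d => /(ndesc_wperm_box u).
have la : labs a = a by case: (a) na.
rewrite /nobox cats1 all_rcons na; apply: (IHt (sw a * u)%g).
  rewrite /reduced eqn_leq wlen_min andbT -ltnS rt.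
  exact: wlen_mul_le.
by rewrite wperm_sw la.
Qed.

Lemma omega0K : (omega0 n * omega0 n = 1)%g.
Proof. by apply/permP => k; rewrite permM !permE rev_ordK. Qed.

Local Notation W := (wperm (omega0 n)).

Lemma wpermW : (W * W = 1)%g.
Proof. by rewrite -wpermM omega0K wperm1. Qed.

Lemma simple_nobox a : ~~ is_box a -> simple a = wperm (sw a).
Proof.
move=> na; apply: weylD_eqP => // k.
by rewrite wbar_simple (negbTE na) wbar_wperm.
Qed.

Lemma simple_star a : ~~ is_box a -> simple (star a) = (W * simple a * W)%g.
Proof.
move=> na; rewrite !simple_nobox ?is_box_star // -!wpermM mulgA; congr wperm.
have oV : (omega0 n)^-1%g = omega0 n by apply/eqP; rewrite eq_invg_mul omega0K.
rewrite -{1}oV -mulgA -[RHS]/((sw a) ^ omega0 n)%g /sw tpermJ.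
by rewrite !permE pos1_star // pos2_star // tpermC.
Qed.

Lemma wordprod_star t : nobox t -> wordprod (map star t) = (W * wordprod t * W)%g.
Proof.
elim: t => [|a t IHt] /=; first by rewrite /wordprod !big_nil mulg1 wpermW.
case/andP=> na nt; rewrite !wordprod_cons IHt // simple_star //.
by rewrite !mulgA -(mulgA (W * _)%g W W) wpermW mulg1.
Qed.

Lemma wlen_star u : (wlen (W * wperm u * W)%g <= wlen (wperm u))%N.
Proof.
have rw := reduced_reduced_word (wperm u).
have nb := reduced_nobox rw (wordprod_reduced _).
have e := wordprod_star nb; rewrite wordprod_reduced in e.
by rewrite -e (leq_trans (wlen_min _)) // size_map size_reduced.
Qed.

Lemma wpermV u : (wperm u)^-1%g = wperm u^-1%g.
Proof. by apply/eqP; rewrite eq_invg_mul -wpermM mulVg wperm1. Qed.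

(** Reversing the variables conjugates the generators by [omega0], and
    replacing [X] by [omega0 X] turns the operators into the primed ones. *)
Lemma flipXY_schubertA u :
  flipXY (schubertA (omega0 n * u * omega0 n)%g) =
  fam W (flipXY (Delta n)) (wperm u).
Proof.
set s := (omega0 n * u * omega0 n)%g; rewrite /schubertA /ddiff_w.
set t := reduced_word _.
have te : wordprod t = wperm (omega0 n * s^-1)%g.
  by rewrite wordprod_reduced wpermV -wpermM.
have rt := reduced_reduced_word ((wperm s)^-1 * W)%g; rewrite -/t in rt.
have nt := reduced_nobox rt te.
rewrite flipXY_foldr //; apply/esym/fam_reduced.
  rewrite /reduced size_map (eqP rt) eqn_leq.
  have e1 := wordprod_star nt; rewrite te in e1.
  have e2 : wperm (omega0 n * s^-1)%g = (W * wordprod (map star t) * W)%g.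
    by rewrite e1 !mulgA wpermW mul1g -mulgA wpermW mulg1.
  have e3 : wordprod (map star t) = wperm (omega0 n * (omega0 n * s^-1) * omega0 n)%g.
    by rewrite e1 -!wpermM mulgA.
  rewrite te; apply/andP; split; last by rewrite e1; apply: wlen_star.
  by rewrite e2 e3; apply: wlen_star.
rewrite wordprod_star // te wpermV -!wpermM; congr wperm.
rewrite /s !invMg; have oV : (omega0 n)^-1%g = omega0 n.
  by apply/eqP; rewrite eq_invg_mul omega0K.
have oo (x : 'S_n) : (omega0 n * (omega0 n * x) = x)%g by rewrite mulgA omega0K mul1g.
by rewrite !oV -!mulgA omega0K mulg1 oo.
Qed.
End FlipFamily.

(** * The action of s_Box on the type A family *)

Lemma box_algebra1 (T : comNzRingType) (A B x y : T) :
  (y + 1 * x) * B = A + B * y - (A + B * - x).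
Proof. ring. Qed.

Lemma box_algebra2 (T : comNzRingType) (A B x y : T) :
  (y + -1 * x) * B = A + B * y - (A + B * x).
Proof. ring. Qed.

Lemma sw_val n (a : letter n) (k : 'I_n) :
  sw a k = (if k == pos1 a then (pos1 a).+1 else
    if k == pos2 a then nat_of_ord (pos1 a) else nat_of_ord k) :> nat.
Proof.
rewrite /sw -(pos12S a); case: (eqVneq k (pos1 a)) => [->|k1]; first by rewrite tpermL.
case: (eqVneq k (pos2 a)) => [->|k2]; first by rewrite tpermR.
by rewrite tpermD // eq_sym.
Qed.

Lemma sw_bound n (a : letter n) (k : 'I_n) (sg sr : nat) :
  ((sr + sg).-1 <= maxn k.+1 (sw a k).+1)%N -> (0 < sr)%N ->
  ((k == pos1 a) || (k == pos2 a) -> sr = 2) -> (sg <= k.+1)%N.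
Proof.
rewrite sw_val; have := pos12S a; have := pos12 a.
case: (eqVneq k (pos1 a)) => [->|_] _ p12 /=; first by move=> h _ /(_ isT); lia.
case: (eqVneq k (pos2 a)) => [->|_] /=; first by move=> h _ /(_ isT); lia.
by move=> h r0 _; lia.
Qed.

(** A quotient by a root loses the degree of the root, which is 1 in the two
    variables that the reflection exchanges. *)
Lemma size_quotient n (T : nzRingType) (a : letter n) (k : 'I_n) (r g p q : {poly T}) :
  r * g = p - q -> r != 0 -> (forall c, lead_coef r * c = 0 -> c = 0) ->
  (size p <= k.+1)%N -> (size q <= (sw a k).+1)%N ->
  ((k == pos1 a) || (k == pos2 a) -> size r = 2) -> (size g <= k.+1)%N.
Proof.
move=> e r0 reg sp sq r2; have [->|g0] := eqVneq g 0; first by rewrite size_poly0.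
have rg : lead_coef r * lead_coef g != 0.
  by apply: contra_neq g0 => /reg /eqP; rewrite lead_coef_eq0 => /eqP.
apply: (@sw_bound n a k _ (size r)); [|by rewrite size_poly_gt0|exact: r2].
rewrite -size_proper_mul // e (leq_trans (size_polyD _ _)) // size_polyN geq_max.
by rewrite !leq_max sp sq orbT.
Qed.

Lemma lead_coef_subst_diff (T : nzRingType) (b1 b2 : bool) (x y c : T) :
  b1 = ~~ b2 ->
  lead_coef ((if b2 then 'X else x%:P) - (if b1 then 'X else y%:P)) * c = 0 -> c = 0.
Proof.
move=> ->; case: b2 => /=; first by rewrite lead_coefXsubC mul1r.
by rewrite -opprB lead_coefN lead_coefXsubC mulN1r => /eqP; rewrite oppr_eq0 => /eqP.
Qed.

Lemma size_subst_diff (T : nzRingType) (b1 b2 : bool) (x y : T) :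
  b1 = ~~ b2 -> size ((if b2 then 'X else x%:P) - (if b1 then 'X else y%:P)) = 2.
Proof.
move=> ->; case: b2 => /=; first exact: size_XsubC.
by rewrite -opprB size_polyN; apply: size_XsubC.
Qed.

Lemma rt_reg n (R : idomainType) a (c : {mpoly R[n]}) : rt (@mX n R) a * c = 0 -> c = 0.
Proof. by move=> e; apply: (mulfI (rt_neq0 R a)); rewrite e mulr0. Qed.

Section Univariate.
Variable n : nat.
Local Notation PXY := (polyXY n).
Implicit Types (f g : PXY) (k : 'I_n) (a : letter n).

(** [f] as a polynomial in its [k]-th variable. *)
Definition univ k : PXY -> {poly PXY} :=
  mmap (polyC \o @mpolyC n (polyY n))
    (fun j => if j == k then 'X else (xvar j)%:P).
HB.instance Definition _ k := GRing.RMorphism.on (univ k).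

Lemma univ_C k c : univ k c%:MP = c%:MP%:P.
Proof. by rewrite /univ mmapC. Qed.

Lemma univ_xvar k j : univ k (xvar j) = if j == k then 'X else (xvar j)%:P.
Proof. by rewrite /univ mmapX mmap1U. Qed.

(** A substitution can be carried out on the coefficients with any value for
    the [k]-th variable, which they do not contain. *)
Lemma univ_subst k (phi psi : {rmorphism PXY -> PXY}) f :
  (forall c, phi c%:MP = psi c%:MP) ->
  (forall j, j != k -> phi (xvar j) = psi (xvar j)) ->
  psi f = (map_poly phi (univ k f)).[psi (xvar k)].
Proof.
move=> eC eX; move: f.
apply: (@eq_mpoly_morph _ _ _ psi
  (horner_eval (psi (xvar k)) \o (map_poly phi \o univ k))) => [c|j] /=.
  by rewrite univ_C map_polyC /= /horner_eval hornerC.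
suff h : psi (xvar j) = horner_eval (psi (xvar k)) (map_poly phi (univ k (xvar j))).
  exact: h.
rewrite univ_xvar; case: (eqVneq j k) => [->|jk].
  by rewrite map_polyX /horner_eval hornerX.
by rewrite map_polyC /= /horner_eval hornerC eX.
Qed.

Lemma univK k f : (univ k f).[xvar k] = f.
Proof.
have := @univ_subst k idfun idfun f (fun=> erefl) (fun _ _ => erefl).
by rewrite map_poly_id.
Qed.

Lemma size_map_poly_leq (R S : nzRingType) (phi : R -> S) (p : {poly R}) :
  (size (map_poly phi p) <= size p)%N.
Proof. exact: size_poly. Qed.

Lemma univ_wact k a f : ~~ is_box a ->
  univ k (wact (simple a) f) = map_poly (wact (simple a)) (univ (sw a k) f).
Proof.
move=> na; move: f; apply: (@eq_mpoly_morph _ _ _ (univ k \o wact (simple a))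
  (map_poly (wact (simple a)) \o univ (sw a k))) => [c|j] /=.
  by rewrite wact_C !univ_C map_polyC /= wact_C.
suff h : univ k (wact (simple a) (xvar j))
    = map_poly (wact (simple a)) (univ (sw a k) (xvar j)) by exact: h.
rewrite wact_simple_X // !univ_xvar.
have -> : (sw a j == k) = (j == sw a k) by rewrite -(inj_eq (@perm_inj _ (sw a))) tpermK.
case: ifP => _; first by rewrite map_polyX.
by rewrite map_polyC /= wact_simple_X.
Qed.

(** This bound, which is that of [Delta] after the reversal of [X], is what makes
    s_Box act like s_1; the variables are counted from 0. *)
Definition staircase f := forall k, (size (univ k f) <= k.+1)%N.

Lemma staircase_dd a f : ~~ is_box a -> staircase f -> staircase (dd a f).
Proof.
move=> na sf k.
have gE : univ k (rt (@mX n (polyY n)) a) * univ k (dd a f)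
    = univ k f - map_poly (wact (simple a)) (univ (sw a k) f).
  by rewrite -rmorphM ddE rmorphB /= univ_wact.
have rtE : univ k (rt (@mX n (polyY n)) a)
    = (if pos2 a == k then 'X else (xvar (pos2 a))%:P)
      - (if pos1 a == k then 'X else (xvar (pos1 a))%:P).
  rewrite /rt /sgl (negbTE na) mulN1r rmorphB /=.
  by congr (_ - _); apply: univ_xvar.
have r0 : univ k (rt (@mX n (polyY n)) a) != 0.
  apply: contraTneq (@rt_neq0 n (polyY n) a) => e.
  by rewrite -(univK k (rt _ a)) e horner0 eqxx.
have pk : (k == pos1 a) || (k == pos2 a) -> (pos1 a == k) = ~~ (pos2 a == k).
  by case/orP=> /eqP ->; rewrite eqxx ?(negbTE (pos12 a)) // eq_sym (negbTE (pos12 a)).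
have reg c : lead_coef (univ k (rt (@mX n (polyY n)) a)) * c = 0 -> c = 0.
  case: (boolP ((k == pos1 a) || (k == pos2 a))) => kp.
    by rewrite rtE; exact: (lead_coef_subst_diff (pk kp)).
  have e : univ k (rt (@mX n (polyY n)) a) = (rt (@mX n (polyY n)) a)%:P.
    move: kp; rewrite negb_or ![k == _]eq_sym => /andP[/negbTE k1 /negbTE k2].
    by rewrite rtE k1 k2 /rt /sgl (negbTE na) mulN1r polyCB.
  rewrite e lead_coefC; exact: rt_reg.
apply: (size_quotient gE r0 reg (sf k)).
  exact: leq_trans (size_map_poly_leq _ _) (sf _).
by move=> kp; rewrite rtE; apply: size_subst_diff; apply: pk.
Qed.

(** Only the first degrees matter: without the first variable and of degree at
    most 1 in the second one, [f] is [A + B * x_2], and both operators give [B]. *)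
Lemma staircase_box (b : 'I_(1 < n)) f : staircase f ->
  dd (inr b) f = dd (labs (inr b)) f.
Proof.
move=> sf; pose a : letter n := inr b; pose k0 := pos1 a; pose k1 := pos2 a.
have k10 : k1 != k0 by rewrite eq_sym; apply: pos12 a.
have s0 : (size (univ k0 f) <= 1)%N by apply: sf.
have s1 : (size (univ k1 f) <= 2)%N by apply: sf.
have lin v : (univ k1 f).[v] = (univ k1 f)`_0 + (univ k1 f)`_1 * v.
  by rewrite (horner_coef_wide _ s1) !big_ord_recr big_ord0 /= add0r mulr1.
have fE : f = (univ k1 f)`_0 + (univ k1 f)`_1 * xvar k1 by rewrite -lin univK.
have substE (phi psi : {rmorphism PXY -> PXY}) :
    (forall c, phi c%:MP = psi c%:MP) ->
    (forall j, j != k0 -> phi (xvar j) = psi (xvar j)) -> phi f = psi f.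
  move=> eC eX; have cE := size1_polyC s0; set c := _`_0 in cE.
  have phiE (chi : {rmorphism PXY -> PXY}) :
      (map_poly phi (univ k0 f)).[chi (xvar k0)] = phi c.
    by rewrite cE map_polyC hornerC.
  have e1 := @univ_subst k0 phi phi f (fun=> erefl) (fun _ _ => erefl).
  have e2 := univ_subst f eC eX.
  exact: etrans (etrans e1 (phiE phi)) (esym (etrans e2 (phiE psi))).
pose psi v : {rmorphism PXY -> PXY} := horner_eval v \o univ k1.
have psi_xvar v j : psi v (xvar j) = if j == k1 then v else xvar j.
  by rewrite /= univ_xvar; case: ifP => _; rewrite /horner_eval ?hornerX ?hornerC.
have psi_C v c : psi v c%:MP = c%:MP by rewrite /= univ_C /horner_eval hornerC.
have wX (c : letter n) (i : 'I_n) : wact (simple c) (xvar i)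
    = (-1) ^+ (is_box c && ((i == pos1 c) || (i == pos2 c))) * xvar (sw c i).
  by rewrite -[xvar i]/(mX _ i) wact_X /pact wbar_simple wabs_simple.
have e1 : wact (simple a) f = psi (- xvar k0) f.
  apply: (substE (wact (simple a)) (psi _)) => [c|j jk0].
    exact: etrans (wact_C _ c) (esym (psi_C _ c)).
    rewrite psi_xvar; apply: etrans (wX a j) _; rewrite /= -/k0 -/k1 (negbTE jk0) /=.
  case: (eqVneq j k1) => [->|jk1]; first by rewrite expr1 mulN1r /sw tpermR.
  by rewrite expr0 mul1r /sw tpermD // eq_sym.
have e2 : wact (simple (labs a)) f = psi (xvar k0) f.
  apply: (substE (wact (simple (labs a))) (psi _)) => [c|j jk0].
    exact: etrans (wact_C _ c) (esym (psi_C _ c)).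
  rewrite psi_xvar; apply: etrans (wX (labs a) j) _.
  rewrite labs_box expr0 mul1r /sw pos1_labs pos2_labs.
  case: (eqVneq j k1) => [->|jk1]; first by rewrite tpermR.
  by rewrite tpermD // eq_sym.
have psiE v : psi v f = (univ k1 f)`_0 + (univ k1 f)`_1 * v by rewrite -lin.
have d1 : dd a f = (univ k1 f)`_1.
  apply: dd_unique; rewrite e1 psiE [X in X - _]fE /rt /sgl /= -/k0 -/k1.
  by rewrite -[mX _ k0]/(xvar k0) -[mX _ k1]/(xvar k1); exact: box_algebra1.
have d2 : dd (labs a) f = (univ k1 f)`_1.
  apply: dd_unique; rewrite e2 psiE [X in X - _]fE /rt /sgl labs_box pos1_labs pos2_labs.
  by rewrite -[mX _ (pos1 a)]/(xvar k0) -[mX _ (pos2 a)]/(xvar k1); exact: box_algebra2.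
by rewrite d1 d2.
Qed.
End Univariate.

Section TypeA.
Variable n : nat.
Implicit Types (a : letter n) (u : 'S_n) (t : seq (letter n)).
Local Notation W := (wperm (omega0 n)).

Lemma size_prod_bound (T : nzRingType) (I : Type) (r : seq I) (P : pred I)
    (F : I -> {poly T}) (d : I -> nat) :
  (forall i, P i -> (size (F i) <= (d i).+1)%N) ->
  (size (\prod_(i <- r | P i) F i)%R <= (\sum_(i <- r | P i) d i).+1)%N.
Proof.
move=> Fd; elim/big_ind2: _ => [|p d1 q d2 sp sq|//]; first by rewrite size_poly1.
by rewrite (leq_trans (size_polyMleq _ _)) //; lia.
Qed.

Definition flipDelta : polyXY n := flipXY (Delta n).

Lemma flipDeltaE : flipDelta =
  \prod_(i < n) \prod_(j < n | (i.+1 + j.+1 <= n)%N) (xvar (rev_ord i) + yvar j).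
Proof.
rewrite /flipDelta /Delta rmorph_prod; apply: eq_bigr => i _ /=.
rewrite rmorph_prod; apply: eq_bigr => j _ /=.
by rewrite rmorphB /= flipXY_xvar flipXY_yvar opprK.
Qed.

Lemma staircase_flipDelta : staircase flipDelta.
Proof.
move=> k; rewrite flipDeltaE rmorph_prod /=.
have row (i : 'I_n) : predT i -> (size (univ k (\prod_(j < n | (i.+1 + j.+1 <= n)%N)
      (xvar (rev_ord i) + yvar j)))
    <= (\sum_(j < n | (i.+1 + j.+1 <= n)%N) (rev_ord i == k)).+1)%N.
  rewrite rmorph_prod /= => _; apply: size_prod_bound => j _.
  rewrite rmorphD /= univ_xvar univ_C (leq_trans (size_polyD _ _)) // geq_max.
  apply/andP; split; last by rewrite (leq_trans (size_polyC_leq1 _)).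
  case: ifP => _; first by rewrite size_polyX.
  exact: size_polyC_leq1.
apply: leq_trans (size_prod_bound _ row) _.
rewrite ltnS (bigD1 (rev_ord k)) //= [X in (_ + X)%N]big1 ?addn0; last first.
  move=> i ik; rewrite big1 // => j _; case: (eqVneq (rev_ord i) k) => // e.
  by case/eqP: ik; rewrite -e rev_ordK.
rewrite rev_ordK eqxx.
rewrite (eq_bigl (fun j : 'I_n => (j < k)%N)) => [|j].
  by rewrite -(big_ord_widen n (fun _ => 1%N) (ltnW (ltn_ord k))) sum1_card card_ord.
by have := ltn_ord k; rewrite /=; lia.
Qed.

Lemma staircase_chain f t : nobox t -> staircase f -> staircase (chain f t).
Proof.
elim: t => [|a t IHt] nt sf; first exact: sf.
move/andP: nt => [na nt]; exact: staircase_dd na (IHt nt sf).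
Qed.

Lemma pact_rho_omega0 k : pact (rho (n := n)) W k = (n.-1)%:Z - rho k.
Proof.
rewrite /pact wbar_wperm wabs_wperm permE expr0 mul1r /rho /=.
by have := ltn_ord k; lia.
Qed.

(** Up to a constant, which the roots of S_n do not see, [omega0] changes the sign
    of [rho]. *)
Lemma desc_omega0 u a : ~~ is_box a -> desc (W^-1 * wperm u)%g a = ~~ desc (wperm u) a.
Proof.
move=> na; rewrite /desc (eq_rt a (pactM (rho (n := n)) W^-1%g (wperm u))).
have -> : (W^-1 = W)%g by apply/eqP; rewrite eq_invg_mul wpermW.
rewrite (eq_rt a (eq_pact (wperm u) pact_rho_omega0)).
have -> : rt (pact (fun k => (n.-1)%:Z - rho k) (wperm u)) a
    = - rt (pact (rho (n := n)) (wperm u)) a.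
  by rewrite /rt /pact /sgl (negbTE na) !wbar_wperm; ring.
by rewrite oppr_lt0 -leNgt lt_neqAle eq_sym rho_neq0.
Qed.

Definition famA u : polyXY n := fam W flipDelta (wperm u).

Lemma staircase_famA u : staircase (famA u).
Proof.
apply: staircase_chain staircase_flipDelta.
apply: (@reduced_nobox _ _ (omega0 n * u^-1)%g); first exact: reduced_reduced_word.
by rewrite wordprod_reduced wpermV -wpermM.
Qed.

Lemma dd_famA u a :
  dd a (famA u) = if desc (wperm u) (labs a) then famA (sw a * u)%g else 0.
Proof.
have key b : ~~ is_box b ->
    dd b (famA u) = if desc (wperm u) b then famA (sw b * u)%g else 0.
  move=> nb; rewrite /famA dd_fam desc_omega0 // wperm_sw.
  have -> : labs b = b by case: (b) nb.
  by case: (desc (wperm u) b).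
case: a => [i|b]; first exact: key.
have nb : ~~ is_box (labs (inr b)) by [].
have swE : sw (labs (inr b)) = sw (inr b) by rewrite /sw pos1_labs pos2_labs.
apply: etrans (staircase_box b (staircase_famA u)) _.
by have := key _ nb; rewrite swE; exact.
Qed.
End TypeA.

(** * Values of the kernel at the points of an orbit *)

(** The differences [s k - k] have the sum 0. *)
Lemma perm_ge_id n (s : 'S_n) : (forall k : 'I_n, k <= s k)%N -> s = 1%g.
Proof.
move=> ge; have sumE : (\sum_(k < n) (s k - k) = 0)%N.
  rewrite sumnB => [|k _]; last exact: ge.
  rewrite [X in (X - _)%N](_ : _ = \sum_(k < n) k)%N ?subnn //.
  by rewrite [RHS](reindex_inj (@perm_inj _ s)).
apply/permP => k; rewrite perm1; apply: val_inj; apply/eqP; rewrite eqn_leq ge andbT.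
by move/eqP: sumE; rewrite sum_nat_eq0 => /forallP/(_ k); rewrite implyTb subn_eq0.
Qed.

Lemma sumprod_pairs n (T : idomainType) (x : 'I_n -> T) :
  sumprod (map x (enum 'I_n)) = pairs (fun i j => x i + x j).
Proof.
rewrite prod_pairs.
elim: n x => [|n IHn] x; first by rewrite big_ord0 enum_ord0.
rewrite enum_ordSl /= -map_comp big_ord_recl [in RHS]big_pred0 // mul1r.
rewrite (IHn (x \o lift ord0)) big_map big_enum /= -big_split /=.
apply: eq_bigr => j _; rewrite [RHS]big_mkcond big_ord_recl /=.
by rewrite [in LHS]big_mkcond.
Qed.

(** If the same variables carry different signs at both points, then they do so
    for at least two variables, by the parity condition. *)
Lemma pairsum_sign (T : comNzRingType) m (b c : pred 'I_m.+1) (z : 'I_m.+1 -> T) :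
  let lin x := linprod (index_enum 'I_m.+1) xpredT x in
  \big[addb/false]_k b k = false -> \big[addb/false]_k c k = false ->
  ~~ [forall k, b k == c k] ->
  pairsum m (wQ (lin (fun k => (-1) ^+ b k * z k)))
    (wQ (lin (fun k => (-1) ^+ c k * z k))) = 0.
Proof.
set n := m.+1; move=> lin b0 c0; rewrite negb_forall => /existsP[i bci].
have [j ji bcj] : exists2 j, j != i & b j != c j.
  have : \big[addb/false]_k (b k (+) c k) = false by rewrite big_split /= b0 c0.
  rewrite (bigD1 i) //= => e.
  case: (pickP (fun j => (j != i) && (b j != c j))) => [j /andP[]|no]; first by exists j.
  move: e; rewrite big1 => [|k ki]; first by case: (b i) (c i) bci => [] [].
  by have := no k; rewrite ki /= => /negbFE/eqP ->; rewrite addbb.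
pose r : pred 'I_n := fun k => (k != i) && (k != j).
have split2 (x : 'I_n -> T) : lin x
    = linprod (index_enum 'I_n) r x * (1 + x i *: 'X) * (1 + x j *: 'X).
  rewrite /lin /linprod (bigD1 i) //= (bigD1 j) //=.
  by rewrite mulrCA -mulrA mulrC [X in _ = X]mulrC mulrAC.
have sgnN k (d e : bool) : d != e -> (-1) ^+ e * z k = - ((-1) ^+ d * z k).
  by case: d e => [] [] // _; rewrite expr0 expr1 mul1r mulN1r ?opprK.
have m0 : (0 < m)%N.
  by move: (ltn_ord i) (ltn_ord j) ji; rewrite -val_eqE /=; lia.
have cr : (count r (index_enum 'I_n)).+1 = m.
  have <- : #|r| = count r (index_enum 'I_n).
    by rewrite -sum1_card -sum1_count; apply: eq_bigl.
  have cC : #|[predC r]| = 2%N.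
    have -> : 2%N = #|[set i; j]| by rewrite cards2 eq_sym ji.
    by apply: eq_card => k; rewrite !inE /r negb_and !negbK.
  by have := cardC r; rewrite cC card_ord addn2 => -[].
rewrite !split2 (sgnN i _ _ bci) (sgnN j _ _ bcj) !scaleNr.
apply: pairsum_wQ_flip2 => //; try exact: linprod0.
- by move=> k; apply: q2_diag_linprod => l; rewrite !exprMn !sqrr_sign.
- by rewrite (leq_trans (size_linprod _ _ _)) // cr.
- by rewrite (leq_trans (size_linprod _ _ _)) // cr.
Qed.
Section Points.
Variable m : nat.
Local Notation n := m.+1.
Local Notation z := (@mX n Zhalf).
Implicit Types (u v w : weylD n) (i j k : 'I_n).

Lemma z_reg u a : rt (pact z u) a != 0.
Proof.
rewrite -wact_rt; apply: contraNneq (rt_neq0 Zhalf a) => e.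
by rewrite -(wactK u (rt _ a)) e wact0.
Qed.

Lemma z_lin_neq0 i j (b c : bool) : i != j -> (-1) ^+ b * z i + (-1) ^+ c * z j != 0.
Proof.
move=> ij; apply/eqP => /mpolyP/(_ U_(i)%MM) /eqP.
rewrite mcoeff0 mcoeffD -!(rmorph_sign (@mpolyC n Zhalf)) !mcoeffCM !mcoeffX.
by rewrite eqxx eq_mnm1 (eq_sym j) (negbTE ij) mulr0 addr0 mulr1 signr_eq0.
Qed.

Lemma pact_add_neq0 u i j : i != j -> pact z u i + pact z u j != 0.
Proof. by move=> ij; apply: z_lin_neq0; rewrite (inj_eq perm_inj). Qed.

Lemma pact_sub_neq0 u i j : i != j -> pact z u i - pact z u j != 0.
Proof.
move=> ij; rewrite /pact -mulNr -signrN; apply: z_lin_neq0.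
by rewrite (inj_eq perm_inj).
Qed.

(** The point at which [Y] is evaluated: the entries of [v] in reverse order, so
    that [Delta] becomes a product over the pairs of positions. *)
Definition rpt v : 'I_n -> polyY n := fun j => pact z v (rev_ord j).

Lemma evXY_Delta (x y : 'I_n -> polyY n) :
  evXY x (fun j => y (rev_ord j)) (Delta n) = pairs (fun i k => x i - y k).
Proof.
rewrite -staircase_pairs /Delta rmorph_prod; apply: eq_bigr => i _ /=.
rewrite rmorph_prod; apply: eq_bigr => j _ /=.
by rewrite rmorphB /= evXY_xvar evXY_yvar.
Qed.

Lemma evXY_flipDelta (x y : 'I_n -> polyY n) :
  evXY x (fun j => y (rev_ord j)) (flipDelta n) = pairs (fun i k => x (rev_ord i) + y k).
Proof.
rewrite -staircase_pairs flipDeltaE rmorph_prod; apply: eq_bigr => i _ /=.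
rewrite rmorph_prod; apply: eq_bigr => j _ /=.
by rewrite rmorphD /= evXY_xvar evXY_yvar.
Qed.

Lemma lin_reindex (s : 'S_n) (x : 'I_n -> polyY n) : lin (x \o s) = lin x.
Proof.
by rewrite /lin /linprod [RHS](reindex_inj (@perm_inj _ s)).
Qed.

Lemma lin_rev (x : 'I_n -> polyY n) : lin (fun j => x (rev_ord j)) = lin x.
Proof.
by rewrite /lin /linprod [RHS](reindex_inj rev_ord_inj).
Qed.

Lemma lin_pact v : lin (pact z v) = lin (fun k => (-1) ^+ wbar v^-1%g k * z k).
Proof.
rewrite -[RHS](lin_reindex (wabs v)); apply: eq_bigr => k _ /=.
by rewrite /pact wbar_inv permK.
Qed.

End Points.

Section Kernel.
Variable m : nat.
Local Notation n := m.+1.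
Local Notation z := (@mX n Zhalf).
Implicit Types (u v w : weylD n) (i j k : 'I_n).

Definition kernel : polyXY n := Delta n * PtildeXY n.

Lemma bars_even v : \big[addb/false]_k wbar v k = false.
Proof. by rewrite -odd_bars; apply/negbTE; apply: valP v. Qed.

Lemma evXY_kernel u v : evXY (pact z u) (rpt v) kernel =
  pairs (fun i k => pact z u i - pact z v k) *
  (((2^-1 : Zhalf) ^+ m)%:MP * pairsum m (wQ (lin (pact z u))) (wQ (lin (pact z v)))).
Proof.
rewrite /kernel rmorphM /=; congr (_ * _); first exact: evXY_Delta.
by rewrite evXY_PtildeXY (lin_rev (pact z v)).
Qed.

(** Different sign patterns make the second factor vanish.  For the same sign
    pattern, a nonzero first factor forces every entry of [v] to occur in [u] at
    the same place or further to the right. *)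
Lemma kernel_offdiag u v : u != v -> evXY (pact z u) (rpt v) kernel = 0.
Proof.
move=> uv; rewrite evXY_kernel.
case: (boolP [forall k, wbar u^-1%g k == wbar v^-1%g k]) => [/forallP e|ne]; last first.
  have -> : pairsum m (wQ (lin (pact z u))) (wQ (lin (pact z v))) = 0.
    rewrite !lin_pact; exact: pairsum_sign (bars_even _) (bars_even _) ne.
  by rewrite !mulr0.
set D := pairs _; have [->|] := eqVneq D 0; first by rewrite mul0r.
move/prodf_neq0 => /= nz; case/eqP: uv.
pose s := (wabs v * (wabs u)^-1)%g.
have barE w k : wbar w k = wbar w^-1%g (wabs w k) by rewrite wbar_inv permK.
have us k : wabs u (s k) = wabs v k by rewrite permM permKV.
have xE k : pact z u (s k) = pact z v k by rewrite /pact barE us (eqP (e _)) -barE.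
have s1 : s = 1%g.
  apply: perm_ge_id => k; rewrite leqNgt; apply/negP => lt.
  by have := nz (s k, k) lt; rewrite xE subrr eqxx.
have absE : wabs u = wabs v by apply/permP => k; rewrite -us s1 perm1.
by apply: weylD_eqP => // k; rewrite barE absE (eqP (e _)) -barE.
Qed.

Lemma kernel_diag u : evXY (pact z u) (rpt u) kernel =
  pairs (fun i k => pact z u i - pact z u k) * pairs (fun i k => pact z u i + pact z u k).
Proof.
rewrite evXY_kernel; congr (_ * _).
have linE : lin (pact z u) = linprod (map (pact z u) (enum 'I_n)) xpredT id.
  by rewrite /linprod big_map big_enum.
have uniq_x : uniq (map (pact z u) (enum 'I_n)).
  rewrite map_inj_uniq ?enum_uniq // => i j e; apply/eqP; apply: contraT => ij.
  by have := pact_sub_neq0 u ij; rewrite e subrr eqxx.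
have sz : size (map (pact z u) (enum 'I_n)) = n by rewrite size_map size_enum_ord.
rewrite linE (pairsum_wQ_self sz uniq_x) mulrA; have SP := sumprod_pairs (pact z u).
rewrite SP.
have -> : ((2^-1 : Zhalf) ^+ m)%:MP * 2 ^+ m = 1 :> {mpoly Zhalf[n]}.
  rewrite -(rmorph_nat (@mpolyC n Zhalf) 2) -rmorphXn -rmorphM /= -exprMn.
  by rewrite mulVr ?Zhalf_unit2 // expr1n.
by rewrite mul1r.
Qed.

Lemma pairs_neq0 (F : 'I_n -> 'I_n -> polyY n) :
  (forall i j, i != j -> F i j != 0) -> pairs F != 0.
Proof.
move=> nz; apply/prodf_neq0 => -[i j] /= ij; apply: nz.
by rewrite -val_eqE neq_ltn ij.
Qed.

Lemma kernel_diag_neq0 u : evXY (pact z u) (rpt u) kernel != 0.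
Proof.
rewrite kernel_diag mulf_neq0 //; apply: pairs_neq0 => i j ij.
  exact: pact_sub_neq0.
exact: pact_add_neq0.
Qed.
End Kernel.

(** * Values of the two families at one point *)

(** The sign of the reversal, by removing the first position. *)
Lemma odd_omega0 n : odd_perm (omega0 n) = odd (n * n.-1)./2.
Proof.
elim: n => [|n IHn].
  by rewrite (_ : omega0 0 = 1%g) ?odd_perm1 //; apply/permP => -[].
have -> : omega0 n.+1 = lift_perm ord0 ord_max (omega0 n).
  apply/permP => k; apply: val_inj; case: (unliftP ord0 k) => [j|] ->.
    by rewrite lift_perm_lift !permE /= /bump; have := ltn_ord j; lia.
  by rewrite lift_perm_id permE /= subn1.
rewrite odd_lift_perm IHn /= -!bin2 binS bin1 oddD addbC.
by rewrite /=; case: (odd n).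
Qed.

Section TopLength.
Variable n : nat.
Implicit Types (w v : weylD n) (a : letter n).

Lemma exists_desc w : w != 1%g -> exists a, desc w a.
Proof.
move=> w1; case: (pickP (desc w)) => [a|none]; first by exists a.
case/eqP: w1; apply: wlen0_eq; apply/eqP; rewrite -leqn0 leqNgt; apply/negP => l0.
case: (lastP (reduced_word w)) (size_reduced w) (wordprod_reduced w) => [sz|t a sz e].
  by rewrite -sz in l0.
have := wlen_ndesc (negbT (none a)) => l1.
have := wlen_min t; have -> : wordprod t = (w * simple a)%g.
  by rewrite -e -cats1 wordprod_cat wordprod1 -mulgA simple2 mulg1.
by rewrite l1 -sz size_rcons ltnNge leqnSn.
Qed.

(** Along the descents of [w], the length of [w^-1 * v] grows. *)
Lemma wlen_below_top (v : weylD n) (U : pred (weylD n)) :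
  (forall w a, U w -> desc w a -> U (w * simple a)%g /\ ~~ desc (v^-1 * w)%g a) ->
  forall w, U w -> w != 1%g -> (wlen (w^-1 * v)%g < wlen v)%N.
Proof.
move=> step w; have [l] := ubnP (wlen w); elim: l w => // l IHl w le Uw w1.
have [a wa] := exists_desc w1; have [Uwa nd] := step w a Uw wa.
have up : wlen ((w * simple a)^-1 * v)%g = (wlen (w^-1 * v)%g).+1.
  rewrite invMg simpleV -mulgA; apply: wlen_simple_ndesc.
  by rewrite invMg invgK.
have [e|wa1] := eqVneq (w * simple a)%g 1%g.
  by rewrite -up e invg1 mul1g.
have lt : (wlen (w * simple a)%g < l)%N by rewrite -ltnS -(wlen_desc wa).
by have := IHl _ lt Uwa wa1; rewrite up; apply: ltn_trans; apply: ltnSn.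
Qed.
End TopLength.

Lemma cancel_signD (T : idomainType) (g iv s f iv1 e A B : T) :
  g * iv = s * f * iv1 -> iv = A * (e * B) -> s = 1 -> f = A * B -> iv1 = 1 ->
  A != 0 -> B != 0 -> e * e = 1 -> e * g = 1.
Proof.
move=> h ivE s1 fE i1 A0 B0 ee; rewrite ivE s1 fE i1 mul1r mulr1 in h.
apply: (mulIf (mulf_neq0 A0 B0)); rewrite mul1r -[RHS]h.
by ring.
Qed.

Lemma cancel_signA (T : idomainType) (g iv s f iv1 e A : T) :
  g * iv = s * f * iv1 -> iv = e * A -> s = e -> f = A -> iv1 = 1 ->
  A != 0 -> e * e = 1 -> g = 1.
Proof.
move=> h ivE sE fE i1 A0 ee; rewrite ivE sE fE i1 mulr1 in h.
have e0 : e != 0.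
  by apply: contra_eq_neq ee => ->; rewrite mul0r eq_sym oner_neq0.
by apply: (mulIf (mulf_neq0 e0 A0)); rewrite mul1r.
Qed.

Section Normalization.
Variable m : nat.
Local Notation n := m.+1.
Local Notation z := (@mX n Zhalf).
Local Notation W := (wperm (omega0 n)).
Implicit Types (u v w : weylD n) (i j k : 'I_n).

Definition eps (T : pzRingType) : T := (-1) ^+ (n * n.-1)./2.

Lemma epsM (T : pzRingType) : eps T * eps T = 1.
Proof. by rewrite /eps -expr2 sqrr_sign. Qed.

Lemma schubertD_fam w : schubertD w = eps _ * fam (w0 n) (kernel m) w.
Proof. by rewrite /schubertD /ddiff'_w foldr_ddiff'. Qed.

Lemma dd_schubertD w a :
  dd a (schubertD w) = if desc w a then schubertD (w * simple a)%g else 0.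
Proof.
rewrite !schubertD_fam dd_mul; last by rewrite rmorphXn rmorphN1.
by rewrite dd_famD; case: ifP => _ //; rewrite mulr0.
Qed.

Lemma invprod1 (x : 'I_n -> polyY n) : invprod x (pact (rho (n := n)) 1%g) = 1.
Proof.
rewrite (eq_invprod (frefl x) (pact1 (rho (n := n)))).
rewrite /invprod /pairs big1 // => -[i j] /= ij; rewrite /pairfac /negfac /rho.
have -> : (j%:Z - i%:Z < 0) = false by lia.
have -> : (j%:Z + i%:Z < 0) = false by lia.
by rewrite mulr1.
Qed.

Lemma invprod_w0 (x : 'I_n -> polyY n) : invprod x (pact (rho (n := n)) (w0 n)) =
  pairs (fun i j => x i - x j) * (eps _ * pairs (fun i j => x i + x j)).
Proof.
rewrite (eq_invprod (frefl x) (@pact_rho_w0 n)) /eps -pairsN -pairsM.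
apply: eq_pairs => i j ij; rewrite /pairfac /negfac /rho.
have -> : (- j%:Z - - i%:Z < 0) = true by lia.
have -> : (- j%:Z + - i%:Z < 0) = true by lia.
by rewrite opprB [x j + _]addrC.
Qed.

Lemma invprod_omega0 (x : 'I_n -> polyY n) :
  invprod x (pact (rho (n := n)) W) = pairs (fun i j => x i - x j).
Proof.
rewrite (eq_invprod (frefl x) (@pact_rho_omega0 n)).
apply: eq_pairs => i j ij; rewrite /pairfac /negfac /rho.
have := ltn_ord j => jn.
have -> : (n.-1%:Z - j%:Z - (n.-1%:Z - i%:Z) < 0) = true by lia.
have -> : (n.-1%:Z - j%:Z + (n.-1%:Z - i%:Z) < 0) = false by lia.
by rewrite opprB mulr1.
Qed.

Local Notation ev := (evXY (pact z 1%g) (rpt (w0 n))).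

Lemma kernel_supp u : predT u -> u != w0 n ->
  evXY (pact z u) (rpt (w0 n)) (kernel m) = 0.
Proof. by move=> _; apply: kernel_offdiag. Qed.

(** For [w != 1], the word is too short to lead from 1 to [w0].  For [w = 1], the
    product of the negative roots is the value of the kernel, up to the sign
    [eps]; the length of [w0] is even. *)
Lemma schubertD_value w : ev (schubertD w) = (w == 1%g)%:R.
Proof.
rewrite schubertD_fam rmorphM rmorphXn rmorphN1 /=.
have [->|w1] := eqVneq w 1%g.
  have t1 : (1 * wordprod (reduced_word (1^-1 * w0 n)%g))%g = w0 n.
    by rewrite wordprod_reduced invg1 !mul1g.
  have l1 : (wlen (1%g : weylD n) + size (reduced_word (1^-1 * w0 n)%g) = wlen (w0 n))%N.
    by rewrite wlen1 size_reduced invg1 mul1g.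
  have h := ev_chain_value (@z_reg m) (L := predT) (U := predT) (fun _ _ _ _ => isT)
    kernel_supp (all_predT _) isT t1 l1.
  have s1 : (-1) ^+ size (reduced_word (1^-1 * w0 n)%g) = 1 :> polyY n.
    by rewrite -signr_odd sign_word wordprod_reduced invg1 mul1g odd_perm1.
  apply: (cancel_signD h (invprod_w0 _) s1 (kernel_diag _) (invprod1 _)).
  - by apply: pairs_neq0 => i j; apply: pact_sub_neq0.
  - by apply: pairs_neq0 => i j; apply: pact_add_neq0.
  - exact: epsM.
have -> : ev (fam (w0 n) (kernel m) w) = 0; last by rewrite mulr0.
apply: (ev_chain_vanish (@z_reg m) (L := predT) (U := predT) (fun _ _ _ _ => isT)
  kernel_supp (all_predT _) isT).
rewrite size_reduced invg1 mul1g; apply: (wlen_below_top (U := predT)) => // v a _ va.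
by rewrite desc_w0 va.
Qed.

Lemma pact_w0 (x : 'I_n -> polyY n) k : (0 < k)%N -> pact x (w0 n) k = - x k.
Proof.
move=> k0; rewrite /pact /wabs /wbar /= ffunE perm1.
have -> : (val k != 0%N) by rewrite -lt0n.
by case: (odd m); rewrite /= expr1 mulN1r.
Qed.

Lemma pact_wperm (x : 'I_n -> polyY n) (s : 'S_n) k : pact x (wperm s) k = x (s k).
Proof. by rewrite /pact wbar_wperm expr0 mul1r. Qed.

Lemma evXY_flipDelta_w0 (s : 'S_n) :
  evXY (pact z (wperm s)) (rpt (w0 n)) (flipDelta n)
  = pairs (fun i k => z (s (rev_ord i)) - z k).
Proof.
rewrite (evXY_flipDelta (pact z (wperm s)) (pact z (w0 n))).
apply: eq_pairs => i k ik; rewrite pact_wperm pact_w0 //.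
exact: leq_ltn_trans ik.
Qed.

Definition unbarred : pred (weylD n) := fun w => w == wperm (wabs w).

Lemma unbarredP w : reflect (exists s, w = wperm s) (unbarred w).
Proof.
by apply: (iffP eqP) => [->|[s ->]] //; exists (wabs w).
Qed.

Lemma unbarredM w a : unbarred w -> ~~ is_box a -> unbarred (w * simple a)%g.
Proof.
move=> /unbarredP[s ->] na; apply/unbarredP; exists (sw a * s)%g.
by rewrite simple_nobox // wpermM.
Qed.

Lemma flipDelta_supp w : unbarred w -> w != W ->
  evXY (pact z w) (rpt (w0 n)) (flipDelta n) = 0.
Proof.
case/unbarredP => s ->{w} sW; rewrite evXY_flipDelta_w0.
set D := pairs _; have [//|] := eqVneq D 0; move/prodf_neq0 => /= nz.
case/eqP: sW; congr wperm; have so : (s * omega0 n = 1)%g.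
  apply: perm_ge_id => k; rewrite leqNgt permM permE; apply/negP => lt.
  have lt' : (rev_ord k < s k)%N.
    by move: lt; rewrite /=; have := ltn_ord k; have := ltn_ord (s k); lia.
  by have := nz (rev_ord k, s k) lt'; rewrite /= rev_ordK subrr eqxx.
by rewrite -[s]mulg1 -(omega0K n) mulgA so mul1g.
Qed.

(** The same argument in S_n, where the product of the negative roots and the
    value of [flipDelta] differ by [eps], which is the sign of [omega0]. *)
Lemma famA_value (s : 'S_n) : ev (famA s) = (s == 1%g)%:R.
Proof.
have nb : all (fun a => ~~ is_box a) (reduced_word ((wperm s)^-1 * W)%g).
  apply: (@reduced_nobox _ _ (omega0 n * s^-1)%g); first exact: reduced_reduced_word.
  by rewrite wordprod_reduced wpermV -wpermM.
have U1 : unbarred 1%g by apply/unbarredP; exists 1%g; rewrite wperm1.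
have [s1|s1] := eqVneq s 1%g.
  rewrite s1 wperm1 in nb; rewrite /famA s1 wperm1.
  have t1 : (1 * wordprod (reduced_word (1^-1 * W)%g))%g = W.
    by rewrite wordprod_reduced invg1 !mul1g.
  have l1 : (wlen (1%g : weylD n) + size (reduced_word (1^-1 * W)%g) = wlen W)%N.
    by rewrite wlen1 size_reduced invg1 mul1g.
  have h := ev_chain_value (@z_reg m) (U := unbarred) unbarredM
    flipDelta_supp nb U1 t1 l1.
  have sg : (-1) ^+ size (reduced_word (1^-1 * W)%g) = eps (polyY n).
    by rewrite -signr_odd sign_word wordprod_reduced invg1 mul1g odd_omega0 signr_odd.
  have iv : invprod (pact z W) (pact (rho (n := n)) W)
      = eps (polyY n) * pairs (fun i k => z i - z k).
    rewrite invprod_omega0 /eps -pairsN.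
    rewrite (eq_pairs (G := fun i k => z (rev_ord i) - z (rev_ord k))); last first.
      by move=> i k _; rewrite !pact_wperm !permE.
    rewrite (pairs_rev (fun i k => z i - z k)).
    by apply: eq_pairs => i k _; rewrite opprB.
  have fv : evXY (pact z W) (rpt (w0 n)) (flipDelta n) = pairs (fun i k => z i - z k).
    rewrite evXY_flipDelta_w0; apply: eq_pairs => i k _.
    by rewrite permE rev_ordK.
  have nz : pairs (fun i k => z i - z k) != 0.
    by apply: pairs_neq0 => i j ij; have := pact_sub_neq0 1%g ij; rewrite !pact1.
  exact: (cancel_signA h iv sg fv (invprod1 _) nz (epsM _)).
apply: (ev_chain_vanish (@z_reg m) (U := unbarred) unbarredM flipDelta_supp nb U1).
rewrite size_reduced invg1 mul1g; apply: (wlen_below_top (U := unbarred)).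
- move=> w a /unbarredP[t ->] d.
  have na : ~~ is_box a by apply: contraL d => /(ndesc_wperm_box t).
  split; last by rewrite desc_omega0 // d.
  by apply: unbarredM => //; apply/unbarredP; exists t.
- by apply/unbarredP; exists s.
- by apply: contra s1 => /eqP/(congr1 (@wabs n)) => e; apply/eqP.
Qed.
End Normalization.

(** * Uniqueness *)

(** As a factor of an invertible matrix of size [q], the matrix [N] has rank at
    least [q], and it only has [p] rows. *)
Lemma diag_product_inj (T : idomainType) p q (G : 'M[T]_(q, p)) (N : 'M[T]_(p, q))
    (g : 'rV[T]_p) : (p <= q)%N ->
  (forall i j, i != j -> (G *m N) i j = 0) -> (forall i, (G *m N) i i != 0) ->
  g *m N = 0 -> g = 0.
Proof.
move=> pq off dia gN; pose phi := @tofrac T.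
have unitGN : map_mx phi G *m map_mx phi N \in unitmx.
  rewrite -map_mxM unitmxE unitfE.
  have -> : map_mx phi (G *m N) = diag_mx (\row_i phi ((G *m N) i i)).
    apply/matrixP => i j; rewrite [LHS]mxE [RHS]mxE [X in X *+ _]mxE.
    case: eqVneq => [->|ij]; first by rewrite mulr1n.
    by rewrite (off _ _ ij) mulr0n /phi tofrac0.
  rewrite det_diag; apply/prodf_neq0 => i _; rewrite mxE.
  by rewrite /phi tofrac_eq0 dia.
have freeN : row_free (map_mx phi N).
  rewrite -row_leq_rank (leq_trans pq) //.
  apply: leq_trans (mxrankM_maxr (map_mx phi G) (map_mx phi N)).
  by rewrite (mxrank_unit unitGN).
have /eqP : map_mx phi g *m map_mx phi N = 0 by rewrite -map_mxM gN map_mx0.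
rewrite mulmx_free_eq0 // => /eqP g0; apply/matrixP => i j.
have /matrixP/(_ i j) := g0; rewrite !mxE => /eqP.
by rewrite /phi tofrac_eq0 => /eqP.
Qed.

Section Span.
Variable m : nat.
Local Notation n := m.+1.
Local Notation z := (@mX n Zhalf).
Local Notation P := (polyY n).
Implicit Types (u v w : weylD n) (i j k : 'I_n) (f g : polyXY n) (h : P).

(** Polynomials in [X] alone are represented in the ring [P], which also contains
    the values of [evXY]. *)
Definition inX : P -> polyXY n := map_mpoly (@mpolyC n Zhalf).
HB.instance Definition _ := GRing.RMorphism.on inX.

Lemma inX_X i : inX (z i) = xvar i.
Proof. by rewrite /inX map_mpolyX. Qed.

Lemma inX_C c : inX c%:MP = (c%:MP)%:MP.
Proof. by rewrite /inX map_mpolyC. Qed.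

Lemma wact_inX w h : wact w (inX h) = inX (wact w h).
Proof.
move: h; apply: (@eq_mpoly_morph _ _ _ (wact w \o inX) (inX \o wact w)) => [c|i] /=.
  by rewrite wact_C !inX_C wact_C.
have h1 : wact w (inX (z i)) = pact (@mX n P) w i by rewrite inX_X; apply: wact_X.
have h2 : inX (wact w (z i)) = pact (@mX n P) w i.
  by rewrite wact_X /pact rmorphM rmorphXn rmorphN1 /= inX_X.
exact: etrans h1 (esym h2).
Qed.

Lemma dd_inX a h c : dd a (inX h * c%:MP) = inX (dd a h) * c%:MP.
Proof.
apply: dd_unique; rewrite wact_mul wact_C wact_inX -mulrBl -rmorphB -ddE rmorphM /=.
have -> : inX (rt z a) = rt (@mX n P) a.
  rewrite /rt /sgl rmorphD rmorphM /= !inX_X.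
  by case: ifP; rewrite ?rmorphN1 ?rmorph1.
exact: mulrA.
Qed.

(** The exponents of [y_j] in [Delta] are at most [n - 1 - j]. *)
Definition stairs : pred {ffun 'I_n -> 'I_n} :=
  family (fun j => [pred b : 'I_n | (b < n - j)%N]).

Definition spanIndex : Type := ({ffun 'I_n -> 'I_n} * {set 'I_n.-1})%type.
Definition indices : pred spanIndex := [pred p | stairs p.1].
Definition ymon (b : {ffun 'I_n -> 'I_n}) : P := \prod_j 'X_j ^+ b j.
Definition basisY (p : spanIndex) : P := ymon p.1 * Ptilde n (strict_part (~: p.2)).

(** Combinations of the products of staircase monomials and [Ptilde]
    polynomials in [Y], with coefficients in [X].  There are no more of these
    products than elements of the Weyl group. *)
Definition spanned f :=
  exists g : spanIndex -> P, f = \sum_(p | indices p) inX (g p) * (basisY p)%:MP.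

Lemma spannedB f1 f2 : spanned f1 -> spanned f2 -> spanned (f1 - f2).
Proof.
move=> [g1 ->] [g2 ->]; exists (fun p => g1 p - g2 p).
by rewrite -sumrB; apply: eq_bigr => p _; rewrite rmorphB mulrBl.
Qed.

Lemma spannedD f1 f2 : spanned f1 -> spanned f2 -> spanned (f1 + f2).
Proof.
move=> [g1 ->] [g2 ->]; exists (fun p => g1 p + g2 p).
by rewrite -big_split; apply: eq_bigr => p _; rewrite rmorphD mulrDl.
Qed.

Lemma spanned0 : spanned 0.
Proof.
by exists (fun=> 0); rewrite big1 // => p _; rewrite rmorph0 mul0r.
Qed.

Lemma spanned_sum (I : finType) (A : pred I) (F : I -> polyXY n) :
  (forall x : I, A x -> spanned (F x)) -> spanned (\sum_(x | A x) F x).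
Proof. by move=> FS; apply: big_ind => //; [exact: spanned0 | exact: spannedD]. Qed.

Lemma spanned_sign d f : spanned f -> spanned ((-1) ^+ d * f).
Proof.
move=> sf; rewrite -signr_odd; case: (odd d); last by rewrite expr0 mul1r.
by rewrite expr1 mulN1r -sub0r; apply: spannedB; [exact: spanned0 | exact: sf].
Qed.

Lemma spanned_dd a f : spanned f -> spanned (dd a f).
Proof.
move=> [g ->]; exists (fun p => dd a (g p)).
by rewrite dd_sum; apply: eq_bigr => p _; apply: dd_inX.
Qed.

Lemma spanned_chain f (t : seq (letter n)) : spanned f -> spanned (chain f t).
Proof. by move=> sf; elim: t => [|a t IHt]; [exact: sf | exact: spanned_dd]. Qed.

(** The product of a column is a polynomial in one [y_j], of degree [n - 1 - j]. *)
Lemma stairs_expand (F : 'I_n -> P) (e : P) : exists c,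
  \prod_(i < n) \prod_(j < n | (i.+1 + j.+1 <= n)%N) (inX (F i) + inX e * yvar j)
  = \sum_(b | stairs b) inX (c b) * (ymon b)%:MP.
Proof.
pose q (j : 'I_n) : {poly P} := \prod_(i < n | (i.+1 + j.+1 <= n)%N) ((F i)%:P + e *: 'X).
have size_q j : (size (q j) <= n - j)%N.
  apply: leq_trans (size_prod_bound (d := fun=> 1%N) _ _) _ => [i _|].
    rewrite (leq_trans (size_polyD _ _)) // geq_max size_polyC (leq_trans (leq_b1 _)) //.
    by rewrite (leq_trans (size_scale_leq _ _)) // size_polyX.
  rewrite (eq_bigl (fun i : 'I_n => (i < n.-1 - j)%N)) => [|i]; last by lia.
  rewrite -(big_ord_widen n (fun _ => 1%N)); last by have := ltn_ord j; lia.
  by rewrite sum1_card card_ord; have := ltn_ord j; lia.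
have col j : \prod_(i < n | (i.+1 + j.+1 <= n)%N) (inX (F i) + inX e * yvar j)
    = \sum_(b < n | (b < n - j)%N) inX (q j)`_b * yvar j ^+ b.
  have <- : (map_poly inX (q j)).[yvar j]
      = \prod_(i < n | (i.+1 + j.+1 <= n)%N) (inX (F i) + inX e * yvar j).
    rewrite /q rmorph_prod horner_prod; apply: eq_bigr => i _.
    by rewrite rmorphD /= map_polyC map_polyZ map_polyX !hornerE.
  have le : (size (map_poly inX (q j)) <= n)%N.
    by rewrite (leq_trans (size_poly _ _)) // (leq_trans (size_q j)) // leq_subr.
  rewrite (horner_coef_wide _ le) [RHS]big_mkcond; apply: eq_bigr => b _.
  rewrite coef_map; case: ltnP => // lt.
  have -> : (q j)`_b = 0 by apply: nth_default; exact: leq_trans (size_q j) lt.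
  by rewrite raddf0 mul0r.
exists (fun b : {ffun 'I_n -> 'I_n} => \prod_j (q j)`_(b j)).
rewrite (exchange_big_dep predT) //=; under eq_bigr => j _ do rewrite col.
rewrite bigA_distr_big_dep; apply: eq_bigr => b _.
rewrite big_split /= -rmorph_prod; congr (_ * _).
rewrite /ymon rmorph_prod /=; apply: eq_bigr => j _.
by rewrite rmorphXn.
Qed.
End Span.

Section SpanUnique.
Variable m : nat.
Local Notation n := m.+1.
Local Notation z := (@mX n Zhalf).
Local Notation P := (polyY n).
Implicit Types (u v w : weylD n) (i j k : 'I_n) (f g : polyXY n) (h : P).

Lemma kernel_spanned : spanned (kernel m).
Proof.
have [c cE] := stairs_expand z (-1).
have DE : Delta n = \sum_(b | stairs b) inX (c b) * (ymon b)%:MP.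
  rewrite -cE; apply: eq_bigr => i _; apply: eq_bigr => j _.
  by rewrite inX_X rmorphN1 mulN1r.
pose F (b : {ffun 'I_n -> 'I_n}) (S : {set 'I_n.-1}) : polyXY n :=
  inX (c b * Ptilde n (strict_part S)) * (basisY (b, S))%:MP.
exists (fun p => c p.1 * Ptilde n (strict_part p.2)).
rewrite /kernel DE /PtildeXY big_distrlr /= (pair_big _ _) /=.
apply: eq_big => [p|p _]; first by rewrite andbT.
rewrite /basisY !rmorphM /=; exact: mulrACA.
Qed.

Lemma evY_z h : evY z h = h.
Proof.
by move: h; apply: (@eq_mpoly_morph _ _ _ (evY z) idfun) => [c|i] /=;
   rewrite ?evY_C ?evY_X.
Qed.

Lemma Ptilde_nil : Ptilde n [::] = 1.
Proof.
by rewrite /Ptilde /= expr0 scale1r -[LHS]evY_z evY_Qtilde.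
Qed.

Lemma flipDelta_spanned : spanned (flipDelta n).
Proof.
have [c cE] := stairs_expand (fun i => z (rev_ord i)) 1.
have DE : flipDelta n = \sum_(b | stairs b) inX (c b) * (ymon b)%:MP.
  rewrite -cE flipDeltaE; apply: eq_bigr => i _; apply: eq_bigr => j _.
  by rewrite inX_X rmorph1 mul1r.
(* The index [setT] stands for the empty partition, by the complement in
   [basisY]. *)
exists (fun p => if p.2 == setT then c p.1 else 0).
rewrite DE (eq_bigl (fun p : spanIndex m => stairs p.1 && predT p.2)); last first.
  by move=> p; rewrite andbT.
rewrite -(pair_big (@stairs m) predT (fun b S => inX (if S == setT then c b else 0)
  * (basisY (b, S))%:MP)) /=.
apply: eq_bigr => b _; rewrite (bigD1 setT) //= eqxx big1 ?addr0 => [|S /negbTE->].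
  rewrite /basisY /= setCT.
  have -> : strict_part (set0 : {set 'I_n.-1}) = [::].
    by rewrite /strict_part enum_set0.
  by rewrite Ptilde_nil mulr1.
by rewrite raddf0 mul0r.
Qed.

(** One bit of a barred permutation is determined by the others. *)
Definition extend_bars (S : {set 'I_m}) : {ffun 'I_n -> bool} :=
  [ffun k => if unlift ord0 k is Some j then j \in S else odd #|S|].

Lemma extend_bars_even (s : 'S_n) (S : {set 'I_m}) :
  ~~ odd #|[set k | (s, extend_bars S).2 k]|.
Proof.
rewrite odd_bars big_ord_recl /= ffunE unlift_none.
have -> : odd #|S| = \big[addb/false]_(j < m) (j \in S).
  rewrite -odd_bars; congr (odd _); apply: eq_card => j; by rewrite inE.
rewrite (eq_bigr (fun j : 'I_m => j \in S)) ?addbb // => j _.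
by rewrite ffunE liftK.
Qed.

Lemma card_subsets : #|{: {set 'I_m}}| = (2 ^ m)%N.
Proof. by rewrite -cardsT -powersetT card_powerset cardsT card_ord. Qed.

Lemma card_weylD_ge : (n`! * 2 ^ m <= #|{: weylD n}|)%N.
Proof.
pose F (p : 'S_n * {set 'I_m}) : weylD n := WeylD (extend_bars_even p.1 p.2).
have F_inj : injective F.
  move=> [s S] [t T] e; have st : s = t := congr1 (@wabs n) e.
  congr (_, _) => //; apply/setP => j.
  have := congr1 (fun w => wbar w (lift ord0 j)) e.
  by rewrite /wbar /= !ffunE liftK.
have := leq_card F F_inj; rewrite card_prod card_Sn.
by rewrite card_subsets.
Qed.

Lemma card_indices : (#|@indices m| <= #|{: weylD n}|)%N.
Proof.
apply: leq_trans card_weylD_ge.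
have -> : #|@indices m| = (#|@stairs m| * #|{: {set 'I_m}}|)%N.
  by rewrite -cardX; apply: eq_card => p; rewrite !inE andbT.
rewrite card_subsets.
rewrite leq_mul2r; apply/orP; right.
rewrite (card_family (fun j : 'I_n => [pred b : 'I_n | (b < n - j)%N])) foldrE big_map.
rewrite big_enum /= (reindex_inj rev_ord_inj) /=.
rewrite fact_prod big_add1 big_mkord; apply: leq_prod => j _.
rewrite (eq_card (B := [pred b : 'I_n | (b < j.+1)%N])).
  by rewrite -sum1_card -(big_ord_widen n (fun _ => 1%N) (ltn_ord j)) sum1_card card_ord.
by move=> b; rewrite !inE; have := ltn_ord j; lia.
Qed.

(** The values of [f] at the point [z] are combinations of its coefficients in
    [X]; the matrix of these combinations is a factor of the diagonal matrix formed
    by the values of the kernel, so its rows are independent. *)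
Lemma spanned_eq0 f : spanned f -> (forall v, evXY z (rpt v) f = 0) -> f = 0.
Proof.
move=> [g fE] f0; have [c cE] := kernel_spanned.
have evE (x y : 'I_n -> P) (d : spanIndex m -> P) :
    evXY x y (\sum_(p | indices p) inX (d p) * (basisY p)%:MP)
    = \sum_(i < #|@indices m|) evY x (d (enum_val i)) * evY y (basisY (enum_val i)).
  rewrite -(big_enum_val (A := @indices m) (fun p => evY x (d p) * evY y (basisY p))).
  rewrite rmorph_sum /=; apply: eq_bigr => p _.
  by rewrite rmorphM /= evXY_map evXY_C.
pose N : 'M[P]_(#|@indices m|, #|{: weylD n}|) :=
  \matrix_(i, j) evY (rpt (enum_val j)) (basisY (enum_val i)).
pose G : 'M[P]_(#|{: weylD n}|, #|@indices m|) :=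
  \matrix_(i, j) evY (pact z (enum_val i)) (c (enum_val j)).
pose r : 'rV[P]_#|@indices m| := \row_i g (enum_val i).
have GN a b : (G *m N) a b = evXY (pact z (enum_val a)) (rpt (enum_val b)) (kernel m).
  by rewrite cE evE mxE; apply: eq_bigr => k _; rewrite !mxE.
have r0 : r = 0.
  apply: (diag_product_inj (G := G) (N := N) card_indices).
  - move=> i j ij; rewrite GN; apply: kernel_offdiag.
    by rewrite (inj_eq enum_val_inj).
  - by move=> i; rewrite GN; apply: kernel_diag_neq0.
  apply/matrixP => i j; rewrite [RHS]mxE -(f0 (enum_val j)) fE evE mxE.
  by apply: eq_bigr => k _; rewrite !mxE evY_z.
rewrite fE big1 // => p pP; have pA : p \in @indices m by [].
have /matrixP/(_ 0 (enum_rank_in pA p)) := r0.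
by rewrite !mxE enum_rankK_in // => ->; rewrite raddf0 mul0r.
Qed.

Lemma rpt_mul v w j : rpt (v * w)%g j = evY (pact z v) (rpt w j).
Proof.
rewrite /rpt pactM {1}/pact {1}[X in _ = evY _ X]/pact rmorphM rmorphXn rmorphN1 /=.
by rewrite evY_X.
Qed.

(** A polynomial killed by all the divided differences is invariant, and then its
    values at the different points are the images of one of them under the
    automorphisms of the ring of values. *)
Lemma spanned_dd_eq0 f v : spanned f -> (forall a, dd a f = 0) ->
  evXY (pact z 1%g) (rpt v) f = 0 -> f = 0.
Proof.
move=> sf df fv; apply: (spanned_eq0 sf) => w.
have inv u : wact u f = f.
  rewrite -(wordprod_reduced u); elim: (reduced_word u) => [|a t IHt].
    by rewrite /wordprod big_nil wact1.
  rewrite wordprod_cons wactM IHt; apply/eqP; rewrite eq_sym -subr_eq0 -ddE df.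
  by rewrite mulr0.
have ev0 : evXY z (rpt v) f = 0.
  by rewrite (eq_evXY (fun k => esym (pact1 z k)) (frefl (rpt v))).
pose u := (w * v^-1)%g.
have evu : evY (pact z u) (evXY z (rpt v) f) = evXY (pact z u) (rpt w) f.
  move: (f); apply: (@eq_mpoly_morph _ _ _ (evY (pact z u) \o evXY z (rpt v))
    (evXY (pact z u) (rpt w))) => [b|i] /=; last first.
    by rewrite -/(xvar i) !evXY_xvar evY_X.
  rewrite !evXY_C; move: (b).
  apply: (@eq_mpoly_morph _ _ _ (evY (pact z u) \o evY (rpt v)) (evY (rpt w))) => [d|i] /=.
    by rewrite !evY_C.
  by rewrite !evY_X -rpt_mul /u mulgKV.
by rewrite -(inv u) evXY_wact -evu ev0 raddf0.
Qed.
End SpanUnique.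

(** * The identity *)

Section Main.
Variable m : nat.
Local Notation n := m.+1.
Implicit Types (u : 'S_n) (w : weylD n).

Lemma schubertD_spanned w : spanned (schubertD w).
Proof.
rewrite schubertD_fam; apply: spanned_sign; apply: spanned_chain.
exact: kernel_spanned.
Qed.

Lemma famA_spanned u : spanned (famA u).
Proof. by apply: spanned_chain; exact: flipDelta_spanned. Qed.

Definition discrepancy u : polyXY n := \sum_(w in Lset u) schubertD w - famA u.

Lemma discrepancy_spanned u : spanned (discrepancy u).
Proof.
apply: spannedB; last exact: famA_spanned.
by apply: spanned_sum => w _; exact: schubertD_spanned.
Qed.

Lemma dd_discrepancy u a :
  dd a (discrepancy u) = if desc (wperm u) (labs a) then discrepancy (sw a * u)%g else 0.
Proof.
rewrite /discrepancy ddD ddN dd_famA (dd_sum_Lset u (fun w => dd_schubertD w a)).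
by case: ifP => _ //; rewrite subr0.
Qed.

Lemma discrepancy_value u :
  evXY (pact (@mX n Zhalf) 1%g) (rpt (w0 n)) (discrepancy u) = 0.
Proof.
rewrite /discrepancy rmorphB rmorph_sum /= famA_value.
under eq_bigr => w _ do rewrite schubertD_value.
have [u1|u1] := eqVneq u 1%g.
  have L1 : 1%g \in Lset u by rewrite LsetE u1 wperm1 eqxx andbT.
  rewrite (bigD1 1%g L1) /= eqxx big1 ?addr0 ?subrr // => w /andP[_ /negbTE->].
  by [].
rewrite big1 ?subr0 // => w; rewrite LsetE => /andP[/eqP wu _].
by have [w1|//] := eqVneq w 1%g; case/eqP: u1; rewrite -wu w1.
Qed.

(** By induction on the length of [u], all the divided differences vanish. *)
Lemma discrepancy_eq0 u : discrepancy u = 0.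
Proof.
have [l] := ubnP (wlen (wperm u)); elim: l u => // l IHl u le.
apply: spanned_dd_eq0 (discrepancy_spanned u) _ (discrepancy_value u) => a.
rewrite dd_discrepancy; case: ifP => // d; apply: IHl.
by rewrite wperm_sw -ltnS -(wlen_desc d).
Qed.
End Main.

Theorem theorem8 (n : nat) (hn : (1 <= n)%N) (u : 'S_n) :
  \sum_(w in Lset u) schubertD w =
  flipXY (schubertA (omega0 n * u * omega0 n)%g).
Proof.
case: n hn u => // m _ u; rewrite flipXY_schubertA; apply/eqP; rewrite -subr_eq0.
exact/eqP/discrepancy_eq0.
Qed.
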